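(* Let $\Bbbk$ be an algebraically closed field of characteristic zero. Let $\mathfrak{g}$ be a finite-dimensional simple Lie algebra over $\Bbbk$ with Serre generators $e_i,f_i$, $i=1,\dots,n$, and let $J$ be a primitive ideal of $U(\mathfrak{g})$. The following conditions are equivalent: (a) There exist a not necessarily abelian TGW algebra $\mathcal{A}_\mu(R,\sigma,t)$ and a surjective homomorphism $\psi:U(\mathfrak{g})\to\mathcal{A}_\mu(R,\sigma,t)$ with kernel $J$ such that $\psi(e_i)=X_i$ and $\psi(f_i)=Y_i$; (b) There exists a simple completely pointed $\mathfrak{g}$-module $M$ such that $\operatorname{Ann}_{U(\mathfrak{g})}M=J$.
   Context: Not necessarily abelian TGW (twisted generalized Weyl) algebras. A not necessarily abelian TGW datum $(R,\sigma,t)$ with index set $I$ (here $I=\{1,\dots,n\}$) consists of an associative unital $\Bbbk$-algebra $R$, $\Bbbk$-algebra automorphisms $\sigma=(\sigma_i)_{i\in I}$ of $R$ (not required to commute with each other), and nonzero central elements $t=(t_i)_{i\in I}$ of $R$. Given $\mu=(\mu_{ij})_{i\ne j}$ with $\mu_{ij}\in\Bbbk\setminus\{0\}$, $\mathcal{C}_\mu(R,\sigma,t)$ is the free $R$-ring on symbols $X_i,Y_i$ ($i\in I$) modulo the relations $X_ir=\sigma_i(r)X_i$, $Y_ir=\sigma_i^{-1}(r)Y_i$, $Y_iX_i=t_i$, $X_iY_i=\sigma_i(t_i)$ ($r\in R$, $i\in I$), $X_iY_j=\mu_{ij}Y_jX_i$ ($i\neq j$). It is graded by the free abelian group $\mathbb{Z}I$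 via $\deg X_i=i$, $\deg Y_i=-i$, $\deg r=0$. The TGW algebra $\mathcal{A}_\mu(R,\sigma,t)$ is the quotient of $\mathcal{C}_\mu(R,\sigma,t)$ by the sum of all graded ideals having zero intersection with the degree-zero component; the images of $X_i,Y_i$ are denoted by the same symbols. A weight module $M=\bigoplus_{\mu\in\mathfrak{h}^*}M_\mu$ over $\mathfrak{g}$ (with Cartan subalgebra $\mathfrak{h}$) is completely pointed (multiplicity free) if $\dim_\Bbbk M_\mu\le1$ for all $\mu\in\mathfrak{h}^*$. A primitive ideal is the annihilator of a simple module.
   Formalization: The case g = sl_2 with J the annihilator of the trivial module is excluded: there (b) holds, but (a) fails, because a rank-one TGW algebra contains R, so Y_1X_1 = t_1 is nonzero while e_1 lies in J. *)

(* Defs.v *)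
From HB Require Import structures.
From mathcomp Require Import all_boot all_order all_algebra.
From mathcomp Require Import generic_quotient boolp.

Set Implicit Arguments.
Unset Strict Implicit.
Unset Printing Implicit Defensive.

Import GRing.Theory.

Local Open Scope ring_scope.
Local Open Scope quotient_scope.

(* The free R-ring on a type T: terms over the constants of R and the         *)
(* generators in T, modulo the ring axioms and the requirement that the       *)
(* constants form a ring morphism. Zero, one and opposites come from R.       *)

Inductive rterm (R T : Type) : Type :=
| RCst of R
| RGen of T
| RAdd of rterm R T & rterm R T
| RMul of rterm R T & rterm R T.

Arguments RCst {R} T.
Arguments RGen R {T}.

HB.instance Definition _ (R T : Type) := gen_eqMixin (rterm R T).
HB.instance Definition _ (R T : Type) := gen_choiceMixin (rterm R T).

Inductive rcong (R : pzRingType) (T : Type) : rterm R T -> rterm R T -> Prop :=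
| rcong_refl a : rcong a a
| rcong_sym a b : rcong a b -> rcong b a
| rcong_trans a b c : rcong a b -> rcong b c -> rcong a c
| rcong_add a a' b b' : rcong a a' -> rcong b b' -> rcong (RAdd a b) (RAdd a' b')
| rcong_mul a a' b b' : rcong a a' -> rcong b b' -> rcong (RMul a b) (RMul a' b')
| rcong_addA a b c : rcong (RAdd a (RAdd b c)) (RAdd (RAdd a b) c)
| rcong_addC a b : rcong (RAdd a b) (RAdd b a)
| rcong_add0 a : rcong (RAdd (RCst T 0) a) a
| rcong_mulA a b c : rcong (RMul a (RMul b c)) (RMul (RMul a b) c)
| rcong_mul1l a : rcong (RMul (RCst T 1) a) a
| rcong_mul1r a : rcong (RMul a (RCst T 1)) a
| rcong_mul0 a : rcong (RMul (RCst T 0) a) (RCst T 0)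
| rcong_mulDl a b c : rcong (RMul (RAdd a b) c) (RAdd (RMul a c) (RMul b c))
| rcong_mulDr a b c : rcong (RMul a (RAdd b c)) (RAdd (RMul a b) (RMul a c))
| rcong_cstD r s : rcong (RCst T (r + s)) (RAdd (RCst T r) (RCst T s))
| rcong_cstM r s : rcong (RCst T (r * s)) (RMul (RCst T r) (RCst T s)).

Section FreeRing.
Variables (R : pzRingType) (T : Type).
Implicit Types (a b c : rterm R T).

Definition rcongb a b : bool := `[< rcong a b >].

Lemma rcongb_equiv : equiv_class_of rcongb.
Proof.
split.
- by move=> a; apply/asboolP; exact: rcong_refl.
- by move=> a b; apply/asboolP/asboolP; exact: rcong_sym.
- move=> b a c /asboolP ab /asboolP bc; apply/asboolP; exact: rcong_trans ab bc.
Qed.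

Canonical rcongb_rel := EquivRelPack rcongb_equiv.

Definition freeRing : Type := {eq_quot rcongb}.

HB.instance Definition _ := Choice.on freeRing.
HB.instance Definition _ := EqQuotient.on freeRing.

Let cls (a : rterm R T) : freeRing := \pi_freeRing a.

Lemma free_eqP a b : rcong a b <-> cls a = cls b.
Proof. by split=> [ab|/eqmodP/asboolP //]; apply/eqmodP/asboolP. Qed.

Lemma free_repr a : rcong (repr (cls a)) a.
Proof. by apply/free_eqP; rewrite /cls reprK. Qed.

Definition free_cst (r : R) : freeRing := cls (RCst T r).
Definition free_gen (x : T) : freeRing := cls (RGen R x).
Definition free_add (p q : freeRing) : freeRing := cls (RAdd (repr p) (repr q)).
Definition free_mul (p q : freeRing) : freeRing := cls (RMul (repr p) (repr q)).
Definition free_opp (p : freeRing) : freeRing := free_mul (free_cst (-1)) p.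

Lemma free_addE a b : free_add (cls a) (cls b) = cls (RAdd a b).
Proof. by apply/free_eqP; apply: rcong_add; exact: free_repr. Qed.

Lemma free_mulE a b : free_mul (cls a) (cls b) = cls (RMul a b).
Proof. by apply/free_eqP; apply: rcong_mul; exact: free_repr. Qed.

Lemma free_ind (P : freeRing -> Prop) : (forall a, P (cls a)) -> forall p, P p.
Proof. by move=> H p; rewrite -[p]reprK; exact: H. Qed.

Lemma free_addA : associative free_add.
Proof.
elim/free_ind=> a; elim/free_ind=> b; elim/free_ind=> c.
by rewrite !free_addE; apply/free_eqP; exact: rcong_addA.
Qed.

Lemma free_addC : commutative free_add.
Proof.
elim/free_ind=> a; elim/free_ind=> b.
by rewrite !free_addE; apply/free_eqP; exact: rcong_addC.
Qed.

Lemma free_add0 : left_id (free_cst 0) free_add.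
Proof.
by elim/free_ind=> a; rewrite free_addE; apply/free_eqP; exact: rcong_add0.
Qed.

Lemma free_mulA : associative free_mul.
Proof.
elim/free_ind=> a; elim/free_ind=> b; elim/free_ind=> c.
by rewrite !free_mulE; apply/free_eqP; exact: rcong_mulA.
Qed.

Lemma free_mul1l : left_id (free_cst 1) free_mul.
Proof.
by elim/free_ind=> a; rewrite free_mulE; apply/free_eqP; exact: rcong_mul1l.
Qed.

Lemma free_mul1r : right_id (free_cst 1) free_mul.
Proof.
by elim/free_ind=> a; rewrite free_mulE; apply/free_eqP; exact: rcong_mul1r.
Qed.

Lemma free_mulDl : left_distributive free_mul free_add.
Proof.
elim/free_ind=> a; elim/free_ind=> b; elim/free_ind=> c.
by rewrite !(free_addE, free_mulE); apply/free_eqP; exact: rcong_mulDl.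
Qed.

Lemma free_mulDr : right_distributive free_mul free_add.
Proof.
elim/free_ind=> a; elim/free_ind=> b; elim/free_ind=> c.
by rewrite !(free_addE, free_mulE); apply/free_eqP; exact: rcong_mulDr.
Qed.

Lemma free_cstD r s : free_cst (r + s) = free_add (free_cst r) (free_cst s).
Proof. by rewrite free_addE; apply/free_eqP; exact: rcong_cstD. Qed.

Lemma free_cstM r s : free_cst (r * s) = free_mul (free_cst r) (free_cst s).
Proof. by rewrite free_mulE; apply/free_eqP; exact: rcong_cstM. Qed.

Lemma free_addN : left_inverse (free_cst 0) free_opp free_add.
Proof.
move=> p; rewrite /free_opp -{2}[p]free_mul1l -free_mulDl -free_cstD addNr.
by elim/free_ind: p => a; rewrite free_mulE; apply/free_eqP; exact: rcong_mul0.
Qed.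

HB.instance Definition _ :=
  GRing.isZmodule.Build freeRing free_addA free_addC free_add0 free_addN.
HB.instance Definition _ := GRing.Zmodule_isPzRing.Build freeRing
  free_mulA free_mul1l free_mul1r free_mulDl free_mulDr.

End FreeRing.

Arguments free_cst {R} T r.
Arguments free_gen R {T} x.

(* ring_quot S is A modulo the two-sided ideal generated by S.                *)

Inductive ideal_gen (A : pzRingType) (S : A -> Prop) : A -> Prop :=
| ideal_gen_in x : S x -> ideal_gen S x
| ideal_gen0 : ideal_gen S 0
| ideal_genD x y : ideal_gen S x -> ideal_gen S y -> ideal_gen S (x + y)
| ideal_genMl a x : ideal_gen S x -> ideal_gen S (a * x)
| ideal_genMr a x : ideal_gen S x -> ideal_gen S (x * a).

Section RingQuot.
Variables (A : pzRingType) (S : A -> Prop).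
Implicit Types (a b c : A).

Definition ideal_eqb a b : bool := `[< ideal_gen S (a - b) >].

Lemma ideal_genN a : ideal_gen S a -> ideal_gen S (- a).
Proof. by rewrite -mulN1r; exact: ideal_genMl. Qed.

Lemma ideal_eqb_equiv : equiv_class_of ideal_eqb.
Proof.
split.
- by move=> a; apply/asboolP; rewrite subrr; exact: ideal_gen0.
- by move=> a b; apply/asboolP/asboolP => /ideal_genN; rewrite opprB.
- move=> b a c /asboolP ab /asboolP bc; apply/asboolP.
  have -> : a - c = (a - b) + (b - c) by rewrite addrA subrK.
  exact: ideal_genD.
Qed.

Canonical ideal_eqb_rel := EquivRelPack ideal_eqb_equiv.

Definition ring_quot : Type := {eq_quot ideal_eqb}.

HB.instance Definition _ := Choice.on ring_quot.
HB.instance Definition _ := EqQuotient.on ring_quot.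

Definition quot_pi (a : A) : ring_quot := \pi_ring_quot a.

Lemma quot_eqP a b : ideal_gen S (a - b) <-> quot_pi a = quot_pi b.
Proof. by split=> [ab|/eqmodP/asboolP //]; apply/eqmodP/asboolP. Qed.

Lemma quot_repr a : ideal_gen S (repr (quot_pi a) - a).
Proof. by apply/quot_eqP; rewrite /quot_pi reprK. Qed.

Definition quot_add (p q : ring_quot) : ring_quot := quot_pi (repr p + repr q).
Definition quot_mul (p q : ring_quot) : ring_quot := quot_pi (repr p * repr q).
Definition quot_opp (p : ring_quot) : ring_quot := quot_pi (- repr p).

Lemma quot_addE a b : quot_add (quot_pi a) (quot_pi b) = quot_pi (a + b).
Proof.
apply/quot_eqP; rewrite opprD addrACA.
by apply: ideal_genD; exact: quot_repr.
Qed.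

Lemma quot_oppE a : quot_opp (quot_pi a) = quot_pi (- a).
Proof. by apply/quot_eqP; rewrite -opprD; apply: ideal_genN; exact: quot_repr. Qed.

Lemma quot_mulE a b : quot_mul (quot_pi a) (quot_pi b) = quot_pi (a * b).
Proof.
apply/quot_eqP; set a' := repr _; set b' := repr _.
have -> : a' * b' - a * b = (a' - a) * b' + a * (b' - b).
  by rewrite mulrBl mulrBr addrA subrK.
by apply: ideal_genD; [apply: ideal_genMr|apply: ideal_genMl]; exact: quot_repr.
Qed.

Lemma quot_ind (P : ring_quot -> Prop) : (forall a, P (quot_pi a)) -> forall p, P p.
Proof. by move=> H p; rewrite -[p]reprK; exact: H. Qed.

Lemma quot_addA : associative quot_add.
Proof.
elim/quot_ind=> a; elim/quot_ind=> b; elim/quot_ind=> c.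
by rewrite !quot_addE addrA.
Qed.

Lemma quot_addC : commutative quot_add.
Proof. by elim/quot_ind=> a; elim/quot_ind=> b; rewrite !quot_addE addrC. Qed.

Lemma quot_add0 : left_id (quot_pi 0) quot_add.
Proof. by elim/quot_ind=> a; rewrite quot_addE add0r. Qed.

Lemma quot_addN : left_inverse (quot_pi 0) quot_opp quot_add.
Proof. by elim/quot_ind=> a; rewrite quot_oppE quot_addE addNr. Qed.

HB.instance Definition _ :=
  GRing.isZmodule.Build ring_quot quot_addA quot_addC quot_add0 quot_addN.

Lemma quot_mulA : associative quot_mul.
Proof.
elim/quot_ind=> a; elim/quot_ind=> b; elim/quot_ind=> c.
by rewrite !quot_mulE mulrA.
Qed.

Lemma quot_mul1l : left_id (quot_pi 1) quot_mul.
Proof. by elim/quot_ind=> a; rewrite quot_mulE mul1r. Qed.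

Lemma quot_mul1r : right_id (quot_pi 1) quot_mul.
Proof. by elim/quot_ind=> a; rewrite quot_mulE mulr1. Qed.

Lemma quot_mulDl : left_distributive quot_mul quot_add.
Proof.
elim/quot_ind=> a; elim/quot_ind=> b; elim/quot_ind=> c.
by rewrite !(quot_addE, quot_mulE) mulrDl.
Qed.

Lemma quot_mulDr : right_distributive quot_mul quot_add.
Proof.
elim/quot_ind=> a; elim/quot_ind=> b; elim/quot_ind=> c.
by rewrite !(quot_addE, quot_mulE) mulrDr.
Qed.

HB.instance Definition _ := GRing.Zmodule_isPzRing.Build ring_quot
  quot_mulA quot_mul1l quot_mul1r quot_mulDl quot_mulDr.

End RingQuot.

(* Finite dimensionality is carried by vectType.                              *)
Record lieAlgebra (k : fieldType) := LieAlgebra {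
  lie_sort :> vectType k;
  lie_br : lie_sort -> lie_sort -> lie_sort;
  lie_linl : forall y a x x', lie_br (a *: x + x') y = a *: lie_br x y + lie_br x' y;
  lie_linr : forall x a y y', lie_br x (a *: y + y') = a *: lie_br x y + lie_br x y';
  lie_alt : forall x, lie_br x x = 0;
  lie_jacobi : forall x y z,
    lie_br x (lie_br y z) + lie_br y (lie_br z x) + lie_br z (lie_br x y) = 0
}.

Section Lie.
Variables (k : fieldType) (L : lieAlgebra k).

Definition lie_simple : Prop :=
  (exists x y : L, lie_br x y <> 0) /\
  forall I : {vspace L}, (forall x y : L, y \in I -> lie_br x y \in I) ->
    I = 0%VS \/ I = fullv.

(* Cartan matrices of finite type.                                            *)
Definition cartan_matrix n (A : 'M[int]_n) : Prop :=
  [/\ forall i, A i i = 2,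
      forall i j, i != j -> A i j <= 0,
      forall i j, A i j = 0 -> A j i = 0
    & exists d : 'I_n -> rat,
      [/\ forall i, 0 < d i,
          forall i j, d i * (A i j)%:~R = d j * (A j i)%:~R
        & forall x : 'I_n -> rat, (exists i, x i != 0) ->
            0 < \sum_i \sum_j x i * (d i * (A i j)%:~R) * x j]].

Section Serre.
Variables (n : nat) (e f : 'I_n -> L).

Definition coroot (i : 'I_n) : L := lie_br (e i) (f i).

Definition coroots : seq L := [seq coroot i | i <- enum 'I_n].

(* The Cartan subalgebra determined by Serre generators is spanned by the h_i. *)
Definition cartan_subalg : {vspace L} := <<coroots>>%VS.

(* a_ij = alpha_j(h_i). The freeness of the h_i is not a consequence of the   *)
(* relations: it excludes generating families with too many elements, for     *)
(* instance those having some e_i = f_i = 0.                                  *)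
Definition serre_generators : Prop :=
  exists A : 'M[int]_n,
  [/\ cartan_matrix A /\ free coroots,
      (forall i j, lie_br (coroot i) (coroot j) = 0) /\
      (forall i j, i != j -> lie_br (e i) (f j) = 0),
      forall i j, lie_br (coroot i) (e j) = (A i j)%:~R *: e j /\
                  lie_br (coroot i) (f j) = - ((A i j)%:~R *: f j),
      forall i j, i != j ->
        iter `|1 - A i j|%N (lie_br (e i)) (e j) = 0 /\
        iter `|1 - A i j|%N (lie_br (f i)) (f j) = 0
    & forall V : {vspace L}, (forall i, e i \in V /\ f i \in V) ->
        (forall x y : L, x \in V -> y \in V -> lie_br x y \in V) -> V = fullv].

End Serre.

Inductive Uenv_rel : freeRing k L -> Prop :=
| Uenv_central a x :
    Uenv_rel (free_gen k x * free_cst L a - free_cst L a * free_gen k x)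
| Uenv_linear a x y :
    Uenv_rel (free_gen k (a *: x + y) -
              (free_cst L a * free_gen k x + free_gen k y))
| Uenv_br x y :
    Uenv_rel (free_gen k (lie_br x y) -
              (free_gen k x * free_gen k y - free_gen k y * free_gen k x)).

Definition Uenv : pzRingType := ring_quot Uenv_rel.
Definition Uenv_scalar (a : k) : Uenv := quot_pi Uenv_rel (free_cst L a).
Definition Uenv_inj (x : L) : Uenv := quot_pi Uenv_rel (free_gen k x).

(* A Lie module over L is a left module over Uenv, on which k acts through    *)
(* Uenv_scalar.                                                               *)
Section Modules.
Variable M : lmodType Uenv.

Definition simple_module : Prop :=
  (exists m : M, m <> 0) /\
  forall N : M -> Prop, N 0 -> (forall x y, N x -> N y -> N (x + y)) ->
    (forall u x, N x -> N (u *: x)) ->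
    (forall x, N x -> x = 0) \/ (forall x, N x).

Definition annihilator (u : Uenv) : Prop := forall m : M, u *: m = 0.

Variable H : {vspace L}.

Definition weight_space (lam : 'Hom(subvs_of H, k^o)) (m : M) : Prop :=
  forall h : subvs_of H, Uenv_inj (vsval h) *: m = Uenv_scalar (lam h) *: m.

(* The sum of the weight spaces is automatically direct.                      *)
Definition weight_module : Prop :=
  forall m : M, exists s : seq M, m = \sum_(v <- s) v /\
    forall v, v \in s -> exists lam, weight_space lam v.

(* Last condition: each weight space has dimension at most 1 over k.          *)
Definition completely_pointed : Prop :=
  weight_module /\
  forall lam, exists v : M, forall m, weight_space lam m ->
    exists a : k, m = Uenv_scalar a *: v.

End Modules.

Definition primitive_ideal (J : Uenv -> Prop) : Prop :=
  exists M : lmodType Uenv,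
    simple_module M /\ forall u, J u <-> annihilator M u.

(* A primitive ideal containing L is the augmentation ideal, the annihilator  *)
(* of the trivial module. For L = sl_2 the quotient Uenv / J = k is then not  *)
(* a TGW algebra: a rank one TGW algebra contains R, so that Y_1 X_1 = t_1 is *)
(* nonzero in it, whereas e_1 and f_1 vanish in k.                            *)
Definition contains_lie (J : Uenv -> Prop) : Prop := forall x : L, J (Uenv_inj x).

End Lie.

Record tgw_datum (k : fieldType) (n : nat) := TGWDatum {
  tgw_ring : algType k;
  tgw_sigma : 'I_n -> {lrmorphism tgw_ring -> tgw_ring};
  tgw_sigmaV : 'I_n -> tgw_ring -> tgw_ring;
  tgw_sigmaK : forall i, cancel (tgw_sigma i) (tgw_sigmaV i);
  tgw_sigmaVK : forall i, cancel (tgw_sigmaV i) (tgw_sigma i);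
  tgw_t : 'I_n -> tgw_ring;
  tgw_t_neq0 : forall i, tgw_t i != 0;
  tgw_t_central : forall i r, tgw_t i * r = r * tgw_t i
}.

Section TGW.
Variables (k : fieldType) (n : nat) (D : tgw_datum k n).
Variable mu : 'I_n -> 'I_n -> k.

Notation R := (tgw_ring D).
(* inl i and inr i index the generators X_i and Y_i.                          *)
Notation F := (freeRing R ('I_n + 'I_n)%type).
Notation C r := (free_cst ('I_n + 'I_n)%type r).
Notation X i := (free_gen R (inl i)).
Notation Y i := (free_gen R (inr i)).

Inductive tgwc_rel : F -> Prop :=
| tgwc_Xr i r : tgwc_rel (X i * C r - C (tgw_sigma D i r) * X i)
| tgwc_Yr i r : tgwc_rel (Y i * C r - C (tgw_sigmaV i r) * Y i)
| tgwc_YX i : tgwc_rel (Y i * X i - C (tgw_t D i))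
| tgwc_XY i : tgwc_rel (X i * Y i - C (tgw_sigma D i (tgw_t D i)))
| tgwc_XYij i j : i != j ->
    tgwc_rel (X i * Y j - C ((mu i j)%:A) * (Y j * X i)).

Definition TGWC : pzRingType := ring_quot tgwc_rel.
Definition tgwc_cst (r : R) : TGWC := quot_pi tgwc_rel (C r).
Definition tgwc_X (i : 'I_n) : TGWC := quot_pi tgwc_rel (X i).
Definition tgwc_Y (i : 'I_n) : TGWC := quot_pi tgwc_rel (Y i).

(* The homogeneous components of the grading by the free abelian group on the *)
(* index set, whose i-th basis element is delta_mx 0 i.                       *)
Inductive tgwc_homog : 'rV[int]_n -> TGWC -> Prop :=
| homog_cst r : tgwc_homog 0 (tgwc_cst r)
| homog_X i : tgwc_homog (delta_mx 0 i) (tgwc_X i)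
| homog_Y i : tgwc_homog (- delta_mx 0 i) (tgwc_Y i)
| homog_0 d : tgwc_homog d 0
| homog_D d x y : tgwc_homog d x -> tgwc_homog d y -> tgwc_homog d (x + y)
| homog_M d d' x y :
    tgwc_homog d x -> tgwc_homog d' y -> tgwc_homog (d + d') (x * y).

Definition two_sided_ideal (I : TGWC -> Prop) : Prop :=
  [/\ I 0, forall x y, I x -> I y -> I (x + y)
    & forall a x, I x -> I (a * x) /\ I (x * a)].

Definition graded_ideal (I : TGWC -> Prop) : Prop :=
  two_sided_ideal I /\
  forall x, I x -> exists s : seq TGWC, x = \sum_(y <- s) y /\
    forall y, y \in s -> I y /\ exists d, tgwc_homog d y.

(* The union of the graded ideals meeting the degree-zero component in 0; the *)
(* ideal it generates is the sum of these ideals.                             *)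
Definition tgwa_rel (x : TGWC) : Prop :=
  exists I : TGWC -> Prop,
    [/\ graded_ideal I, forall y, I y -> tgwc_homog 0 y -> y = 0 & I x].

Definition TGWA : pzRingType := ring_quot tgwa_rel.
Definition tgwa_cst (r : R) : TGWA := quot_pi tgwa_rel (tgwc_cst r).
Definition tgwa_X (i : 'I_n) : TGWA := quot_pi tgwa_rel (tgwc_X i).
Definition tgwa_Y (i : 'I_n) : TGWA := quot_pi tgwa_rel (tgwc_Y i).

End TGW.

(* Main.v *)
Require Import Defs.
From HB Require Import structures.
From mathcomp Require Import all_boot all_order all_algebra.
From mathcomp Require Import fingroup perm.
From mathcomp Require Import generic_quotient boolp.
From mathcomp.multinomials Require Import mpoly.
From mathcomp Require Import zify ring.

Set Implicit Arguments.
Unset Strict Implicit.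
Unset Printing Implicit Defensive.

Import Order.TTheory GRing.Theory Num.Theory.
Local Open Scope ring_scope.

(** Let A = U(g)/J, graded by the root lattice, with degree-zero part A_0.  Both
    conditions are equivalent to the commutativity of A_0.

    If (b) holds, A_0 acts diagonally on a faithful module.  If (a) holds, the
    normal form of the elements of C_mu(R, sigma, t) shows that A_0 consists of
    images of central elements of R.

    Conversely let A_0 be commutative.  A is prime and the e_i, f_i are
    ad-nilpotent, so each of them is nilpotent or regular in A.

    - If all are regular, an interpolation argument and Martindale's lemma show
      that A_0 is the polynomial algebra generated by the coweights.  Then A is a
      TGW algebra over it with sigma_i the translations, and a generic weight
      lambda, with lambda(h_i) = 1/2, yields a simple quotient of A which is
      completely pointed and faithful, since its support is Zariski dense.

    - If some e_i or f_i is nilpotent, then h_i is diagonalizable, and by the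
      connectedness of the Dynkin diagram so are all the h_j.  The given simple
      module is then a highest weight module with finitely many weights; the
      commutativity of A_0 makes it completely pointed, and A is a TGW algebra over
      the functions on the set of weights, sigma_i being a permutation which
      extends the shift by the i-th simple root.  The trivial module needs a datum
      in which the t_i become zero in C_mu: R = k x k, t_i = (0, 1), mu_ij = 2.

    Scalars enter through Quillen's lemma: the endomorphisms of a simple module
    over U(g) are scalars. *)

(** Commutativity of [A_0] is the pivot because it forgets the module in (b) and the datum in (a):
    the simple module that defines [J] need not be a weight module, and [R] may be noncommutative.

    The way back to (a) is nondegeneracy. If each nonzero homogeneous element of [A] has a nonzero
    multiple in degree zero, then [A] is the TGW algebra as soon as some map from [R] to [A_0]
    satisfies the relations and its kernel dies in [C_mu]. A faithful simple weight module gives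
    this nondegeneracy.

    Quillen's lemma is what makes Martindale's lemma applicable: it shows that the extended centroid
    is [k].

    The value 1/2 keeps every [h_i] in 1/2 + Z on the whole support. On a line of weights in the
    direction of a simple root, [f_i e_i] is a quadratic function of the position, and then has at
    most one zero in the support lattice. So the support contains a half-line of each such line
    through one of its points, whence density.

    For the trivial module, [mu_ij mu_ji = 4] makes two straightenings of one monomial disagree,
    which kills the [t_i]. This takes two distinct indices, hence the excluded case. *)

Lemma vspace_of_pred (k : fieldType) (V : vectType k) (P : V -> Prop) :
  P 0 -> (forall a x y, P x -> P y -> P (a *: x + y)) ->
  exists U : {vspace V}, forall x, x \in U <-> P x.
Proof.
move=> P0 Plin.
(* A subspace of largest dimension contained in [P] absorbs every vector of [P], since adjoining one
   cannot enlarge it. *)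
pose Q m := `[< exists U : {vspace V}, \dim U = m /\ forall x, x \in U -> P x >].
have Qex : exists m, Q m.
  by exists 0%N; apply/asboolP; exists 0%VS; rewrite dimv0; split=> // x; rewrite memv0 => /eqP->.
have Qub m : Q m -> (m <= \dim {:V})%N.
  by move=> /asboolP [U [<- _]]; apply: dimvS; apply: subvf.
case: (ex_maxnP Qex Qub) => m /asboolP [U [dU UP]] Qmax.
exists U => x; split; first exact: UP.
move=> Px; have : (\dim (U + <[x]>) <= m)%N.
  apply: Qmax; apply/asboolP; exists (U + <[x]>)%VS; split=> // y /memv_addP [u uU [v /vlineP [a ->] ->]].
  by rewrite addrC; apply: Plin => //; apply: UP.
rewrite -dU => le.
have /eqP -> : U == (U + <[x]>)%VS by rewrite eqEdim addvSl.
by rewrite (subvP (addvSr _ _)) // memv_line.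
Qed.

Lemma natr_inj_pchar0 (k : fieldType) : [pchar k] =i pred0 -> injective (fun m : nat => m%:R : k).
Proof.
move=> ch a b; wlog le : a b / (a <= b)%N.
  by move=> H; case: (leqP a b) => [|/ltnW] le ab; [exact: H|apply/esym/H].
move=> /= ab; have /eqP : (b - a)%:R = 0 :> k by rewrite natrB // ab subrr.
by rewrite ((pcharf0P k).1 ch) subn_eq0 => ba; apply/eqP; rewrite eqn_leq le.
Qed.

Lemma intr_inj_pchar0 (k : fieldType) : [pchar k] =i pred0 -> injective (fun m : int => m%:~R : k).
Proof.
move=> ch a b /= ab; apply/eqP; rewrite -subr_eq0.
have : (a - b)%:~R = 0 :> k by rewrite rmorphB /= ab subrr.
case: (a - b) => m; first by move/eqP; rewrite -pmulrn ((pcharf0P k).1 ch) => /eqP->.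
by rewrite NegzE rmorphN /= => /eqP; rewrite oppr_eq0 -pmulrn (pcharf0P k).1.
Qed.

Lemma natr_notin_pchar0 (k : fieldType) (s : seq k) :
  [pchar k] =i pred0 -> exists m : nat, m%:R \notin s.
Proof.
move=> ch; apply: contrapT => /forallNP H.
have sub : {subset [seq m%:R : k | m <- iota 0 (size s).+1] <= s}.
  by move=> _ /mapP [m _ ->]; move: (H m) => /negP; rewrite negbK.
suff /uniq_leq_size /(_ sub) : uniq [seq m%:R : k | m <- iota 0 (size s).+1].
  by rewrite size_map size_iota ltnn.
by rewrite map_inj_uniq ?iota_uniq //; apply: natr_inj_pchar0.
Qed.

(** * Algebras over a field, given by a central scalar map *)

Section CentralScalars.
Variables (k : fieldType) (A : pzRingType) (sc : {rmorphism k -> A}).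
Hypothesis scC : forall c a, sc c * a = a * sc c.

(** An inductive span, because [A] carries only a central map from [k] and no module structure. *)
Inductive lspan (B : A -> Prop) : A -> Prop :=
| lspan0 : lspan B 0
| lspan_cons c b x : B b -> lspan B x -> lspan B (sc c * b + x).

Lemma lspanD B x y : lspan B x -> lspan B y -> lspan B (x + y).
Proof.
elim=> [|c b x' Bb _ IH]; first by rewrite add0r.
by move=> /IH ?; rewrite -addrA; apply: lspan_cons.
Qed.

Lemma lspanZ B c x : lspan B x -> lspan B (sc c * x).
Proof.
elim=> [|c' b x' Bb _ IH]; first by rewrite mulr0; constructor.
by rewrite mulrDr mulrA -rmorphM; apply: lspan_cons.
Qed.

Lemma lspan_mem B b : B b -> lspan B b.
Proof.
by move=> Bb; rewrite -[b]addr0 -[b]mul1r -(rmorph1 sc); apply: lspan_cons => //; constructor.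
Qed.

Lemma lspan_bind (B B' : A -> Prop) (h : A -> A) x :
  (forall a b, h (a + b) = h a + h b) -> (forall c a, h (sc c * a) = sc c * h a) ->
  (forall b, B b -> lspan B' (h b)) -> lspan B x -> lspan B' (h x).
Proof.
move=> hD hZ hB; elim=> [|c b x' Bb _ IH].
  by rewrite -(mul0r (sc 0)) -scC rmorph0 -(rmorph0 sc) hZ rmorph0 mul0r; constructor.
by rewrite hD hZ; apply: lspanD => //; apply/lspanZ/hB.
Qed.

Lemma lspan_sub (B B' : A -> Prop) x : (forall b, B b -> lspan B' b) -> lspan B x -> lspan B' x.
Proof. by move=> H; apply: (@lspan_bind B B' id). Qed.

Definition comb (B : seq A) (c : 'rV[k]_(size B)) : A := \sum_i sc (c 0 i) * B`_i.

Lemma lspan_comb (B : seq A) x : lspan (fun b => b \in B) x -> exists c, x = comb (B := B) c.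
Proof.
elim=> [|a b x' Bb _ [c ->]].
  by exists 0; rewrite /comb big1 // => i _; rewrite mxE rmorph0 mul0r.
have lt : (index b B < size B)%N by rewrite index_mem.
exists (a *: delta_mx 0 (Ordinal lt) + c); rewrite /comb.
under [in RHS]eq_bigr do rewrite !mxE rmorphD mulrDl.
rewrite big_split /=; congr (_ + _).
rewrite (bigD1 (Ordinal lt)) //= big1 ?addr0 ?eqxx ?mulr1 ?nth_index //.
by move=> i /negbTE ni; rewrite ni mulr0 rmorph0 mul0r.
Qed.

Lemma comb_lin (B : seq A) a x y : comb (B := B) (a *: x + y) = sc a * comb x + comb y.
Proof.
rewrite /comb mulr_sumr -big_split /=; apply: eq_bigr => i _.
by rewrite !mxE rmorphD mulrDl rmorphM mulrA.
Qed.

(** The combinations killed by some power of [z] form a subspace; the sum of the exponents of a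
    basis is a uniform exponent. *)
Lemma finite_uniform_kernel (z : A) (B : seq A) :
  exists m, forall w, lspan (fun b => b \in B) w ->
    (exists m', z ^+ m' * w = 0) -> z ^+ m * w = 0.
Proof.
pose P (c : 'rV[k]_(size B)) := exists m, z ^+ m * comb c = 0.
have mono m m' w : z ^+ m * w = 0 -> (m <= m')%N -> z ^+ m' * w = 0.
  by move=> h le; rewrite -(subnK le) exprD -mulrA h mulr0.
have [|a x y [m hm] [m' hm']|U UP] := @vspace_of_pred _ _ P.
- by exists 0%N; rewrite /comb big1 ?mulr0 // => i _; rewrite mxE rmorph0 mul0r.
- exists (m + m')%N; rewrite comb_lin mulrDr mulrA -scC -mulrA.
  by rewrite (mono _ _ _ hm) ?leq_addr // mulr0 (mono _ _ _ hm') ?leq_addl // addr0.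
have /choice [g gP] : forall i : 'I_(\dim U), exists m, z ^+ m * comb (vbasis U)`_i = 0.
  by move=> i; apply/UP/vbasis_mem/mem_nth; rewrite size_tuple.
exists (\sum_i g i)%N => w /lspan_comb [c ->] /UP cU.
rewrite (coord_vbasis cU).
have combS (F : 'I_(\dim U) -> k) :
    comb (\sum_i F i *: (vbasis U)`_i) = \sum_i sc (F i) * comb (vbasis U)`_i.
  elim/big_rec2: _ => [|i x y _ <-]; last by rewrite comb_lin.
  by rewrite /comb big1 // => i _; rewrite mxE rmorph0 mul0r.
rewrite combS mulr_sumr big1 // => i _; rewrite mulrA -scC -mulrA.
by rewrite (mono _ _ _ (gP i)) ?mulr0 // (bigD1 i) //= leq_addr.
Qed.

Section PrimeRing.
Hypothesis primeA : forall a b : A, (forall y, a * y * b = 0) -> a = 0 \/ b = 0.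

Definition adj (z y : A) : A := z * y - y * z.

Lemma iter_adj0 z m : iter m (adj z) 0 = 0.
Proof. by elim: m => //= m ->; rewrite /adj mulr0 mul0r subrr. Qed.

Lemma iter_adjD z m x y : iter m (adj z) (x + y) = iter m (adj z) x + iter m (adj z) y.
Proof. by elim: m => //= m ->; rewrite /adj mulrDr mulrDl opprD addrACA. Qed.

Lemma adjM z x y : adj z (x * y) = adj z x * y + x * adj z y.
Proof. by rewrite /adj mulrBl mulrBr !mulrA addrA subrK. Qed.

Lemma iter_adj_le z m m' x : (m <= m')%N -> iter m (adj z) x = 0 -> iter m' (adj z) x = 0.
Proof. by move=> le h; rewrite -(subnK le) iterD h iter_adj0. Qed.

(** The Leibniz rule without binomials: one [adj] falls on one factor or the other, and induction on
    [a + b] does the rest. *)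
Lemma iter_adjM z a b x y : iter a (adj z) x = 0 -> iter b (adj z) y = 0 ->
  iter (a + b) (adj z) (x * y) = 0.
Proof.
have [s] := ubnP (a + b); elim: s a b x y => // s IH [|a] [|b] x y lt /= hx hy.
- by rewrite hx mul0r.
- by rewrite hx mul0r iter_adj0 /adj mulr0 mul0r subrr.
- by rewrite hy mulr0 iter_adj0 /adj mulr0 mul0r subrr.
have h1 : iter (a + b.+1) (adj z) (adj z x * y) = 0.
  by apply: IH; rewrite -?iterSr //; lia.
have h2 : iter (a.+1 + b) (adj z) (x * adj z y) = 0.
  by apply: IH; rewrite -?iterSr //; lia.
by rewrite -[adj z _]/(iter (a + b.+1).+1 (adj z) (x * y)) iterSr adjM iter_adjD h1 addnS -addSn h2 addr0.
Qed.

(** Induction on [m + a] with [z y = [z, y] + y z]: either the nilpotency order of the left factor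
    drops, or one [z] is handed on to [w]. *)
Lemma pow_adj_mul z a m y w : iter a (adj z) y = 0 -> z ^+ m * w = 0 -> z ^+ (m + a) * (y * w) = 0.
Proof.
have [s] := ubnP (m + a); elim: s a m y w => // s IH [|a] [|m] y w lt hy hw.
- by rewrite [y]hy mul0r mulr0.
- by rewrite [y]hy mul0r mulr0.
- by rewrite expr0 mul1r in hw; rewrite hw !mulr0.
have h1 : z ^+ (m.+1 + a) * (adj z y * w) = 0.
  by apply: IH; rewrite -?iterSr //; lia.
have h2 : z ^+ (m + a.+1) * (y * (z * w)) = 0.
  by apply: IH => //; rewrite mulrA -exprSr.
rewrite addSn exprSr -mulrA [z * _]mulrA -[z * y](subrK (y * z)) -/(adj z y) mulrDl mulrDr.
by rewrite {1}addnS -addSn h1 add0r -[y * z * w]mulrA.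
Qed.

(** [G] generates [A] and acts locally finitely by commutators. For a quotient of an enveloping
    algebra it is the image of the Lie algebra. *)
Variable G : A -> Prop.
Hypothesis genG : forall P : A -> Prop, (forall c, P (sc c)) -> (forall g, G g -> P g) ->
  (forall a b, P a -> P b -> P (a + b)) -> (forall a b, P a -> P b -> P (a * b)) -> forall a, P a.
Hypothesis finG : forall u, exists B : seq A, lspan (fun b => b \in B) u /\
  forall g b, G g -> b \in B -> lspan (fun b => b \in B) (g * b - b * g).

(* If z u = 0, the ad-submodule generated by u is finite dimensional, so it is *)
(* killed by one power z^m; since it generates the same left and right ideals, *)
(* z^m A u = 0. *)
Lemma adnil_regular_or_nilpotent z : (forall y, exists m, iter m (adj z) y = 0) ->
  (exists m, z ^+ m = 0) \/ (forall u, z * u = 0 -> u = 0).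
Proof.
move=> nilz; case: (pselect (exists m, z ^+ m = 0)) => [|nn]; [by left|right=> u zu].
have [B [uB adB]] := finG u; have [m0 m0P] := finite_uniform_kernel z B.
pose W w := lspan (fun b => b \in B) w /\ exists m, z ^+ m * w = 0.
have WZ c w : W w -> W (sc c * w).
  move=> [wB [m hm]]; split; first exact: lspanZ.
  by exists m; rewrite mulrA -scC -mulrA hm mulr0.
have Wad g w : G g -> W w -> W (g * w - w * g).
  move=> Gg [wB [m hm]]; split.
    apply: (@lspan_bind _ _ (fun w => g * w - w * g) _ _ _ _ wB).
    - by move=> x y; rewrite mulrDr mulrDl opprD addrACA.
    - by move=> c x; rewrite mulrBr !mulrA -scC.
    by move=> b; apply: adB.
  have [a ha] := nilz g; exists (m + a)%N; rewrite mulrBr (pow_adj_mul ha hm) sub0r.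
  by rewrite mulrA addnC exprD -[X in X * g]mulrA hm mulr0 mul0r oppr0.
pose RI x := exists s : seq (A * A), (forall p, p \in s -> W p.1) /\ x = \sum_(p <- s) p.1 * p.2.
have RID x y : RI x -> RI y -> RI (x + y).
  move=> [s [sW ->]] [t [tW ->]]; exists (s ++ t); rewrite big_cat; split=> //= p.
  by rewrite mem_cat => /orP []; [exact: sW|exact: tW].
have RIm w a : W w -> RI (w * a).
  by move=> Ww; exists [:: (w, a)]; rewrite big_seq1; split=> // p; rewrite inE => /eqP->.
have RIb (y : A) : (forall w a, W w -> RI (y * (w * a))) -> forall x, RI x -> RI (y * x).
  move=> H x [s [sW ->]]; elim: s sW => [|p s IH] sW; first by rewrite big_nil mulr0; exists [::]; rewrite big_nil.
  rewrite big_cons mulrDr; apply: RID; first by apply/H/sW; rewrite mem_head.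
  by apply: IH => q qs; apply: sW; rewrite inE qs orbT.
have RIl y : forall x, RI x -> RI (y * x).
  elim/genG: y => [c|g Gg|a b IHa IHb|a b IHa IHb].
  - by apply: RIb => w a Ww; rewrite mulrA; apply/RIm/WZ.
  - apply: RIb => w a Ww; rewrite mulrA -[g * w](subrK (w * g)) mulrDl -[w * g * a]mulrA.
    by apply: RID; apply: RIm => //; apply: Wad.
  - by move=> x Rx; rewrite mulrDl; apply: RID; [apply: IHa|apply: IHb].
  by move=> x Rx; rewrite -mulrA; apply/IHa/IHb.
have Wu : W u by split=> //; exists 1%N; rewrite expr1.
have [y|zm|//] := @primeA (z ^+ m0) u; last by case: nn; exists m0.
rewrite -mulrA; have [s [sW ->]] : RI (y * u).
  by apply: RIl; rewrite -[u]mulr1; apply: RIm.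
rewrite mulr_sumr big_seq big1 // => p /sW [pB pm]; rewrite mulrA m0P ?mul0r //.
Qed.

(* Martindale's lemma on generalized polynomial identities. *)
Lemma gpi_span :
  (forall a b : A, b <> 0 -> (forall y, a * y * b = b * y * a) -> exists c, a = sc c * b) ->
  forall (s : seq (A * A)) a0 b0, a0 <> 0 ->
    (forall x, a0 * x * b0 + \sum_(p <- s) p.1 * x * p.2 = 0) ->
    lspan (fun b => b \in map snd s) b0.
Proof.
move=> centroid s; have [m] := ubnP (size s); elim: m s => // m IH [|[a b] s] lt a0 b0 a0N rel.
  case: (@primeA a0 b0) => // [y|->]; last by constructor.
  by have := rel y; rewrite big_nil addr0.
have weak t : lspan (fun b => b \in map snd s) t -> lspan (fun b1 => b1 \in map snd ((a, b) :: s)) t.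
  by apply: lspan_sub => b' b's; apply: lspan_mem; rewrite inE b's orbT.
(* If [a] and [a0] satisfy the centroid identity, then [a] is a multiple of [a0] and its term merges
   into the leading one. *)
case: (pselect (forall y, a * y * a0 = a0 * y * a)) => [cm|/existsNP [y ny]].
  have [c ac] := centroid _ _ a0N cm.
  have /weak sp : lspan (fun b => b \in map snd s) (b0 + sc c * b).
    apply: (IH s lt a0 _ a0N) => x.
    rewrite -[RHS](rel x) big_cons /= ac addrA; congr (_ + _).
    by rewrite mulrDr [a0 * x * (sc c * b)]mulrA -(scC c (a0 * x)) !mulrA.
  rewrite -[b0](addrK (sc c * b)); apply: lspanD => //.
  rewrite -mulNr -rmorphN; apply/lspanZ/lspan_mem; exact: mem_head.
(* Otherwise [a y] times the relation at [x], minus the relation at [y a x], cancels the term of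
   [(a, b)]. The new leading coefficient is nonzero by the choice of [y]. *)
apply: weak; pose s' := [seq (a * y * p.1 - p.1 * y * a, p.2) | p <- s].
have <- : map snd s' = map snd s by rewrite -map_comp.
apply: (IH s' _ (a * y * a0 - a0 * y * a)); first by rewrite size_map.
  by move=> /eqP; rewrite subr_eq0 => /eqP.
move=> x; rewrite big_map /=.
have E0 : a * y * (a0 * x * b0 + \sum_(p <- (a, b) :: s) p.1 * x * p.2) -
  (a0 * (y * a * x) * b0 + \sum_(p <- (a, b) :: s) p.1 * (y * a * x) * p.2) = 0.
  by rewrite !rel mulr0 subrr.
rewrite -[RHS]E0 mulrDr opprD addrACA mulr_sumr -sumrB big_cons /= !mulrA subrr add0r !mulrBl.
by congr (_ + _); apply: eq_bigr => p _; rewrite !mulrBl !mulrA.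
Qed.
End PrimeRing.
End CentralScalars.

(** * Endomorphisms of simple modules *)

Definition simple_mod (A : pzRingType) (V : lmodType A) : Prop :=
  (exists v : V, v <> 0) /\
  forall N : V -> Prop, N 0 -> (forall x y, N x -> N y -> N (x + y)) ->
    (forall u x, N x -> N (u *: x)) ->
    (forall x, N x -> x = 0) \/ (forall x, N x).

(** Induction on the number [r] of coordinates compared. A cover for the first [r] coordinates also
    serves every [b] whose next coordinate is at least [C]; the finitely many smaller values are
    covered one slice at a time. *)
Lemma dickson m (P : 'X_{1..m} -> Prop) :
  exists s : seq 'X_{1..m}, (forall a, a \in s -> P a) /\
    forall b, P b -> exists2 a, a \in s & (a <= b)%MM.
Proof.
suff H r : forall P : 'X_{1..m} -> Prop, exists s : seq 'X_{1..m}, (forall a, a \in s -> P a) /\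
    forall b, P b -> exists2 a, a \in s & forall i : 'I_m, (i < r)%N -> (a i <= b i)%N.
  have [s [sP cov]] := H m P; exists s; split=> // b /cov [a as_ h]; exists a => //.
  by apply/mnm_lepP => i; apply: h.
elim: r => [|r IH] {}P.
  case: (pselect (exists a, P a)) => [[a Pa]|nP].
    by exists [:: a]; split=> [b|b _]; [rewrite inE => /eqP->|exists a; rewrite ?mem_head].
  by exists [::]; split=> // b Pb; case: nP; exists b.
have [le|lt] := leqP m r.
  have [s [sP cov]] := IH P; exists s; split=> // b /cov [a as_ h]; exists a => // i _.
  by apply: h; apply: leq_trans le.
pose ir := Ordinal lt.
have [s [sP cov]] := IH P.
pose C := (\max_(a <- s) a ir).+1.
have [t [tP tcov]] : exists t : seq 'X_{1..m}, (forall a, a \in t -> P a) /\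
    forall b, P b -> (b ir < C)%N ->
      exists2 a, a \in t & forall i : 'I_m, (i < r.+1)%N -> (a i <= b i)%N.
  elim: C => [|c [t [tP tcov]]]; first by exists [::].
  have [u [uP ucov]] := IH (fun b => P b /\ b ir = c).
  exists (t ++ u); split=> [a|b Pb].
    by rewrite mem_cat => /orP [/tP|/uP []].
  rewrite ltnS leq_eqVlt => /orP [/eqP bc|/(tcov _ Pb) [a at_ h]]; last first.
    by exists a; rewrite ?mem_cat ?at_.
  have [//|a au h] := ucov b; exists a; first by rewrite mem_cat au orbT.
  move=> i; rewrite ltnS leq_eqVlt => /orP [/eqP ir'|]; last exact: h.
  have -> : i = ir by apply: val_inj.
  by rewrite bc (uP a au).2.
exists (s ++ t); split=> [a|b Pb].
  by rewrite mem_cat => /orP [/sP|/tP].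
have [lb|/(tcov _ Pb) [a at_ h]] := leqP C (b ir); last by exists a; rewrite ?mem_cat ?at_ ?orbT.
have [a as_ h] := cov b Pb; exists a; first by rewrite mem_cat as_.
move=> i; rewrite ltnS leq_eqVlt => /orP [/eqP ir'|]; last exact: h.
have -> : i = ir by apply: val_inj.
by apply: leq_trans (ltnW lb); apply: (@leq_bigmax_seq _ s xpredT (fun a : 'X_{1..m} => a ir)).
Qed.

(** * Quillen's lemma for filtered algebras with finitely many generators *)

Section Quillen.
Variables (k : closedFieldType) (A : pzRingType) (sc : {rmorphism k -> A}).
Hypothesis scC : forall c a, sc c * a = a * sc c.
Variables (m : nat) (x : 'I_m -> A).
Hypothesis xbr : forall i j, lspan sc (fun b => exists l, b = x l) (x i * x j - x j * x i).
Hypothesis xgen : forall P : A -> Prop, (forall c, P (sc c)) -> (forall i, P (x i)) ->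
  (forall a b, P a -> P b -> P (a + b)) -> (forall a b, P a -> P b -> P (a * b)) -> forall a, P a.

Definition word (l : seq 'I_m) : A := \prod_(i <- l) x i.
Definition wspan N := lspan sc (fun b => exists l : seq 'I_m, (size l <= N)%N /\ b = word l).
Definition mword (g : 'X_{1..m}) : seq 'I_m := flatten [seq nseq (g i) i | i <- enum 'I_m].

Lemma wspan_le N N' a : (N <= N')%N -> wspan N a -> wspan N' a.
Proof.
move=> le; apply: (lspan_sub scC) => _ [l [sl ->]]; apply: lspan_mem.
by exists l; rewrite (leq_trans sl).
Qed.

Lemma wspanM N N' a b : wspan N a -> wspan N' b -> wspan (N + N') (a * b).
Proof.
move=> Na Nb; apply: (@lspan_bind _ _ _ scC _ _ (fun a => a * b) _ _ _ _ Na).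
- by move=> u v; rewrite mulrDl.
- by move=> c u; rewrite mulrA.
move=> _ [l [sl ->]]; apply: (@lspan_bind _ _ _ scC _ _ (fun b => word l * b) _ _ _ _ Nb).
- by move=> u v; rewrite mulrDr.
- by move=> c u; rewrite !mulrA scC.
move=> _ [l' [sl' ->]]; apply: lspan_mem; exists (l ++ l'); rewrite size_cat leq_add //.
by rewrite /word big_cat.
Qed.

Lemma wspan_word l : wspan (size l) (word l).
Proof. by apply: lspan_mem; exists l. Qed.

(** The graded ring of the length filtration is commutative: a commutator has length one less than
    the product. *)
Lemma wspan_comm i l : wspan (size l) (x i * word l - word l * x i).
Proof.
elim: l => [|j l IH]; first by rewrite /word big_nil mulr1 mul1r subrr; constructor.
rewrite /word big_cons -/(word l) -/(adj (x i) (x j * word l)) adjM.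
apply: lspanD; last first.
  apply: (@wspanM 1 (size l)) => //; apply: lspan_mem; exists [:: j]; by rewrite /word big_seq1.
apply: (@wspanM 1 (size l)); last exact: wspan_word.
apply: (lspan_sub scC) (xbr i j) => _ [p ->]; apply: lspan_mem; exists [:: p].
by rewrite /word big_seq1.
Qed.

Lemma size_mword g : size (mword g) = mdeg g.
Proof.
rewrite size_flatten sumnE mdegE /shape -map_comp big_map big_enum /=.
by apply: eq_bigr => i _; rewrite size_nseq.
Qed.

Lemma mwordU g i : exists l1 l2, mword g = l1 ++ l2 /\ mword (g + U_(i))%MM = l1 ++ i :: l2.
Proof.
have ie : i \in enum 'I_m by rewrite mem_enum.
have := enum_uniq 'I_m; rewrite /mword; case/splitPr: ie => p1 p2.
rewrite cat_uniq /= => /and3P [_ /norP [ip1 _] /andP [ip2 _]].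
have off s : i \notin s -> [seq nseq ((g + U_(i))%MM j) j | j <- s] = [seq nseq (g j) j | j <- s].
  move=> is_; apply/eq_in_map => j js; rewrite mnmDE mnm1E.
  by case: eqP => [ij|]; [rewrite ij js in is_|rewrite addn0].
exists (flatten [seq nseq (g j) j | j <- p1]), (nseq (g i) i ++ flatten [seq nseq (g j) j | j <- p2]).
by rewrite !map_cat !flatten_cat /= !off // mnmDE mnm1E eqxx addn1.
Qed.

Lemma x_mword i g : wspan (mdeg g) (x i * word (mword g) - word (mword (g + U_(i))%MM)).
Proof.
have [l1 [l2 [e1 e2]]] := mwordU g i.
rewrite -size_mword e2 e1 size_cat /word !big_cat big_cons /= -!/(word _).
rewrite mulrA [word l1 * (x i * _)]mulrA -mulrBl.
by apply: wspanM; [apply: wspan_comm|apply: wspan_word].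
Qed.

(** The spanning half of the Poincare-Birkhoff-Witt theorem, which survives in any quotient. *)
Lemma wspan_mword N a : wspan N a ->
  lspan sc (fun b => exists g, (mdeg g <= N)%N /\ b = word (mword g)) a.
Proof.
elim: N a => [|N IH] a.
  apply: (lspan_sub scC) => _ [l [+ ->]]; rewrite leqn0 size_eq0 => /eqP ->; apply: lspan_mem; exists 0%MM; rewrite mdeg0; split=> //.
  by congr word; apply/esym/size0nil; rewrite size_mword mdeg0.
have up b : lspan sc (fun b => exists g, (mdeg g <= N)%N /\ b = word (mword g)) b ->
    lspan sc (fun b => exists g, (mdeg g <= N.+1)%N /\ b = word (mword g)) b.
  by apply: (lspan_sub scC) => _ [g [dg ->]]; apply: lspan_mem; exists g; rewrite leqW.
apply: (lspan_sub scC) => _ [[|i l] [sl ->]].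
  by apply/up/IH/lspan_mem; exists [::].
rewrite /word big_cons -/(word l).
have /IH : wspan N (word l) by apply: lspan_mem; exists l.
apply: (@lspan_bind _ _ _ scC _ _ (fun b => x i * b)).
- by move=> u v; rewrite mulrDr.
- by move=> c u; rewrite !mulrA scC.
move=> _ [g [dg ->]]; rewrite -[x i * _](subrK (word (mword (g + U_(i))%MM))).
apply: lspanD; first by apply/up/IH/(wspan_le dg)/x_mword.
by apply: lspan_mem; exists (g + U_(i))%MM; rewrite mdegD mdeg1 addn1.
Qed.

Lemma wspan_all a : exists N, wspan N a.
Proof.
elim/xgen: a => [c|i|a b [N Na] [N' Nb]|a b [N Na] [N' Nb]].
- exists 0%N; rewrite -[sc c]mulr1 -[_ * 1]addr0; apply: lspan_cons; last by constructor.
  by exists [::]; rewrite /word big_nil.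
- by exists 1%N; apply: lspan_mem; exists [:: i]; rewrite /word big_seq1.
- by exists (N + N')%N; apply: lspanD; [apply: (wspan_le _ Na)|apply: (wspan_le _ Nb)]; rewrite ?leq_addr ?leq_addl.
by exists (N + N')%N; apply: wspanM.
Qed.

Variables (V : lmodType A) (zeta : V -> V).
Hypothesis simpleV : simple_mod V.
Hypothesis zetaD : forall u v, zeta (u + v) = zeta u + zeta v.
Hypothesis zetaZ : forall a v, zeta (a *: v) = a *: zeta v.

Definition pz (p : {poly k}) (v : V) : V := \sum_(i < size p) sc p`_i *: iter i zeta v.

Lemma zeta0 : zeta 0 = 0. Proof. by have := zetaZ 0 0; rewrite !scale0r. Qed.

Lemma iter_zetaD i u v : iter i zeta (u + v) = iter i zeta u + iter i zeta v.
Proof. by elim: i => //= i ->; rewrite zetaD. Qed.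

Lemma iter_zetaZ i a v : iter i zeta (a *: v) = a *: iter i zeta v.
Proof. by elim: i => //= i ->; rewrite zetaZ. Qed.

Lemma pzE (p : {poly k}) v N : (size p <= N)%N -> pz p v = \sum_(i < N) sc p`_i *: iter i zeta v.
Proof.
move=> le; rewrite /pz (big_ord_widen N (fun i => sc p`_i *: iter i zeta v) le) big_mkcond /=.
apply: eq_bigr => i _; case: ltnP => // le'; by rewrite nth_default // rmorph0 scale0r.
Qed.

Lemma pzDr p u v : pz p (u + v) = pz p u + pz p v.
Proof. by rewrite /pz -big_split; apply: eq_bigr => i _; rewrite iter_zetaD scalerDr. Qed.

Lemma pzZ p a v : pz p (a *: v) = a *: pz p v.
Proof.
rewrite /pz scaler_sumr; apply: eq_bigr => i _.
by rewrite iter_zetaZ !scalerA scC.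
Qed.

Lemma pzr0 p : pz p 0 = 0. Proof. by have := pzZ p 0 0; rewrite !scale0r. Qed.

Lemma pzDl p q v : pz (p + q) v = pz p v + pz q v.
Proof.
pose N := maxn (size p) (size q).
rewrite (@pzE (p + q) v N) ?size_polyD // (@pzE p v N) ?leq_maxl // (@pzE q v N) ?leq_maxr //.
by rewrite -big_split; apply: eq_bigr => i _; rewrite coefD rmorphD scalerDl.
Qed.

Lemma pzC c v : pz c%:P v = sc c *: v.
Proof. by rewrite (@pzE _ v 1%N) ?size_polyC_leq1 // big_ord1 coefC. Qed.

Lemma pzCM c p v : pz (c%:P * p) v = sc c *: pz p v.
Proof.
rewrite (@pzE _ v (size p)) ?mul_polyC ?size_scale_leq // /pz scaler_sumr.
by apply: eq_bigr => i _; rewrite coefZ rmorphM scalerA.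
Qed.

Lemma pzN p v : pz (- p) v = - pz p v.
Proof.
apply/eqP; rewrite -addr_eq0 -pzDl addNr -(rmorph0 (@polyC k)) pzC.
by rewrite rmorph0 scale0r.
Qed.

Lemma pzXM p v : pz ('X * p) v = zeta (pz p v).
Proof.
have zS N (F : 'I_N -> V) : zeta (\sum_i F i) = \sum_i zeta (F i).
  by elim/big_rec2: _ => [|i y z _ <-]; rewrite ?zeta0 ?zetaD.
rewrite (@pzE _ v (size p).+1); last first.
  by have [->|p0] := eqVneq p 0; [rewrite mulr0 size_poly0|rewrite mulrC size_mulX].
rewrite big_ord_recl coefXM rmorph0 scale0r add0r /pz zS.
by apply: eq_bigr => i _; rewrite zetaZ coefXM /=.
Qed.

Lemma pzM p q v : pz (p * q) v = pz p (pz q v).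
Proof.
elim/poly_ind: p v => [|p c IH] v.
  by rewrite mul0r -(rmorph0 (@polyC k)) !pzC rmorph0 !scale0r.
rewrite mulrDl !pzDl pzCM pzC -mulrA [p * ('X * q)]mulrCA pzXM IH.
by rewrite [p * 'X]mulrC pzXM.
Qed.

Variable v0 : V.

(** The [k[zeta]]-submodule generated by the ordered monomials below [b], applied to [v0]. The
    monomial order refines the total degree, so commutator corrections are always lower. *)
Inductive lowerthan (b : 'X_{1..m}) : V -> Prop :=
| lowerthan0 : lowerthan b 0
| lowerthan_cons p g w : (g < b)%O -> lowerthan b w -> lowerthan b (pz p (word (mword g) *: v0) + w).

Lemma lowerthanD b u w : lowerthan b u -> lowerthan b w -> lowerthan b (u + w).
Proof.
elim=> [|p g u' lt _ IH] hw; first by rewrite add0r.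
by rewrite -addrA; apply: lowerthan_cons => //; apply: IH.
Qed.

Lemma lowerthan_pz b q u : lowerthan b u -> lowerthan b (pz q u).
Proof.
elim=> [|p g u' lt _ IH]; first by rewrite pzr0; constructor.
by rewrite pzDr -pzM; apply: lowerthan_cons.
Qed.

Lemma lowerthanN b u : lowerthan b u -> lowerthan b (- u).
Proof.
move=> /(lowerthan_pz (-1)%:P); rewrite pzC rmorphN rmorph1.
by rewrite scaleN1r.
Qed.

Lemma lowerthan_mem b p g : (g < b)%O -> lowerthan b (pz p (word (mword g) *: v0)).
Proof. by move=> lt; rewrite -[pz _ _]addr0; apply: lowerthan_cons => //; constructor. Qed.

Lemma lowerthan_wspan b N a : (N < mdeg b)%N -> wspan N a -> lowerthan b (a *: v0).
Proof.
move=> lt /wspan_mword; elim=> [|c _ a' [g [dg ->]] _ IH]; first by rewrite scale0r; constructor.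
rewrite scalerDl -scalerA -pzC; apply: lowerthan_cons => //.
by apply: lt_mdeg_ltmc; apply: leq_ltn_trans lt.
Qed.

Lemma x_word_lower i p g (b : 'X_{1..m}) : (mdeg g < mdeg b)%N ->
  lowerthan b (x i *: pz p (word (mword g) *: v0) - pz p (word (mword (g + U_(i))%MM) *: v0)).
Proof.
move=> lt; rewrite -pzZ -[- _]scaleN1r -pzZ -pzDr scaleN1r scalerA -scalerBl.
by apply/lowerthan_pz/(lowerthan_wspan lt)/x_mword.
Qed.

Lemma lowerthan_x i b u : lowerthan b u -> lowerthan (b + U_(i))%MM (x i *: u).
Proof.
elim=> [|p g u' lt _ IH]; first by rewrite scaler0; constructor.
rewrite scalerDr; apply: lowerthanD => //.
rewrite -[x i *: _](subrK (pz p (word (mword (g + U_(i))%MM) *: v0))).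
apply: lowerthanD; last by apply: lowerthan_mem; rewrite ltmc_add2l.
by apply: x_word_lower; rewrite mdegD mdeg1 addn1 ltnS lemc_mdeg // ltW.
Qed.

(** That is, [p] kills the class of the monomial [b] in the corresponding successive quotient over
    [k[zeta]]. *)
Definition leading_relation b p := lowerthan b (pz p (word (mword b) *: v0)).

Lemma leading_relationU b p i : leading_relation b p -> leading_relation (b + U_(i))%MM p.
Proof.
move=> /(lowerthan_x i) h; rewrite /leading_relation.
have := @x_word_lower i p b (b + U_(i))%MM; rewrite mdegD mdeg1 addn1 => /(_ (ltnSn _)) /lowerthanN.
by move=> /(lowerthanD h); rewrite opprB addrCA subrr addr0.
Qed.

Lemma leading_relation_le a b p : (a <= b)%MM -> leading_relation a p -> leading_relation b p.
Proof.
move=> ab ha; rewrite -(submK ab); move: (b - a)%MM => c {ab b}.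
have [N] := ubnP (mdeg c); elim: N c => // N IH c lt.
have [->|/eqP c0] := eqVneq c 0%MM; first by rewrite add0m.
have [i ci] : exists i, (0 < c i)%N.
  apply: contrapT => /forallNP h; apply: c0; apply/mnmP => i; rewrite mnm0E.
  by apply/eqP; rewrite -leqn0 leqNgt; apply/negP/h.
have ic : (U_(i) <= c)%MM.
  by apply/mnm_lepP => j; rewrite mnm1E; case: eqP => // <-.
rewrite -(submK ic) -addmA [(U_(i) + a)%MM]addmC addmA.
apply/leading_relationU/IH; rewrite -ltnS (leq_trans _ lt) // ltnS.
by rewrite -[in X in (_ < X)%N](submK ic) mdegD mdeg1 addn1.
Qed.

Lemma leading_relationM b p q : leading_relation b p -> leading_relation b (q * p).
Proof. by rewrite /leading_relation pzM; apply: lowerthan_pz. Qed.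

(** Torsion at [a] persists at all multiples of [a], so Dickson's lemma leaves finitely many
    exponents to treat, and the product of their annihilators serves everywhere. *)
Lemma uniform_leading_relation :
  exists2 s : {poly k}, s != 0 & forall b, (exists2 p : {poly k}, p != 0 & leading_relation b p) -> leading_relation b s.
Proof.
have [l [lP cov]] := dickson (fun b => exists2 p : {poly k}, p != 0 & leading_relation b p).
have [s s0 sP] : exists2 s : {poly k}, s != 0 & forall b, b \in l -> leading_relation b s.
  elim: l lP {cov} => [|a l IH] lP; first by exists 1; rewrite ?oner_neq0.
  have [b bl|s s0 sP] := IH; first by apply: lP; rewrite inE bl orbT.
  have [p p0 pP] := lP a (mem_head _ _); exists (p * s); first by rewrite mulf_neq0.
  move=> b; rewrite inE => /orP [/eqP->|/sP h]; first by rewrite mulrC; apply: leading_relationM.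
  exact: leading_relationM.
by exists s => // b /cov [a /sP h ab]; apply: leading_relation_le h.
Qed.

Hypothesis v0N : v0 <> 0.

Lemma lowerthan_le b b' u : (b <= b')%O -> lowerthan b u -> lowerthan b' u.
Proof.
move=> le; elim=> [|p g w lt _ IH]; first by constructor.
by apply: lowerthan_cons => //; apply: lt_le_trans le.
Qed.

Lemma word_mword0 : word (mword 0%MM) = 1.
Proof. by rewrite (_ : mword _ = [::]) ?/word ?big_nil //; apply/size0nil; rewrite size_mword mdeg0. Qed.

Definition lowereq b w := exists p u, lowerthan b u /\ w = pz p (word (mword b) *: v0) + u.

Lemma lowereq0 : lowereq 0%MM 0.
Proof.
exists 0, 0; split; first by constructor.
by rewrite -(rmorph0 (@polyC k)) pzC rmorph0 scale0r addr0.
Qed.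

Lemma lowereqD b b' w w' : lowereq b w -> lowereq b' w' ->
  lowereq b (w + w') \/ lowereq b' (w + w').
Proof.
wlog le : b b' w w' / (b <= b')%O.
  move=> H hw hw'; case: (leP b b') => [le|/ltW le]; first exact: H.
  by rewrite addrC or_comm; apply: H.
move=> [p [u [hu ->]]] [p' [u' [hu' ->]]]; right.
move: le; rewrite le_eqVlt => /orP [/eqP bb'|lt].
  subst b'; exists (p + p'), (u + u'); split; first exact: lowerthanD.
  by rewrite pzDl addrACA.
exists p', (pz p (word (mword b) *: v0) + u + u'); split; last by rewrite addrCA.
by apply: lowerthanD => //; apply: lowerthan_cons => //; apply: lowerthan_le hu; apply: ltW.
Qed.

Lemma lowerthan_bound b u : lowerthan b u -> b <> 0%MM -> exists2 b', (b' < b)%O & lowereq b' u.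
Proof.
move=> + b0; elim=> [|p g u' lt _ [b' lt' hw]].
  by exists 0%MM; [rewrite lt_def le0x andbT; apply/eqP|exact: lowereq0].
have hg : lowereq g (pz p (word (mword g) *: v0)).
  by exists p, 0; split; [constructor|rewrite addr0].
by case: (lowereqD hg hw) => h; [exists g|exists b'].
Qed.

(* Quillen's lemma, by generic freeness: after inverting s, the successive *)
(* quotients of the filtration by leading monomials are free over k[zeta], so *)
(* zeta - lambda is not surjective when s(lambda) <> 0. *)
Lemma simple_endo_scalar : exists c, forall v, zeta v = sc c *: v.
Proof.
apply: contrapT => /forallNP nosc.
have [_ simp] := simpleV.
have subZ c u v : zeta (u + v) - sc c *: (u + v) = (zeta u - sc c *: u) + (zeta v - sc c *: v).
  by rewrite zetaD scalerDr opprD addrACA.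
have subA c a v : zeta (a *: v) - sc c *: (a *: v) = a *: (zeta v - sc c *: v).
  by rewrite zetaZ scalerBr !scalerA scC.
have inj c v : zeta v - sc c *: v = 0 -> v = 0.
  have [|||h|all] := simp (fun v => zeta v - sc c *: v = 0).
  - by rewrite zeta0 scaler0 subrr.
  - by move=> u w hu hw; rewrite subZ hu hw addr0.
  - by move=> a u hu; rewrite subA hu scaler0.
  - exact: h.
  by case: (nosc c) => u; apply/eqP; rewrite -subr_eq0; apply/eqP/all.
have surj c v : exists w, v = zeta w - sc c *: w.
  have [|||h|//] := simp (fun v => exists w, v = zeta w - sc c *: w).
  - by exists 0; rewrite zeta0 scaler0 subrr.
  - by move=> _ _ [u ->] [w ->]; exists (u + w); rewrite subZ.
  - by move=> a _ [u ->]; exists (a *: u); rewrite subA.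
  case: v0N; apply: (inj c); apply: h; by exists v0.
have pzXc c v : pz ('X - c%:P) v = zeta v - sc c *: v.
  by rewrite pzDl -rmorphN pzC rmorphN scaleNr -['X]mulr1 pzXM -[1]/(1%:P) pzC rmorph1 scale1r.
(* Each [zeta - c] is injective when [zeta] is not a scalar; as [k] is algebraically closed, so is
   each nonzero polynomial in [zeta]. *)
have pinj (p : {poly k}) v : p != 0 -> pz p v = 0 -> v = 0.
  move=> p0; have [r pr] := closed_field_poly_normal p; rewrite pr -mul_polyC pzM pzC.
  move=> h; have {h} : pz (\prod_(z <- r) ('X - z%:P)) v = 0.
    rewrite -[LHS]scale1r -(rmorph1 sc) -(@mulVf _ (lead_coef p)) ?lead_coef_eq0 //.
    by rewrite rmorphM -scalerA h scaler0.
  elim: r {pr} => [|z r IH]; first by rewrite big_nil -[1]/(1%:P) pzC rmorph1 scale1r.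
  by rewrite big_cons pzM pzXc => /inj.
have [s s0 sP] := uniform_leading_relation.
have /closed_nonrootP [lam nroot] := s0.
have gen w : exists b, lowereq b w.
  have [a ->] : exists a, w = a *: v0.
    have [|||h|//] := simp (fun w => exists a, w = a *: v0).
    - by exists 0; rewrite scale0r.
    - by move=> _ _ [a ->] [b ->]; exists (a + b); rewrite scalerDl.
    - by move=> a _ [b ->]; exists (a * b); rewrite scalerA.
    by case: v0N; apply: h; exists 1; rewrite scale1r.
  have [N /wspan_mword] := wspan_all a.
  elim=> [|c _ a' [g [_ ->]] _ [b hb]]; first by exists 0%MM; rewrite scale0r; exact: lowereq0.
  have hg : lowereq g ((sc c * word (mword g)) *: v0).
    by exists c%:P, 0; rewrite pzC addr0 scalerA; split=> //; constructor.
  by rewrite scalerDl; case: (lowereqD hg hb) => ?; [exists g|exists b].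
(* Surjectivity of [zeta - lam] solves the equation for [N = 0]. Allowing powers of [s] on the left
   lets the induction on the leading exponent of [w] clear torsion. *)
suff H b : forall N w, lowereq b w -> pz (s ^+ N) v0 = pz ('X - lam%:P) w -> False.
  have [w hw] := surj lam v0; have [b hb] := gen w.
  by apply: (H b 0%N w hb); rewrite expr0 pzXc -hw -[1]/(1%:P) pzC rmorph1 scale1r.
have low0 u : lowerthan 0%MM u -> u = 0.
  by case=> // p g w; rewrite ltx0.
elim/(@ltmwf m): b => b IH N w [p [u [hu ->]]] eN.
have step w' N' : lowerthan b w' -> pz (s ^+ N') v0 = pz ('X - lam%:P) w' -> False.
  move=> hw' e'; case: (eqVneq b 0%MM) => [b0|/eqP b0].
    rewrite b0 in hw'; rewrite (low0 _ hw') pzr0 in e'.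
    by apply: v0N; apply: pinj e'; rewrite expf_neq0.
  by have [b' lt hb'] := lowerthan_bound hw' b0; apply: (IH b' lt N' w').
(* In the torsion case, multiplying by [s] lowers the leading exponent of [w] and raises [N] by
   one. *)
case: (pselect (exists2 p : {poly k}, p != 0 & leading_relation b p)) => [/sP hs|nB].
  apply: (step (pz s (pz p (word (mword b) *: v0) + u)) N.+1).
    by rewrite pzDr -pzM mulrC; apply: lowerthanD; [apply: leading_relationM|apply: lowerthan_pz].
  by rewrite exprS pzM eN -!pzM mulrC.
(* At the bottom the equation becomes [s ^ N = (X - lam) p], which fails at [lam]. *)
case: (eqVneq b 0%MM) => [b0|/eqP b0].
  subst b; move: eN; rewrite (low0 _ hu) addr0 word_mword0 scale1r -pzM => eN.
  have : s ^+ N - ('X - lam%:P) * p = 0.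
    apply/eqP/negP => /negP n0; apply: v0N; apply: (pinj _ _ n0).
    by rewrite pzDl pzN eN subrr.
  move=> /eqP; rewrite subr_eq0 => /eqP /(congr1 (fun q => q.[lam])).
  rewrite hornerM hornerXsubC subrr mul0r horner_exp => /eqP.
  by rewrite expf_eq0 => /andP [_]; apply/negP.
(* Since [v0] itself lies below [b], the leading term of [(zeta - lam) w] must vanish modulo lower
   terms; without torsion this forces [p = 0]. *)
have lead : leading_relation b (('X - lam%:P) * p).
  rewrite /leading_relation pzM -[pz p _](addrK u) pzDr -eN.
  apply: lowerthanD; last by apply/lowerthan_pz/lowerthanN.
  rewrite -[v0]scale1r -word_mword0; apply: lowerthan_mem.
  by rewrite lt_def le0x andbT; apply/eqP.
have p0 : p = 0.
  apply/eqP/negP => /negP p0; apply: nB; exists (('X - lam%:P) * p) => //.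
  by rewrite mulf_neq0 // polyXsubC_eq0.
apply: (step (pz p (word (mword b) *: v0) + u) N) => //.
by rewrite p0 -(rmorph0 (@polyC k)) pzC rmorph0 scale0r add0r.
Qed.

End Quillen.

Lemma cyclic_sub (A : pzRingType) (V : lmodType A) (v : V) :
  simple_mod V -> v <> 0 -> forall w, exists a, w = a *: v.
Proof.
move=> [_ simp] v0; have [|||h|//] := simp (fun w => exists a, w = a *: v).
- by exists 0; rewrite scale0r.
- by move=> _ _ [a ->] [b ->]; exists (a + b); rewrite scalerDl.
- by move=> a _ [b ->]; exists (a * b); rewrite scalerA.
by case: v0; apply: h; exists 1; rewrite scale1r.
Qed.

Lemma simple_faithful_prime (A : pzRingType) (V : lmodType A) :
  simple_mod V -> (forall a : A, (forall v : V, a *: v = 0) -> a = 0) ->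
  forall a b : A, (forall y, a * y * b = 0) -> a = 0 \/ b = 0.
Proof.
move=> simp faith a b ab; case: (pselect (b = 0)) => [|b0]; [by right|left].
have [v bv] : exists v : V, b *: v <> 0.
  by apply: contrapT => /forallNP h; apply/b0/faith => v; apply: contrapT.
by apply: faith => w; have [y ->] := cyclic_sub simp bv w; rewrite !scalerA ab scale0r.
Qed.

(** * Primitive quotients of the enveloping algebra *)

(** An abstract form of [U(g)/J] with a faithful simple module, which keeps the ring theory
    independent of how the quotient is built. *)
Record primitive_quotient (k : closedFieldType) (L : lieAlgebra k) (n : nat) (e f : 'I_n -> L) :=
  PrimitiveQuotient {
    pq_pchar0 : [pchar k] =i pred0;
    pq_simpleL : lie_simple L;
    pq_serre : serre_generators e f;
    pq_ring :> nzRingType;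
    pq_sc : {rmorphism k -> pq_ring};
    pq_scC : forall c a, pq_sc c * a = a * pq_sc c;
    pq_X : L -> pq_ring;
    pq_lin : forall a x y, pq_X (a *: x + y) = pq_sc a * pq_X x + pq_X y;
    pq_br : forall x y, pq_X (lie_br x y) = pq_X x * pq_X y - pq_X y * pq_X x;
    pq_gen : forall P : pq_ring -> Prop, (forall c, P (pq_sc c)) -> (forall x, P (pq_X x)) ->
      (forall a b, P a -> P b -> P (a + b)) -> (forall a b, P a -> P b -> P (a * b)) ->
      forall a, P a;
    pq_mod : lmodType pq_ring;
    pq_simple : simple_mod pq_mod;
    pq_faithful : forall a, (forall v : pq_mod, a *: v = 0) -> a = 0
  }.

Section PrimitiveQuotient.
Variables (k : closedFieldType) (L : lieAlgebra k) (n : nat) (e f : 'I_n -> L).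
Variable S : primitive_quotient e f.
Notation A := (pq_ring S).
Notation sc := (pq_sc S).
Notation X := (pq_X S).
Let scC : forall c (a : A), sc c * a = a * sc c := @pq_scC _ _ _ _ _ S.

Definition pqE i : A := X (e i).
Definition pqF i : A := X (f i).
Definition pqH i : A := X (coroot e f i).
Notation E := pqE.
Notation F := pqF.
Notation H := pqH.

Lemma pqX0 : X 0 = 0.
Proof.
have /eqP := pq_lin S 1 0 0; rewrite rmorph1 mul1r scaler0 addr0.
by rewrite -subr_eq subrr eq_sym => /eqP.
Qed.

Lemma pqXZ a x : X (a *: x) = sc a * X x.
Proof. by have := pq_lin S a x 0; rewrite pqX0 !addr0. Qed.

Lemma pqXD x y : X (x + y) = X x + X y.
Proof. by have := pq_lin S 1 x y; rewrite rmorph1 mul1r scale1r. Qed.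

Lemma pqX_sum (I : Type) (r : seq I) (c : I -> L) : X (\sum_(i <- r) c i) = \sum_(i <- r) X (c i).
Proof. by elim/big_rec2: _ => [|i y x _ <-]; rewrite ?pqX0 ?pqXD. Qed.

Definition pq_prime := simple_faithful_prime (@pq_simple _ _ _ _ _ S) (@pq_faithful _ _ _ _ _ S).

Lemma pqX_basis x : lspan sc (fun b => exists l : 'I_(\dim {:L}), b = X (vbasis {:L})`_l) (X x).
Proof.
rewrite (coord_vbasis (memvf x)) pqX_sum.
elim/big_rec: _ => [|i y _ IH]; first by constructor.
by rewrite pqXZ; apply: lspan_cons => //; exists i.
Qed.

(** The identity makes [y b v |-> y a v] a well-defined endomorphism of the simple module, and
    Quillen's lemma makes it a scalar. *)
Lemma pq_centroid (a b : A) : b <> 0 -> (forall y, a * y * b = b * y * a) -> exists c, a = sc c * b.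
Proof.
move=> b0 ab; have simp := @pq_simple _ _ _ _ _ S.
have [v1 bv] : exists v : pq_mod S, b *: v <> 0.
  by apply: contrapT => /forallNP h; apply/b0/pq_faithful => v; apply: contrapT.
have zer (u : pq_mod S) : (forall t, b *: (t *: u) = 0) -> u = 0.
  move=> h; apply: contrapT => u0; apply: bv.
  by have [t ->] := cyclic_sub simp u0 v1.
have wd y (v : pq_mod S) y' (v' : pq_mod S) : y *: (b *: v) = y' *: (b *: v') -> y *: (a *: v) = y' *: (a *: v').
  move=> e0; apply/subr0_eq/zer => t.
  rewrite !scalerBr !scalerA !mulrA -[b * t * y * a]mulrA -[b * t * y' * a]mulrA.
  have sw z : b * t * (z * a) = a * (t * z) * b by rewrite ab !mulrA.
  by rewrite !sw -!scalerA e0 subrr.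
have /choice [zeta zP] (w : pq_mod S) : exists w', exists y, w = y *: (b *: v1) /\ w' = y *: (a *: v1).
  by have [y ->] := cyclic_sub simp bv w; exists (y *: (a *: v1)), y.
have zE y v : zeta (y *: (b *: v)) = y *: (a *: v).
  by have [y' [e1 ->]] := zP (y *: (b *: v)); apply/esym/wd.
have zD u w : zeta (u + w) = zeta u + zeta w.
  have [y ->] := cyclic_sub simp bv u; have [z ->] := cyclic_sub simp bv w.
  by rewrite -scalerDl !zE scalerDl.
have zZ c u : zeta (c *: u) = c *: zeta u.
  by have [y ->] := cyclic_sub simp bv u; rewrite [c *: (y *: _)]scalerA !zE -scalerA.
have br i j : lspan sc (fun b => exists l : 'I_(\dim {:L}), b = X (vbasis {:L})`_l)
    (X (vbasis {:L})`_i * X (vbasis {:L})`_j - X (vbasis {:L})`_j * X (vbasis {:L})`_i).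
  by rewrite -pq_br; exact: pqX_basis.
have gen (P : A -> Prop) : (forall c, P (sc c)) -> (forall i : 'I_(\dim {:L}), P (X (vbasis {:L})`_i)) ->
    (forall a b, P a -> P b -> P (a + b)) -> (forall a b, P a -> P b -> P (a * b)) -> forall a, P a.
  move=> Psc PX PD PM; apply: pq_gen => // x.
  elim: (pqX_basis x) => [|c _ y [l ->] _ Py]; first by rewrite -(rmorph0 sc).
  by apply: PD => //; apply: PM.
have [c cP] := simple_endo_scalar scC br gen simp zD zZ bv.
exists c; apply/subr0_eq/pq_faithful => v.
by rewrite scalerBl -scalerA -cP -[b *: v]scale1r zE scale1r subrr.
Qed.
End PrimitiveQuotient.

Lemma lie_skew (k : fieldType) (L : lieAlgebra k) (x y : L) : lie_br x y = - lie_br y x.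
Proof.
have D z u v : lie_br (u + v) z = lie_br u z + lie_br v z.
  by have := lie_linl z 1 u v; rewrite !scale1r.
have D' z u v : lie_br z (u + v) = lie_br z u + lie_br z v.
  by have := lie_linr z 1 u v; rewrite !scale1r.
have := lie_alt (x + y); rewrite D !D' !lie_alt add0r addr0 => /eqP.
by rewrite addr_eq0 => /eqP.
Qed.

(** The product of the factors [(T_i - w'_i) / (w_i - w'_i)], one for each [w'] in [s], with [i] a
    coordinate where [w] and [w'] differ. The class [C] records what kind of operator results: an
    additive map for the grading of [A], the action of a degree-zero element for modules. *)
Lemma weight_projector (k : fieldType) (n : nat) (G : zmodType) (scal : k -> G -> G)
    (T : 'I_n -> G -> G) (C : (G -> G) -> Prop) :
  (forall a b x, scal a x - scal b x = scal (a - b) x) ->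
  (forall a b x, scal a (scal b x) = scal (a * b) x) ->
  (forall x, scal 1 x = x) -> (forall x, scal 0 x = 0) -> (forall a, scal a 0 = 0) ->
  (forall i a x, T i (scal a x) = scal a (T i x)) ->
  C id -> (forall g i c c', C g -> C (fun x => g (scal c (T i x - scal c' x)))) ->
  (forall g, C g -> g 0 = 0) ->
  forall (w : 'rV[k]_n) (s : seq 'rV[k]_n), w \notin s ->
  exists g, [/\ C g, forall x, (forall i, T i x = scal (w 0 i) x) -> g x = x &
    forall w' x, w' \in s -> (forall i, T i x = scal (w' 0 i) x) -> g x = 0].
Proof.
move=> scB scM sc1 scl0 sc0 Tsc C1 CT C0 w; elim=> [|w1 s IH]; first by exists id.
rewrite inE negb_or => /andP [ww1 /IH [g [Cg gw gs]]].
have [i wi] : exists i, w 0 i != w1 0 i.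
  apply: contrapT => /forallNP h; case/eqP: ww1; apply/rowP => i.
  by apply/eqP; rewrite -[_ == _]negbK; apply/negP/h.
exists (fun x => g (scal (w 0 i - w1 0 i)^-1 (T i x - scal (w1 0 i) x))); split.
- exact: CT.
- by move=> x hx; rewrite hx scB scM mulVf ?subr_eq0 // sc1 gw.
move=> w' x; rewrite inE => /orP [/eqP->|w's] hx.
  by rewrite hx scB subrr scl0 sc0 C0.
rewrite hx scB scM; apply: gs w's _ => j.
by rewrite Tsc hx !scM mulrC.
Qed.

Section PrimitiveQuotientStructure.
Variables (k : closedFieldType) (L : lieAlgebra k) (n : nat) (e f : 'I_n -> L).
Variable S : primitive_quotient e f.
Notation A := (pq_ring S).
Notation sc := (pq_sc S).
Notation X := (pq_X S).
Notation E := (pqE S).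
Notation F := (pqF S).
Notation H := (pqH S).
Let scC : forall c (a : A), sc c * a = a * sc c := @pq_scC _ _ _ _ _ S.

Lemma pqX_iter m x y : iter m (adj (X x)) (X y) = X (iter m (lie_br x) y).
Proof. by elim: m => //= m ->; rewrite pq_br. Qed.

(** The image of the Lie algebra is finite dimensional and stable under commutators; by the Leibniz
    rule, products of two such spaces are stable too. *)
Lemma pq_finite u : exists B : seq A, lspan sc (fun b => b \in B) u /\
  forall g b, (exists x, g = X x) -> b \in B -> lspan sc (fun b => b \in B) (g * b - b * g).
Proof.
elim/(@pq_gen _ _ _ _ _ S): u => [c|x|a b [B [aB hB]] [C [bC hC]]|a b [B [aB hB]] [C [bC hC]]].
- exists [:: 1]; split.
    by rewrite -[sc c]addr0 -[sc c]mulr1; apply: lspan_cons; [rewrite mem_head|constructor].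
  by move=> g b _; rewrite inE => /eqP->; rewrite mulr1 mul1r subrr; constructor.
- pose B := [seq X y | y <- vbasis {:L}].
  have XB y : lspan sc (fun b => b \in B) (X y).
    apply: (lspan_sub scC) (pqX_basis S y) => _ [l ->]; apply: lspan_mem; apply/map_f/mem_nth.
    by rewrite size_tuple.
  by exists B; split=> // g _ [z ->] /mapP [y _ ->]; rewrite -pq_br.
- have up (B1 B2 : seq A) t : {subset B1 <= B2} -> lspan sc (fun b => b \in B1) t -> lspan sc (fun b => b \in B2) t.
    by move=> sub; apply: (lspan_sub scC) => b0 /sub b0B; apply: lspan_mem.
  have sB : {subset B <= B ++ C} by move=> ?; rewrite mem_cat => ->.
  have sC : {subset C <= B ++ C} by move=> ? h; rewrite mem_cat h orbT.
  exists (B ++ C); split; first by apply: lspanD; [apply: up aB|apply: up bC].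
  by move=> g b0 hg; rewrite mem_cat => /orP [/(hB g b0 hg)|/(hC g b0 hg)]; apply: up.
pose D := [seq x * y | x <- B, y <- C].
have BC x y : lspan sc (fun b => b \in B) x -> lspan sc (fun b => b \in C) y ->
    lspan sc (fun b => b \in D) (x * y).
  move=> xB yC; apply: (lspan_bind scC (h := fun x => x * y)) xB.
  - by move=> u v; rewrite mulrDl.
  - by move=> c u; rewrite mulrA.
  move=> u uB; apply: (lspan_bind scC (h := fun y => u * y)) yC.
  - by move=> ? ?; rewrite mulrDr.
  - by move=> c v; rewrite !mulrA scC.
  by move=> v vC; apply/lspan_mem/allpairsP; exists (u, v).
exists D; split; first exact: BC.
move=> g _ hg /allpairsP [[x y] /= [xB yC ->]].
rewrite -/(adj g (x * y)) adjM; apply: lspanD; apply: BC; try exact: lspan_mem.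
  exact: hB.
exact: hC.
Qed.

Definition pqC : 'M[int]_n := sval (cid (pq_serre S)).

Lemma pqCP : [/\ cartan_matrix pqC /\ free (coroots e f),
  (forall i j, lie_br (coroot e f i) (coroot e f j) = 0) /\
  (forall i j, i != j -> lie_br (e i) (f j) = 0),
  forall i j, lie_br (coroot e f i) (e j) = (pqC i j)%:~R *: e j /\
              lie_br (coroot e f i) (f j) = - ((pqC i j)%:~R *: f j),
  forall i j, i != j ->
    iter `|1 - pqC i j|%N (lie_br (e i)) (e j) = 0 /\
    iter `|1 - pqC i j|%N (lie_br (f i)) (f j) = 0
  & forall V : {vspace L}, (forall i, e i \in V /\ f i \in V) ->
    (forall x y : L, x \in V -> y \in V -> lie_br x y \in V) -> V = fullv].
Proof. exact: (svalP (cid (pq_serre S))). Qed.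

Definition pqB : 'M[k]_n := map_mx intr pqC.

(** Positive definiteness of the symmetrized matrix gives a nonzero determinant over the rationals,
    hence over the integers, and characteristic zero carries it to [k]. *)
Lemma pqB_unit : pqB \in unitmx.
Proof.
have [[[_ _ _ [d [d0 _ pos]]] _] _ _ _ _] := pqCP.
have detN : \det pqC != 0.
  apply/negP => det0.
  have : \det ((map_mx intr pqC : 'M[rat]_n)^T) == 0 by rewrite det_tr det_map_mx (eqP det0).
  move=> /det0P [v v0 hv].
  have [i vi] : exists i, v 0 i != 0.
    apply: contrapT => /forallNP h; case/eqP: v0; apply/rowP => i; rewrite mxE.
    by apply/eqP; rewrite -[_ == _]negbK; apply/negP/h.
  have := pos (fun i => v 0 i); rewrite big1 ?ltxx => [|j _]; first by move=> h; have := h (ex_intro _ i vi).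
  have /rowP /(_ j) := hv; rewrite !mxE => hj.
  rewrite -[RHS](mulr0 (v 0 j * d j)) -[X in _ = _ * X]hj mulr_sumr; apply: eq_bigr => l _.
  by rewrite !mxE !mulrA mulrAC.
rewrite unitmxE det_map_mx unitfE; apply: contra detN => /eqP h.
by apply/eqP; apply: (intr_inj_pchar0 (pq_pchar0 S)); rewrite h.
Qed.

Lemma pqHE i : H i = E i * F i - F i * E i.
Proof. exact: pq_br. Qed.

Lemma pqEF i j : i != j -> E i * F j = F j * E i.
Proof.
have [_ [_ ef] _ _ _] := pqCP; move=> /ef ij; apply/eqP; rewrite -subr_eq0.
by rewrite -pq_br ij pqX0.
Qed.

Lemma pqHH i j : H i * H j = H j * H i.
Proof.
have [_ [hh _] _ _ _] := pqCP; apply/eqP; rewrite -subr_eq0.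
by rewrite -pq_br hh pqX0.
Qed.

Lemma pqHadE i j : adj (H i) (E j) = sc (pqB i j) * E j.
Proof. by have [_ _ /(_ i j) [h _] _ _] := pqCP; rewrite /adj -pq_br h pqXZ !mxE. Qed.

Lemma pqHadF i j : adj (H i) (F j) = - (sc (pqB i j) * F j).
Proof.
have [_ _ /(_ i j) [_ h] _ _] := pqCP.
by rewrite /adj -pq_br h -scaleNr pqXZ !mxE rmorphN mulNr.
Qed.

(* The fundamental coweights: ad (W i) reads off the i-th coordinate of the *)
(* degree. *)
Definition pqW i : A := \sum_j sc (invmx pqB i j) * H j.
Notation W := pqW.

Lemma adj_suml (I : finType) (c : I -> k) (z : I -> A) y :
  adj (\sum_i sc (c i) * z i) y = \sum_i sc (c i) * adj (z i) y.
Proof.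
rewrite /adj mulr_suml mulr_sumr -sumrB; apply: eq_bigr => i _.
by rewrite mulrBr !mulrA (scC (c i) y).
Qed.

Lemma pqWadE i j : adj (W i) (E j) = sc (i == j)%:R * E j.
Proof.
rewrite adj_suml; have /matrixP /(_ i j) := mulVmx pqB_unit; rewrite !mxE => <-.
by rewrite rmorph_sum mulr_suml; apply: eq_bigr => l _; rewrite pqHadE mulrA -rmorphM.
Qed.

Lemma pqWadF i j : adj (W i) (F j) = - (sc (i == j)%:R * F j).
Proof.
rewrite adj_suml; have /matrixP /(_ i j) := mulVmx pqB_unit; rewrite !mxE => <-.
by rewrite rmorph_sum mulr_suml -sumrN; apply: eq_bigr => l _; rewrite pqHadF mulrN mulrA -rmorphM.
Qed.

Lemma pqH_W i : H i = \sum_j sc (pqB i j) * W j.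
Proof.
under eq_bigr do rewrite mulr_sumr.
have col l : \sum_j sc (pqB i j) * (sc (invmx pqB j l) * H l) = sc (i == l)%:R * H l.
  have /matrixP /(_ i l) := mulmxV pqB_unit; rewrite !mxE => <-.
  by rewrite rmorph_sum mulr_suml; apply: eq_bigr => j _; rewrite mulrA -rmorphM.
rewrite exchange_big /= (eq_bigr _ (fun l _ => col l)) (bigD1 i) //= big1 ?addr0 => [|l li].
  by rewrite eqxx rmorph1 mul1r.
by rewrite eq_sym (negbTE li) rmorph0 mul0r.
Qed.

Lemma pqWH i j : W i * H j = H j * W i.
Proof.
rewrite /W mulr_suml mulr_sumr; apply: eq_bigr => l _.
by rewrite -mulrA pqHH !mulrA scC.
Qed.

Lemma pqWW i j : W i * W j = W j * W i.
Proof.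
rewrite {2 3}/W mulr_suml mulr_sumr; apply: eq_bigr => l _.
by rewrite -mulrA -pqWH !mulrA scC.
Qed.

Lemma pq_EFgen (P : A -> Prop) : (forall c, P (sc c)) -> (forall i, P (E i)) -> (forall i, P (F i)) ->
  (forall a b, P a -> P b -> P (a + b)) -> (forall a b, P a -> P b -> P (a * b)) -> forall a, P a.
Proof.
move=> Psc PE PF PD PM; apply: (@pq_gen _ _ _ _ _ S) => // x.
have PN a : P a -> P (- a).
  by move=> Pa; rewrite -mulN1r -(rmorphN1 sc); apply: PM.
have [||V VP] := @vspace_of_pred _ L (fun x => P (X x)).
- by rewrite pqX0 -(rmorph0 sc).
- by move=> a y z Py Pz; rewrite pq_lin; apply: PD => //; apply: PM.
have [_ _ _ _ gen] := pqCP; have VT : V = fullv.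
  apply: gen => [i|y z /VP Py /VP Pz]; first by split; apply/VP; [exact: PE|exact: PF].
  apply/VP; rewrite pq_br; apply: PD; first exact: PM.
  by apply/PN/PM.
by apply/VP; rewrite VT memvf.
Qed.

Lemma adjD (z x y : A) : adj z (x + y) = adj z x + adj z y.
Proof. exact: (iter_adjD z 1). Qed.

Lemma adj_self (z : A) : adj z z = 0. Proof. exact: subrr. Qed.

Lemma adj_sc z c : adj z (sc c) = 0. Proof. by rewrite /adj scC subrr. Qed.

Lemma adjN (z y : A) : adj z (- y) = - adj z y.
Proof. by rewrite /adj mulrN mulNr opprB opprK addrC. Qed.

Lemma adjC (z y : A) : adj z y = - adj y z. Proof. by rewrite /adj opprB. Qed.

Lemma pq_adnil (z : A) : (forall j, exists m, iter m (adj z) (E j) = 0) ->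
  (forall j, exists m, iter m (adj z) (F j) = 0) -> forall y, exists m, iter m (adj z) y = 0.
Proof.
move=> nE nF; elim/pq_EFgen => [c||||] //.
- by exists 1%N; rewrite /= adj_sc.
- move=> a b [m hm] [m' hm']; exists (m + m')%N; rewrite iter_adjD.
  by rewrite (iter_adj_le _ hm) ?leq_addr // (iter_adj_le _ hm') ?leq_addl // addr0.
by move=> a b [m hm] [m' hm']; exists (m + m')%N; apply: iter_adjM.
Qed.

(** On [E j] this is a Serre relation; on [F i] three steps suffice, through [H i] and a multiple of
    [E i]. *)
Lemma pq_adnilE i y : exists m, iter m (adj (E i)) y = 0.
Proof.
have [_ _ _ ser _] := pqCP; move: y; apply: pq_adnil => j.
  have [->|ij] := eqVneq i j; first by exists 1%N; exact: adj_self.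
  by exists `|1 - pqC i j|%N; rewrite pqX_iter (ser i j ij).1 pqX0.
have [<-|ij] := eqVneq i j; last by exists 1%N; rewrite /= /adj pqEF // subrr.
exists 3%N; rewrite /= -[adj (E i) (F i)]pqHE [adj (E i) (H i)]adjC pqHadE -mulNr -rmorphN.
by rewrite adjM adj_sc adj_self mul0r mulr0 addr0.
Qed.

Lemma pq_adnilF i y : exists m, iter m (adj (F i)) y = 0.
Proof.
have [_ _ _ ser _] := pqCP; move: y; apply: pq_adnil => j; last first.
  have [->|ij] := eqVneq i j; first by exists 1%N; exact: adj_self.
  by exists `|1 - pqC i j|%N; rewrite pqX_iter (ser i j ij).2 pqX0.
have [<-|ij] := eqVneq i j; last by exists 1%N; rewrite /= /adj pqEF 1?eq_sym // subrr.
exists 3%N; rewrite /= [adj (F i) (E i)]adjC -[adj (E i) (F i)]pqHE !adjN [adj (F i) (H i)]adjC pqHadF opprK.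
by rewrite adjM adj_sc adj_self mul0r mulr0 addr0 oppr0.
Qed.

Definition regular (z : A) := forall u, (z * u = 0 -> u = 0) /\ (u * z = 0 -> u = 0).

(* If u z = 0 then ad(z)^m u = z^m u, so left regularity of z suffices. *)
Lemma pq_regular_or_nilpotent z : (forall y, exists m, iter m (adj z) y = 0) ->
  (exists m, z ^+ m = 0) \/ regular z.
Proof.
move=> nilz.
have genX (P : A -> Prop) : (forall c, P (sc c)) -> (forall g, (exists x, g = X x) -> P g) ->
    (forall a b, P a -> P b -> P (a + b)) -> (forall a b, P a -> P b -> P (a * b)) -> forall a, P a.
  by move=> Psc PX PD PM; apply: (@pq_gen _ _ _ _ _ S) => // x; apply: PX; exists x.
have [|reg] := adnil_regular_or_nilpotent scC (@pq_prime _ _ _ _ _ S) genX pq_finite nilz; first by left.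
right=> u; split; first exact: reg.
move=> uz; have [m hm] := nilz u.
have hz l : iter l (adj z) u = z ^+ l * u.
  elim: l => [|l /= ->]; first by rewrite expr0 mul1r.
  by rewrite /adj -mulrA uz mulr0 subr0 mulrA exprS.
move: hm; rewrite hz; elim: m => [|m IH]; first by rewrite expr0 mul1r.
by rewrite exprS -mulrA => /reg.
Qed.

Lemma regularM a b : regular a -> regular b -> regular (a * b).
Proof.
move=> ra rb u; split=> h; first by apply/(rb u).1/(ra _).1; rewrite mulrA.
by apply/(ra u).2/(rb _).2; rewrite -mulrA.
Qed.

Lemma regular1 : regular 1.
Proof. by move=> u; rewrite mul1r mulr1. Qed.

(** Mirrors [tgwc_homog] with scalars as the only constants, so that degree zero holds exactly what
    the [E i] and [F i] produce. *)
Inductive hdeg : 'rV[int]_n -> A -> Prop :=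
| hg_sc c : hdeg 0 (sc c)
| hg_E i : hdeg (delta_mx 0 i) (E i)
| hg_F i : hdeg (- delta_mx 0 i) (F i)
| hg_0 d : hdeg d 0
| hg_D d x y : hdeg d x -> hdeg d y -> hdeg d (x + y)
| hg_M d d' x y : hdeg d x -> hdeg d' y -> hdeg (d + d') (x * y).

Lemma hdeg_adW d a i : hdeg d a -> adj (W i) a = sc (d 0 i)%:~R * a.
Proof.
elim=> {d a} [c|j|j|d|d x y _ IHx _ IHy|d d' x y _ IHx _ IHy].
- by rewrite adj_sc mxE rmorph0 mul0r.
- by rewrite pqWadE mxE eqxx /=; case: (i == j); rewrite ?rmorph0 ?rmorph1.
- by rewrite pqWadF !mxE eqxx /= rmorphN /= rmorphN mulNr; case: (i == j); rewrite ?rmorph0 ?rmorph1.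
- by rewrite /adj !mulr0 mul0r subrr.
- by rewrite /adj mulrDr mulrDl opprD addrACA -!/(adj _ _) IHx IHy mulrDr.
by rewrite adjM IHx IHy mxE rmorphD rmorphD mulrDl !mulrA -scC.
Qed.

Lemma hdeg_Z d c a : hdeg d a -> hdeg d (sc c * a).
Proof. by move=> h; rewrite -[d]add0r; apply: hg_M => //; constructor. Qed.

Lemma hdeg_N d a : hdeg d a -> hdeg d (- a).
Proof. by move=> h; rewrite -mulN1r -(rmorphN1 sc); apply: hdeg_Z. Qed.

Lemma hdeg_M0 d a b : hdeg 0 a -> hdeg d b -> hdeg d (a * b).
Proof. by move=> ha hb; rewrite -[d]add0r; apply: hg_M. Qed.

Lemma hdeg_MV d a b : hdeg d a -> hdeg (- d) b -> hdeg 0 (a * b).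
Proof. by move=> ha hb; rewrite -(subrr d); apply: hg_M. Qed.

Lemma hdeg_H i : hdeg 0 (H i).
Proof.
rewrite pqHE; apply: hg_D.
  by apply: hdeg_MV; [apply: hg_E|apply: hg_F].
apply: hdeg_N; apply: (@hdeg_MV (- delta_mx 0 i)); first exact: hg_F.
by rewrite opprK; apply: hg_E.
Qed.

Lemma hdeg_sum d (I : Type) (r : seq I) (P : pred I) (c : I -> A) :
  (forall i, P i -> hdeg d (c i)) -> hdeg d (\sum_(i <- r | P i) c i).
Proof. by move=> h; elim/big_rec: _ => [|i x Pi hx]; [constructor|apply: hg_D => //; apply: h]. Qed.

Lemma hdeg_W i : hdeg 0 (W i).
Proof. by apply: hdeg_sum => j _; apply/hdeg_Z/hdeg_H. Qed.

Lemma hdeg_dec a : exists s : seq ('rV[int]_n * A),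
  (forall p, p \in s -> hdeg p.1 p.2) /\ a = \sum_(p <- s) p.2.
Proof.
have one d b : hdeg d b -> exists s : seq ('rV[int]_n * A),
    (forall p, p \in s -> hdeg p.1 p.2) /\ b = \sum_(p <- s) p.2.
  by move=> h; exists [:: (d, b)]; rewrite big_seq1; split=> // p; rewrite inE => /eqP->.
elim/pq_EFgen: a => [c|i|i|a b [s [sh ->]] [t [th ->]]|a b [s [sh ->]] [t [th ->]]].
- by apply: one; constructor.
- by apply: one; constructor.
- by apply: one; constructor.
- exists (s ++ t); rewrite big_cat; split=> // p; rewrite mem_cat => /orP []; [exact: sh|exact: th].
exists [seq (p.1 + q.1, p.2 * q.2) | p <- s, q <- t]; split.
  by move=> _ /allpairsP [[p q] /= [ps qt ->]]; apply: hg_M; [apply: sh|apply: th].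
rewrite big_allpairs_dep mulr_suml; apply: eq_bigr => p _; by rewrite mulr_sumr.
Qed.

(** In characteristic zero, distinct degrees are distinct joint eigenvalues of the [ad (W i)], and a
    projector isolates one of them. *)
Lemma hdeg_sep (s : seq ('rV[int]_n * A)) : (forall p, p \in s -> hdeg p.1 p.2) ->
  \sum_(p <- s) p.2 = 0 -> forall d, \sum_(p <- s | p.1 == d) p.2 = 0.
Proof.
move=> sh s0 d; pose wt (d : 'rV[int]_n) : 'rV[k]_n := map_mx intr d.
have wt_inj : injective wt.
  move=> d1 d2 /rowP h; apply/rowP => i; apply: (intr_inj_pchar0 (pq_pchar0 S)).
  by have := h i; rewrite !mxE.
have [||||||||||g [Cg gw gs]] := @weight_projector k n A (fun c a => sc c * a) (fun i => adj (W i))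
  (fun g => forall x y, g (x + y) = g x + g y) _ _ _ _ _ _ _ _ _ (wt d)
  [seq wt p.1 | p <- s & p.1 != d].
- by move=> a b x; rewrite -mulrBl -rmorphB.
- by move=> a b x; rewrite mulrA -rmorphM.
- by move=> x; rewrite rmorph1 mul1r.
- by move=> x; rewrite rmorph0 mul0r.
- by move=> a; rewrite mulr0.
- by move=> i a x; rewrite adjM adj_sc mul0r add0r.
- by [].
- move=> g i c c' gD x y; rewrite -gD; congr g.
  by rewrite adjD [sc c' * (x + y)]mulrDr opprD addrACA mulrDr.
- by move=> g gD; have /eqP := gD 0 0; rewrite addr0 -subr_eq subrr eq_sym => /eqP.
- apply/negP => /mapP [p]; rewrite mem_filter => /andP [pd _] /wt_inj dp.
  by rewrite dp eqxx in pd.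
have g0 : g 0 = 0 by have /eqP := Cg 0 0; rewrite addr0 -subr_eq subrr eq_sym => /eqP.
have : g (\sum_(p <- s) p.2) = \sum_(p <- s) g p.2.
  by elim/big_rec2: _ => // p x y _ <-.
rewrite s0 g0 => e0; rewrite [RHS]e0 big_mkcond big_seq [RHS]big_seq; apply: eq_bigr => p ps.
case: eqP => [pd|/eqP pd].
  rewrite gw // => i; rewrite (hdeg_adW i (sh p ps)) -pd !mxE //.
apply/esym/(gs (wt p.1)); first by apply: map_f; rewrite mem_filter pd.
by move=> i; rewrite (hdeg_adW i (sh p ps)) !mxE.
Qed.

End PrimitiveQuotientStructure.

(** * Finite differences and Lagrange interpolation *)

Definition pdiff (k : fieldType) (p : {poly k}) : {poly k} := p \Po ('X + 1) - p.

Lemma size_pdiff (k : fieldType) (p : {poly k}) m : (size p <= m.+1)%N -> (size (pdiff p) <= m)%N.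
Proof.
have szX : size ('X + 1 : {poly k}) = 2%N by rewrite -[1]/(1%:P) size_XaddC.
elim/poly_ind: p m => [|p c IH] m; first by rewrite /pdiff comp_poly0 subr0 size_poly0.
have dE : pdiff (p * 'X + c%:P) = pdiff p * 'X + (p \Po ('X + 1)).
  rewrite /pdiff comp_polyD comp_polyM comp_polyX comp_polyC opprD addrACA subrr addr0.
  by rewrite mulrDr mulr1 mulrBl addrAC.
have [->|p0] := eqVneq p 0.
  by rewrite mul0r add0r /pdiff comp_polyC subrr size_poly0.
rewrite size_MXaddC (negbTE p0) /= ltnS => le.
rewrite dE; apply: leq_trans (size_polyD _ _) _; rewrite geq_max.
have -> : size (p \Po ('X + 1)) = size p by rewrite size_comp_poly2 // szX.
rewrite le andbT.
case: m le => [|m] le; first by move: le; rewrite leqn0 size_poly_eq0 (negbTE p0).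
apply: leq_trans (size_polyMleq _ _) _; rewrite size_polyX addn2 /= ltnS.
exact: IH.
Qed.

Lemma iter_pdiff0 (k : fieldType) (p : {poly k}) m : (size p <= m)%N -> iter m (@pdiff k) p = 0.
Proof.
elim: m p => [|m IH] p le; first by apply/eqP; rewrite -size_poly_eq0 -leqn0.
by rewrite iterSr IH // size_pdiff.
Qed.

Lemma pdiff_horner (k : fieldType) (p : {poly k}) x : (pdiff p).[x] = p.[x + 1] - p.[x].
Proof. by rewrite hornerD hornerN horner_comp hornerD hornerX hornerE. Qed.

Lemma lagrange_basis (k : fieldType) (N : nat) : [pchar k] =i pred0 ->
  exists l : 'I_N -> {poly k}, (forall i, (size (l i) <= N)%N) /\
    forall i j : 'I_N, (l i).[j%:R] = (i == j)%:R.
Proof.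
move=> ch; have inj := natr_inj_pchar0 ch.
pose q (i : 'I_N) := \prod_(j < N | j != i) ('X - (j%:R)%:P : {poly k}).
have q0 i : (q i).[i%:R] != 0.
  rewrite horner_prod; apply/prodf_neq0 => j ji; rewrite hornerXsubC subr_eq0.
  by apply: contra ji => /eqP /inj /val_inj ->.
exists (fun i => ((q i).[i%:R])^-1 *: q i); split=> [i|i j].
  apply: leq_trans (size_scale_leq _ _) _.
  rewrite /q -big_filter size_prod_XsubC size_filter -sum1_count sum1_card.
  by have := cardC1 i; rewrite card_ord => ->; rewrite prednK // (leq_ltn_trans _ (ltn_ord i)).
rewrite hornerZ; have [->|ij] := eqVneq i j; first by rewrite mulVf.
have ji : j != i by rewrite eq_sym.
by rewrite [(q i).[j%:R]]horner_prod (bigD1 j ji) /= hornerXsubC subrr mul0r mulr0.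
Qed.

(** * The case where all the e_i and f_i are regular *)

Section RegularCase.
Variables (k : closedFieldType) (L : lieAlgebra k) (n : nat) (e f : 'I_n -> L).
Variable S : primitive_quotient e f.
Notation A := (pq_ring S).
Notation sc := (pq_sc S).
Notation E := (pqE S).
Notation F := (pqF S).
Notation H := (pqH S).
Notation W := (pqW S).
Notation hdeg := (@hdeg _ _ _ _ _ S).
Notation regular := (@regular _ _ _ _ _ S).
Let scC : forall c (a : A), sc c * a = a * sc c := @pq_scC _ _ _ _ _ S.

Inductive hpoly : A -> Prop :=
| hpoly_sc c : hpoly (sc c)
| hpoly_W i : hpoly (W i)
| hpolyD a b : hpoly a -> hpoly b -> hpoly (a + b)
| hpolyM a b : hpoly a -> hpoly b -> hpoly (a * b).

Hypothesis comm0 : forall a b, hdeg 0 a -> hdeg 0 b -> a * b = b * a.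
Hypothesis regE : forall i, regular (E i).
Hypothesis regF : forall i, regular (F i).

(** Regular elements in every degree allow cancellation from any degree to any other. *)
Lemma regular_homog d : exists2 u, hdeg d u & regular u.
Proof.
pose Q d := exists2 u, hdeg d u & regular u.
have QD d1 d2 : Q d1 -> Q d2 -> Q (d1 + d2).
  move=> [u hu ru] [v hv rv]; exists (u * v); [exact: hg_M|exact: regularM].
have Q0 : Q 0 by exists 1; [rewrite -(rmorph1 sc); exact: hg_sc|exact: regular1].
have Qz z i : Q (z *: delta_mx 0 i).
  have Qn m d' : Q d' -> Q (m%:Z *: d').
    move=> Qd; elim: m => [|m IH]; first by rewrite scale0r.
    by rewrite intS scalerDl scale1r; apply: QD.
  case: z => m; first by apply: Qn; exists (E i); [exact: hg_E|exact: regE].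
  rewrite NegzE scaleNr -scalerN; apply: Qn; exists (F i); [exact: hg_F|exact: regF].
rewrite [d]row_sum_delta; elim/big_rec: _ => // i x _; exact: QD.
Qed.

Section Interpolation.
Variables (a b : A).
Hypotheses (a0 : hdeg 0 a) (b0 : hdeg 0 b).

(** [P d] is what [a] becomes, up to the denominator [b], when it moves from the right to the left
    of elements of degree [d]. *)
Definition good (P : 'rV[int]_n -> A) d := forall x, hdeg d x -> b * x * a = P d * x.

(** One regular [x] of degree [d] decides. With [y] regular of degree [-d], the elements [x y] and
    [y x'] have degree zero and commute with [P d], [a] and [b], and the regular [x y] is
    cancelled. *)
Lemma good_one (P : 'rV[int]_n -> A) d x : hdeg 0 (P d) -> hdeg d x -> regular x ->
  b * x * a = P d * x -> good P d.
Proof.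
move=> hP hx rx ex x' hx'; have [y hy ry] := regular_homog (- d).
have hxy : hdeg 0 (x * y) by apply: hdeg_MV hx hy.
have hyx : hdeg 0 (y * x') by apply: (hdeg_MV hy); rewrite opprK.
apply/subr0_eq; apply: (regularM rx ry _).1; rewrite mulrBr.
have -> : x * y * (P d * x') = b * x * a * (y * x').
  by rewrite ex !mulrA -[P d * x * y]mulrA (comm0 hP hxy).
have -> : x * y * (b * x' * a) = b * x * (y * x' * a).
  by rewrite !mulrA (comm0 hxy b0) !mulrA.
by rewrite -(comm0 a0 hyx) !mulrA subrr.
Qed.

(** [r] is the order of a difference twisted by [z]. Once order [r.+1] vanishes,
    [D r j.+1 = D r j * z], so the zero at [M] spreads forward, and backward because [z] is regular.
    The order descends from [N] to 0. *)
Lemma window_vanish (D : nat -> nat -> A) (z : A) N M : regular z ->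
  (forall r j, D r.+1 j = D r j.+1 - D r j * z) -> (forall j, D N j = 0) ->
  (forall j, (M <= j < M + N)%N -> D 0%N j = 0) -> forall j, D 0%N j = 0.
Proof.
move=> rz step DN win.
have win' r j : (M <= j)%N -> (j + r < M + N)%N -> D r j = 0.
  elim: r j => [|r IH] j Mj jr; first by apply: win; rewrite Mj -(addn0 j).
  rewrite step IH ?IH ?mul0r ?subrr //; lia.
suff H s : (s <= N)%N -> forall j, D (N - s)%N j = 0 by have := H N (leqnn N); rewrite subnn.
elim: s => [|s IH] lt j; first by rewrite subn0.
have {}IH j' : D (N - s.+1).+1 j' = 0 by rewrite subnSK //; apply: IH; apply: ltnW.
set r := (N - s.+1)%N in IH *; have rN : (r < N)%N by rewrite /r; lia.
have st j' : D r j'.+1 = D r j' * z by apply/subr0_eq; rewrite -step IH.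
have DM : D r M = 0 by apply: win'; rewrite ?ltn_add2l.
have [le|le] := leqP M j.
  by rewrite -(subnK le); elim: (j - M)%N => [|m IHm]; rewrite ?add0n // addSn st IHm mul0r.
move: DM; rewrite -(subnK (ltnW le)); elim: (M - j)%N => [|m IHm]; rewrite ?add0n // addSn st.
by move=> /(rz _).2 /IHm.
Qed.

(** Multiplying by [E i] turns [ad (E i)] on [a] into a difference in the direction [i]. Both sides
    then have vanishing differences of order [N], so agreement at [N] consecutive degrees spreads
    along the line. [DP r] is the [r]-th difference of [P]. *)
Lemma line_good (P : 'rV[int]_n -> A) i N (DP : nat -> 'rV[int]_n -> A) d :
  (forall d, hdeg 0 (P d)) -> iter N (adj (E i)) a = 0 ->
  (forall d, DP 0%N d = P d) -> (forall r d, DP r.+1 d = DP r (d + delta_mx 0 i) - DP r d) ->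
  (forall d, DP N d = 0) ->
  (forall j : nat, (j < N)%N -> good P (d + j%:Z *: delta_mx 0 i)) ->
  forall z : int, good P (d + z *: delta_mx 0 i).
Proof.
move=> hP aN DP0 DPs DPN gd.
have hwE d' w (j : nat) : hdeg d' w -> hdeg (d' + j%:Z *: delta_mx 0 i) (w * E i ^+ j).
  move=> hw; apply: hg_M => //; elim: j => [|j IH].
    by rewrite expr0 scale0r -(rmorph1 sc); apply: hg_sc.
  by rewrite exprS intS scalerDl scale1r; apply: hg_M => //; apply: hg_E.
have rwE w (j : nat) : regular w -> regular (w * E i ^+ j).
  move=> rw; apply: regularM => //; elim: j => [|j IH]; first by rewrite expr0; apply: regular1.
  by rewrite exprS; apply: regularM.
have key d' w M : hdeg d' w ->
    (forall j : nat, (M <= j < M + N)%N -> good P (d' + j%:Z *: delta_mx 0 i)) ->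
    forall j : nat, b * (w * E i ^+ j) * a = P (d' + j%:Z *: delta_mx 0 i) * (w * E i ^+ j).
  move=> hw win.
  pose D r j := b * (w * E i ^+ j) * iter r (adj (E i)) a -
    DP r (d' + j%:Z *: delta_mx 0 i) * (w * E i ^+ (j + r)).
  suff D0 : forall j, D 0%N j = 0.
    by move=> j; apply/subr0_eq; rewrite -(D0 j) /D /= DP0 addn0.
  apply: (@window_vanish D (E i) N M) => //.
  - move=> r j; rewrite /D /= DPs -addrA -{2}[delta_mx 0 i]scale1r -scalerDl [_%:Z + 1]addrC -intS.
    rewrite addSn addnS [adj _ _]/(E i * _ - _) !mulrBr !mulrBl !opprB !exprSr !mulrA.
    rewrite [LHS]addrACA [RHS]addrACA; congr (_ + _). by rewrite addrC.
  - by move=> j; rewrite /D aN DPN mulr0 mul0r subrr.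
  by move=> j /win gj; rewrite /D /= DP0 addn0 gj ?subrr //; apply: hwE.
case=> m.
  have [w hw rw] := regular_homog d.
  apply: (good_one (hP _) (hwE _ _ m hw) (rwE _ m rw)); exact: (key _ _ 0%N).
(* For a negative position the walk starts at the wanted degree [d'], and the known window lies
   [m.+1] steps further on. *)
rewrite NegzE; set d' := d + _; have [w hw rw] := regular_homog d'.
apply: (good_one (hP _) hw rw).
have := key d' w m.+1 hw _ 0%N; rewrite expr0 mulr1 scale0r addr0; apply => j /andP [mj jN].
have -> : d' + j%:Z *: delta_mx 0 i = d + (j - m.+1)%N%:Z *: delta_mx 0 i.
  by rewrite /d' -addrA -scalerDl -subzn // [- _ + _%:Z]addrC.
by apply: gd; lia.
Qed.
End Interpolation.

(** For one degree take [u], [v] regular of degrees [d], [-d]: then [u v x a = u a v x], as [v x]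
    and [a] commute. Several denominators are multiplied. *)
Lemma denominators (a : A) (s : seq 'rV[int]_n) : hdeg 0 a -> exists b, [/\ hdeg 0 b, regular b &
  exists2 c : 'rV[int]_n -> A, (forall d, hdeg 0 (c d)) & forall d, d \in s -> good a b c d].
Proof.
move=> ha; elim: s => [|d s [b [hb rb [c hc gc]]]].
  exists 1; split; [by rewrite -(rmorph1 sc); apply: hg_sc|exact: regular1|].
  by exists (fun=> 0) => // d; apply: hg_0.
have [u hu ru] := regular_homog d; have [v hv rv] := regular_homog (- d).
have huv : hdeg 0 (u * v) := hdeg_MV hu hv.
have huav : hdeg 0 (u * a * v) by apply: (hdeg_MV _ hv); rewrite -[d]addr0; apply: hg_M.
exists (u * v * b); split; [exact: hdeg_M0|by apply: regularM => //; apply: regularM|].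
exists (fun d' => if d' == d then b * (u * a * v) else u * v * c d').
  by move=> d'; case: ifP => _; apply: hdeg_M0 => //; apply: hc.
move=> d' + x hx /=; rewrite inE; case: eqP => [d'd _|_ /= d's]; [subst d'|]; last first.
  by rewrite -!mulrA [b * (x * a)]mulrA (gc _ d's _ hx) !mulrA.
have hvx : hdeg 0 (v * x) by apply: (hdeg_MV hv); rewrite opprK.
by rewrite (comm0 huv hb) -!mulrA [v * (x * a)]mulrA -(comm0 ha hvx) !mulrA.
Qed.

(** Left multiplication by [phi] of the degree, written as a generalized polynomial in [x] whose
    right factors lie in [k[W]]. This is the shape Martindale's lemma consumes. *)
Definition realized (phi : 'rV[int]_n -> A) := exists s : seq (A * A),
  (forall p, p \in s -> hpoly p.2) /\
  forall d x, hdeg d x -> \sum_(p <- s) p.1 * x * p.2 = phi d * x.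

Lemma realizedD phi psi : realized phi -> realized psi -> realized (fun d => phi d + psi d).
Proof.
move=> [s [sh sP]] [t [th tP]]; exists (s ++ t); split.
  by move=> p; rewrite mem_cat => /orP []; [exact: sh|exact: th].
by move=> d x hx; rewrite big_cat (sP d) // (tP d) // mulrDl.
Qed.

Lemma realizedMl c phi : realized phi -> realized (fun d => c * phi d).
Proof.
move=> [s [sh sP]]; exists [seq (c * p.1, p.2) | p <- s]; split.
  by move=> _ /mapP [p /sh ? ->].
move=> d x hx; rewrite big_map -mulrA -(sP d) // mulr_sumr; apply: eq_bigr => p _ /=.
by rewrite !mulrA.
Qed.

(** The coordinate [d_i] arises from [W i x - x W i = d_i x]. *)
Lemma realized_coord i phi : realized phi -> realized (fun d => sc (d 0 i)%:~R * phi d).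
Proof.
move=> [s [sh sP]].
exists ([seq (p.1 * W i, p.2) | p <- s] ++ [seq (- p.1, W i * p.2) | p <- s]); split.
  by move=> q; rewrite mem_cat => /orP [] /mapP [p /sh ? ->] //=; apply: hpolyM => //; apply: hpoly_W.
move=> d x hx; rewrite big_cat !big_map /= -big_split /= -mulrA -(sP d) // mulr_sumr.
apply: eq_bigr => p _; rewrite mulNr mulNr !mulrA -mulrBl -!mulrA -mulrBr mulrA.
have -> : W i * x - x * W i = sc (d 0 i)%:~R * x := hdeg_adW i hx.
by rewrite !mulrA scC.
Qed.

Lemma realized_poly i (q : {poly k}) phi : realized phi -> realized (fun d => sc (q.[(d 0 i)%:~R]) * phi d).
Proof.
move=> hphi; elim/poly_ind: q => [|q c IH].
  by exists [::]; split=> // d x _; rewrite big_nil horner0 rmorph0 !mul0r.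
have := realizedD (realized_coord i IH) (realizedMl (sc c) hphi).
congr realized; apply/funext => d; rewrite hornerMXaddC rmorphD mulrDl rmorphM.
by congr (_ + _); rewrite mulrA scC.
Qed.

Lemma realized_sum (I : Type) (r : seq I) (phi : I -> 'rV[int]_n -> A) :
  (forall i, realized (phi i)) -> realized (fun d => \sum_(i <- r) phi i d).
Proof.
move=> h; elim: r => [|i r IH].
  by exists [::]; split=> // d x _; rewrite !big_nil mul0r.
by have := realizedD (h i) IH; congr realized; apply/funext => d; rewrite big_cons.
Qed.

Lemma hpoly_lspan (B : A -> Prop) a : (forall b, B b -> hpoly b) -> lspan sc B a -> hpoly a.
Proof.
move=> h; elim=> [|c b x Bb _ IH]; first by rewrite -(rmorph0 sc); constructor.
by apply: hpolyD => //; apply: hpolyM; [constructor|apply: h].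
Qed.

Lemma hdeg_hpoly a : hpoly a -> hdeg 0 a.
Proof.
elim=> [c|i|x y _ hx _ hy|x y _ hx _ hy]; [exact: hg_sc|exact: hdeg_W|exact: hg_D|exact: hdeg_M0].
Qed.

(* The shifts of a along the grading are polynomial in the degree, because a is *)
(* ad-nilpotent.  Interpolating them on a box and clearing denominators gives *)
(* an identity b x a = sum c_l x q_l with q_l in k[W]. *)
Lemma hdeg0_hpoly a : hdeg 0 a -> hpoly a.
Proof.
move=> ha.
have [N [N0 aN]] : exists N, (0 < N)%N /\ forall i, iter N (adj (E i)) a = 0.
  have /choice [g gP] := fun i => pq_adnilE i a.
  exists (\sum_i g i).+1; split=> // i; apply: iter_adj_le (gP i).
  by rewrite leqW // (bigD1 i) //= leq_addr.
have [l [lsz ldel]] := lagrange_basis N (pq_pchar0 S).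
pose deg (m : {ffun 'I_n -> 'I_N}) : 'rV[int]_n := \row_i (m i : nat)%:Z.
have [b [hb rb [c hc gc]]] := denominators (map deg (enum {ffun 'I_n -> 'I_N})) ha.
(* The Lagrange interpolation of [c] from the box of degrees with coordinates below [N], the common
   nilpotency order of the [ad (E i)] on [a]. *)
pose P (d : 'rV[int]_n) := \sum_(m : {ffun 'I_n -> 'I_N}) (\prod_i sc (l (m i)).[(d 0 i)%:~R]) * c (deg m).
have prodsc (m : {ffun 'I_n -> 'I_N}) (d : 'rV[int]_n) (Q : pred 'I_n) :
    \prod_(i | Q i) sc (l (m i)).[(d 0 i)%:~R] = sc (\prod_(i | Q i) (l (m i)).[(d 0 i)%:~R]).
  by rewrite rmorph_prod.
have hP d : hdeg 0 (P d).
  by apply: hdeg_sum => m _; rewrite prodsc; apply: hdeg_Z.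
have Pbox m : P (deg m) = c (deg m).
  rewrite /P (bigD1 m) //= [X in _ + X]big1 => [|m' mm']; last first.
    have [i mi] : exists i, m' i != m i.
      apply: contrapT => /forallNP h; case/eqP: mm'; apply/ffunP => i.
      by apply/eqP; rewrite -[_ == _]negbK; apply/negP/h.
    rewrite prodsc (bigD1 i) //= mxE -pmulrn ldel (negbTE mi) mul0r.
    by rewrite rmorph0 mul0r.
  rewrite prodsc big1 => [|i _]; first by rewrite rmorph1 mul1r addr0.
  by rewrite mxE -pmulrn ldel eqxx.
(* The box constraint is dropped one coordinate at a time: only the coordinates from [r] on are
   still confined. *)
have all r : forall d : 'rV[int]_n, (forall i : 'I_n, (r <= i)%N -> 0 <= d 0 i < N%:Z) -> good a b P d.
  elim: r => [|r IH] d dbox.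
    have /choice [m mP] i : exists j : 'I_N, d 0 i = j%:Z.
      have := dbox i (leq0n _); case: (d 0 i) => // j jN.
      by exists (Ordinal (jN : (j < N)%N)).
    have -> : d = deg (finfun m) by apply/rowP => i; rewrite mxE ffunE.
    move=> x hx; rewrite Pbox; apply: gc => //; apply: map_f; exact: mem_enum.
  have [nr|rn] := leqP n r.
    by apply: IH => i ri; have := ltn_ord i; rewrite ltnNge (leq_trans nr).
  pose i := Ordinal rn; pose d0 := d - d 0 i *: delta_mx 0 i.
  have -> : d = d0 + d 0 i *: delta_mx 0 i by rewrite subrK.
  pose DP t (d : 'rV[int]_n) := \sum_(m : {ffun 'I_n -> 'I_N}) ((\prod_(j | j != i) sc (l (m j)).[(d 0 j)%:~R]) *
    sc (iter t (@pdiff k) (l (m i))).[(d 0 i)%:~R]) * c (deg m).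
  apply: (@line_good a b ha hb P i N DP) => //.
  - move=> d'; apply: eq_bigr => m _; rewrite [in RHS]prodsc (bigD1 i) //= prodsc mulrC.
    by rewrite rmorphM.
  - move=> t d'; rewrite /DP -sumrB; apply: eq_bigr => m _; rewrite -mulrBl; congr (_ * _).
    rewrite iterS pdiff_horner rmorphB mulrBr; congr (_ * _ - _).
      apply: eq_bigr => j ji; rewrite !mxE eqxx (negbTE ji) addr0 //.
    by rewrite !mxE !eqxx rmorphD.
  - move=> d'; apply: big1 => m _; rewrite iter_pdiff0 ?lsz // horner0 rmorph0 mulr0 mul0r //.
  move=> j jN; apply: IH => i' ri'; rewrite !mxE eqxx /=.
  case: (eqVneq i' i) => [->|ii'].
    by rewrite mulr1 subrr add0r; lia.
  rewrite !mulr0 subr0 addr0; apply: dbox; rewrite ltn_neqAle ri' andbT.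
  by apply: contra ii' => /eqP h; apply/eqP/val_inj.
have [s [sh sP]] : realized P.
  apply: realized_sum => m.
  have : realized (fun d => c (deg m) * \prod_(i <- index_enum 'I_n) sc (l (m i)).[(d 0 i)%:~R]).
    apply: realizedMl; elim: (index_enum 'I_n) => [|i t IH].
      exists [:: (1, 1)]; split=> [p|d x _]; last by rewrite big_seq1 big_nil mulr1.
      by rewrite inE => /eqP -> /=; rewrite -(rmorph1 sc); constructor.
    by have := realized_poly i (l (m i)) IH; congr realized; apply/funext => d; rewrite big_cons.
  by congr realized; apply/funext => d; rewrite prodsc scC.
have rel x : b * x * a = \sum_(p <- s) p.1 * x * p.2.
  have [t [th ->]] := hdeg_dec x.
  rewrite mulr_sumr mulr_suml; under [RHS]eq_bigr do rewrite mulr_sumr mulr_suml.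
  rewrite exchange_big /= big_seq [RHS]big_seq; apply: eq_bigr => p pt.
  have gp : good a b P p.1 by apply: (all n) => i; rewrite leqNgt ltn_ord.
  by rewrite (gp _ (th p pt)) (sP _ _ (th p pt)).
have bN : b <> 0.
  by move=> b0; have /eqP := (rb 1).1 (etrans (congr1 (fun t => t * 1) b0) (mul0r 1)); rewrite oner_eq0.
(* As [b] is nonzero, the identity puts [a] in the span of the right factors of [s], which lie in
   [k[W]]. *)
apply: (hpoly_lspan _ (gpi_span scC (@pq_prime _ _ _ _ _ S) (@pq_centroid _ _ _ _ _ S)
   (s := [seq (- p.1, p.2) | p <- s]) bN _)).
  by move=> q /mapP [_ /mapP [p /sh ? ->] ->].
move=> x; rewrite rel big_map -big_split big1 //= => p _.
by rewrite !mulNr subrr.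
Qed.
End RegularCase.

(** * Multivariate polynomials *)

Lemma mpoly_gen_ind (k : fieldType) n (P : {mpoly k[n]} -> Prop) :
  (forall c, P c%:MP) -> (forall i, P 'X_i) -> (forall p q, P p -> P q -> P (p + q)) ->
  (forall p q, P p -> P q -> P (p * q)) -> forall p, P p.
Proof.
move=> PC PX PD PM p; rewrite [p]mpolyE; elim/big_rec: _ => [|m q _ Pq]; first by rewrite -mpolyC0.
apply: (PD) => //; rewrite -mul_mpolyC; apply: (PM) => //.
rewrite mpolyXE_id; elim/big_rec: _ => [|i x _ Px]; first by rewrite -mpolyC1.
apply: (PM) => //; elim: (m i) => [|l IH]; first by rewrite expr0 -mpolyC1.
by rewrite exprS; apply: PM.
Qed.

Section MPoly.
Variables (k : fieldType) (n : nat).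
Implicit Types (p : {mpoly k[n]}).

Definition msubst (h : 'I_n -> {mpoly k[n]}) p := comp_mpoly [tuple h i | i < n] p.

Lemma msubstX h i : msubst h 'X_i = h i.
Proof. by rewrite /msubst comp_mpolyXU -tnth_nth tnth_mktuple. Qed.

Lemma msubstC h c : msubst h c%:MP = c%:MP.
Proof. exact: comp_mpolyC. Qed.

Lemma msubstD h p q : msubst h (p + q) = msubst h p + msubst h q.
Proof. exact: comp_mpolyD. Qed.

Lemma msubstM h p q : msubst h (p * q) = msubst h p * msubst h q.
Proof. exact: (rmorphM (comp_mpoly [tuple h i | i < n])). Qed.

Lemma msubst_comp h g p : msubst g (msubst h p) = msubst (fun i => msubst g (h i)) p.
Proof.
elim/mpoly_gen_ind: p => [c|i|p q hp hq|p q hp hq]; first by rewrite !msubstC.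
- by rewrite !msubstX.
- by rewrite !msubstD hp hq.
by rewrite !msubstM hp hq.
Qed.

Lemma meval_msubst h (v : 'I_n -> k) p : (msubst h p).@[v] = p.@[fun i => (h i).@[v]].
Proof.
elim/mpoly_gen_ind: p => [c|i|p q hp hq|p q hp hq]; first by rewrite msubstC !mevalC.
- by rewrite msubstX mevalXU.
- by rewrite msubstD !mevalD hp hq.
by rewrite msubstM !mevalM hp hq.
Qed.

Lemma msubst_const (v : 'I_n -> k) p : msubst (fun i => (v i)%:MP) p = (p.@[v])%:MP.
Proof.
elim/mpoly_gen_ind: p => [c|i|p q hp hq|p q hp hq]; first by rewrite msubstC mevalC.
- by rewrite msubstX mevalXU.
- by rewrite msubstD mevalD mpolyCD hp hq.
by rewrite msubstM mevalM mpolyCM hp hq.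
Qed.

Lemma msubst_id p : msubst (fun i => 'X_i) p = p.
Proof.
elim/mpoly_gen_ind: p => [c|i|p q hp hq|p q hp hq]; first by rewrite msubstC.
- by rewrite msubstX.
- by rewrite msubstD hp hq.
by rewrite msubstM hp hq.
Qed.

(** [p] as a polynomial in its [i]-th variable. The coefficients stay in the same ring, so that
    evaluation is a substitution. *)
Definition uniq_var (i : 'I_n) : {mpoly k[n]} -> {poly {mpoly k[n]}} :=
  mmap (polyC \o (@mpolyC n k)) (fun j => if j == i then 'X else ('X_j)%:P).

Lemma uniq_var_horner i p (t : {mpoly k[n]}) :
  (uniq_var i p).[t] = msubst (fun j => if j == i then t else 'X_j) p.
Proof.
elim/mpoly_gen_ind: p => [c|j|p q hp hq|p q hp hq].
- by rewrite /uniq_var mmapC msubstC /= hornerC.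
- by rewrite /uniq_var mmapX mmap1U msubstX; case: ifP; rewrite ?hornerX ?hornerC.
- by rewrite /uniq_var rmorphD hornerD msubstD -hp -hq.
by rewrite /uniq_var rmorphM hornerM msubstM -hp -hq.
Qed.

Lemma uniq_var_eq0 i p : uniq_var i p = 0 -> p = 0.
Proof.
have e : msubst (fun j => if j == i then 'X_i else 'X_j) p = p.
  rewrite -[RHS]msubst_id; congr (msubst _ p); apply/funext => j.
  by case: eqP => // ->.
by move=> h; rewrite -e -uniq_var_horner h horner0.
Qed.

Lemma mpolyC_injective : injective (@mpolyC n k).
Proof. by move=> a b /(congr1 (meval (fun=> 0))); rewrite !mevalC. Qed.

Definition upd (v : 'I_n -> k) i c j := if j == i then c else v j.

Lemma infinite_nonroot (q : {poly {mpoly k[n]}}) (Q : k -> Prop) :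
  q != 0 -> (forall s : seq k, exists c, c \notin s /\ Q c) ->
  exists c, Q c /\ q.[c%:MP] != 0.
Proof.
move=> q0 inf; apply: contrapT => /forallNP no.
have [s [su sQ ss]] : exists s : seq k, [/\ uniq s, forall c, c \in s -> Q c & size s = size q].
  elim: (size q) => [|m [s [su sQ ss]]]; first by exists [::].
  have [c [cs Qc]] := inf s; exists (c :: s); rewrite /= cs su ss; split=> // x.
  by rewrite inE => /orP [/eqP->|/sQ].
have : (size [seq c%:MP : {mpoly k[n]} | c <- s] < size q)%N.
  apply: max_poly_roots => //; last by rewrite map_inj_uniq //; apply: mpolyC_injective.
  apply/allP => _ /mapP [c /sQ Qc ->]; apply/rootP/eqP.
  by rewrite -[_ == _]negbK; apply/negP => h; apply: (no c).
by rewrite size_map ss ltnn.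
Qed.

(** A Zariski density criterion: from each point of [D], each coordinate can be changed to
    infinitely many values inside [D]. Coordinates are fixed successively, each time avoiding the
    finitely many roots; later choices may depend on earlier ones. *)
Lemma tree_nonvanish (D : ('I_n -> k) -> Prop) (v0 : 'I_n -> k) p : p != 0 -> D v0 ->
  (forall v i, D v -> forall s : seq k, exists c, c \notin s /\ D (upd v i c)) ->
  exists2 v, D v & p.@[v] != 0.
Proof.
move=> p0 Dv0 step.
have H r : exists2 v, D v & msubst (fun j : 'I_n => if (j < r)%N then (v j)%:MP else 'X_j) p != 0.
  elim: r => [|r [v Dv nz]].
    exists v0 => //; rewrite (_ : (fun j => _) = fun j => 'X_j) ?msubst_id //.
  have [nr|rn] := leqP n r.
    exists v => //; rewrite (_ : (fun j => _) = fun j : 'I_n => if (j < r)%N then (v j)%:MP else 'X_j) //.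
    by apply/funext => j; rewrite ltnS leq_eqVlt orbC (leq_trans (ltn_ord j) nr).
  pose i := Ordinal rn; set q := msubst _ p in nz.
  have q0 : uniq_var i q != 0 by apply: contra nz => /eqP /uniq_var_eq0 ->.
  have [c [Dc]] := infinite_nonroot q0 (step v i Dv).
  rewrite uniq_var_horner msubst_comp => nzc; exists (upd v i c) => //.
  congr (_ != 0) : nzc; congr (msubst _ p); apply/funext => j; rewrite /upd.
  have -> : (j < r.+1)%N = (j == i) || (j < r)%N by rewrite ltnS leq_eqVlt.
  case: (ltnP j r) => jr.
    by rewrite msubstC orbT; case: eqP => // jei; rewrite jei ltnn in jr.
  by rewrite msubstX orbF; case: eqP.
have [v Dv nz] := H n; exists v => //; apply: contra nz => /eqP pv.
rewrite (_ : (fun j => _) = fun j : 'I_n => (v j)%:MP) ?msubst_const ?pv ?mpolyC0 //.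
by apply/funext => j; rewrite ltn_ord.
Qed.

Lemma all_eval_eq0 p : [pchar k] =i pred0 -> (forall v, p.@[v] = 0) -> p = 0.
Proof.
move=> ch h; apply/eqP/negP => /negP p0.
have [v i _ s|v _] := @tree_nonvanish (fun=> True) (fun=> 0) p p0 I.
  by have [m ms] := natr_notin_pchar0 s ch; exists m%:R.
by rewrite h eqxx.
Qed.

Definition mshift (d : 'rV[k]_n) := msubst (fun i => 'X_i + (d 0 i)%:MP).

Lemma meval_mshift d (v : 'I_n -> k) p : (mshift d p).@[v] = p.@[fun i => v i + d 0 i].
Proof. by rewrite meval_msubst; apply: meval_eq => i; rewrite mevalD mevalXU mevalC. Qed.

Lemma mshift0 p : mshift 0 p = p.
Proof.
rewrite -[RHS]msubst_id; congr (msubst _ p); apply/funext => i.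
by rewrite mxE mpolyC0 addr0.
Qed.

Lemma mshiftD d d' p : mshift d (mshift d' p) = mshift (d + d') p.
Proof.
rewrite /mshift msubst_comp; congr (msubst _ p); apply/funext => i.
by rewrite msubstD msubstX msubstC mxE mpolyCD addrA.
Qed.

(* By interpolation in one variable at a time. *)
Lemma shift_stable_ideal (I : {mpoly k[n]} -> Prop) : [pchar k] =i pred0 ->
  I 0 -> (forall p q, I p -> I q -> I (p + q)) -> (forall p q, I p -> I (p * q)) ->
  (forall i p, I p -> I (mshift (delta_mx 0 i) p)) ->
  forall p, I p -> forall v, I (p.@[v])%:MP.
Proof.
move=> ch I0 ID IM Ish p Ip v.
have one i q c : I q -> I (msubst (fun j => if j == i then c%:MP else 'X_j) q).
  move=> Iq; rewrite -uniq_var_horner.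
  (* Recentred at ['X_i], the value of [Q] at [m] is the [m]-fold shift of [q], hence in [I]. By
     interpolation all values of [Q] lie in [I], and the value at [c - 'X_i] substitutes [c] for the
     variable. *)
  pose Q : {poly {mpoly k[n]}} := uniq_var i q \Po ('X + ('X_i)%:P); pose N := size Q.
  have Qm (m : nat) : I Q.[m%:R].
    rewrite horner_comp hornerD hornerX hornerC uniq_var_horner.
    suff -> : msubst (fun j => if j == i then m%:R + 'X_i else 'X_j) q = mshift (m%:R *: delta_mx 0 i) q.
      elim: m => [|m IH]; first by rewrite scale0r mshift0.
      by rewrite mulrS scalerDl scale1r -mshiftD; apply: Ish.
    congr (msubst _ q); apply/funext => j; rewrite !mxE eqxx /=.
    case: eqP => [->|_]; last by rewrite mulr0 mpolyC0 addr0.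
    by rewrite mulr1 addrC mpolyC_nat.
  have [l [lsz ldel]] := lagrange_basis N ch.
  pose lm (m : 'I_N) : {poly {mpoly k[n]}} := map_poly (@mpolyC n k) (l m).
  have QE : Q = \sum_(m < N) Q.[m%:R] *: lm m.
    apply/subr0_eq/eqP/negP => /negP nz.
    have sz : (size (Q - \sum_(m < N) Q.[m%:R] *: lm m)%R <= N)%N.
      apply: leq_trans (size_polyD _ _) _; rewrite size_polyN geq_max leqnn /=.
      apply: leq_trans (size_sum _ _ _) _; apply/bigmax_leqP => m _.
      by apply: leq_trans (size_scale_leq _ _) _; apply: leq_trans (size_poly _ _) (lsz m).
    have : (size [seq ((nat_of_ord m)%:R)%R : {mpoly k[n]} | m <- enum 'I_N] <
        size (Q - \sum_(m < N) Q.[m%:R] *: lm m)%R)%N.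
      apply: max_poly_roots => //.
        apply/allP => _ /mapP [m _ ->]; apply/rootP.
        rewrite hornerD hornerN horner_sum (bigD1 m) //= big1 => [|m' mm'].
          by rewrite addr0 hornerZ -mpolyC_nat horner_map ldel eqxx rmorph1 mulr1 subrr.
        by rewrite hornerZ -mpolyC_nat horner_map ldel (negbTE mm') rmorph0 mulr0.
      rewrite map_inj_uniq ?enum_uniq // => m m'; rewrite -!mpolyC_nat => /mpolyC_injective.
      by move=> /(natr_inj_pchar0 ch) /val_inj.
    by rewrite size_map size_enum_ord ltnNge sz.
  have -> : (uniq_var i q).[c%:MP] = Q.[c%:MP - 'X_i].
    by rewrite horner_comp hornerD hornerX hornerC subrK.
  rewrite QE horner_sum; elim/big_rec: _ => // m x _ Ix; apply: ID => //.
  by rewrite hornerZ; apply: IM.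
have H r : I (msubst (fun j : 'I_n => if (j < r)%N then (v j)%:MP else 'X_j) p).
  elim: r => [|r IH].
    by rewrite (_ : (fun j => _) = fun j => 'X_j) ?msubst_id.
  have [nr|rn] := leqP n r.
    rewrite (_ : (fun j => _) = fun j : 'I_n => if (j < r)%N then (v j)%:MP else 'X_j) //.
    by apply/funext => j; rewrite ltnS leq_eqVlt orbC (leq_trans (ltn_ord j) nr).
  pose i := Ordinal rn; have := one i _ (v i) IH; rewrite msubst_comp.
  congr (I _); congr (msubst _ p); apply/funext => j.
  have -> : (j < r.+1)%N = (j == i) || (j < r)%N by rewrite ltnS leq_eqVlt.
  case: (ltnP j r) => jr; first by rewrite msubstC orbT.
  by rewrite msubstX orbF; case: eqP => // ->.
have := H n; rewrite (_ : (fun j => _) = fun j : 'I_n => (v j)%:MP) ?msubst_const //.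
by apply/funext => j; rewrite ltn_ord.
Qed.
End MPoly.

(** * Weight modules *)

Section WeightModules.
Variables (k : closedFieldType) (L : lieAlgebra k) (n : nat) (e f : 'I_n -> L).
Variable S : primitive_quotient e f.
Notation A := (pq_ring S).
Notation sc := (pq_sc S).
Notation E := (pqE S).
Notation F := (pqF S).
Notation H := (pqH S).
Notation W := (pqW S).
Notation hdeg := (@hdeg _ _ _ _ _ S).
Let scC : forall c (a : A), sc c * a = a * sc c := @pq_scC _ _ _ _ _ S.

Definition wt (d : 'rV[int]_n) : 'rV[k]_n := map_mx intr d.

Lemma wt_inj : injective wt.
Proof.
move=> d1 d2 /rowP h; apply/rowP => i; apply: (intr_inj_pchar0 (pq_pchar0 S)).
by have := h i; rewrite !mxE.
Qed.

Lemma wt0 : wt 0 = 0.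
Proof. by apply/rowP => i; rewrite !mxE. Qed.

Lemma wtN d : wt (- d) = - wt d.
Proof. by apply/rowP => i; rewrite !mxE rmorphN. Qed.

Lemma wt_delta i : wt (delta_mx 0 i) = delta_mx 0 i.
Proof. by apply/rowP => j; rewrite !mxE; case: (_ && _). Qed.

Variable M : lmodType A.

Definition wvec (w : 'rV[k]_n) (m : M) := forall i, W i *: m = sc (w 0 i) *: m.

Lemma wvecD w m m' : wvec w m -> wvec w m' -> wvec w (m + m').
Proof. by move=> h h' i; rewrite !scalerDr h h'. Qed.

Lemma wvecZ w c m : wvec w m -> wvec w (sc c *: m).
Proof. by move=> h i; rewrite !scalerA -scC -!scalerA h !scalerA scC. Qed.

Lemma wvecB w m m' : wvec w m -> wvec w m' -> wvec w (m - m').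
Proof.
move=> h h'; apply: wvecD => //; rewrite -scaleN1r -(rmorphN1 sc).
exact: wvecZ.
Qed.

Lemma hdeg_wvec d y w m : hdeg d y -> wvec w m -> wvec (w + wt d) (y *: m).
Proof.
move=> hy hm i; have := hdeg_adW i hy; rewrite /adj => /eqP; rewrite subr_eq => /eqP h.
by rewrite scalerA h scalerDl -!scalerA hm !scalerA -scC -!scalerA -scalerDl -rmorphD !mxE addrC.
Qed.

Lemma wvec_projector (w : 'rV[k]_n) (s : seq 'rV[k]_n) : w \notin s ->
  exists a, [/\ hdeg 0 a, forall m, wvec w m -> a *: m = m &
    forall w' m, w' \in s -> wvec w' m -> a *: m = 0].
Proof.
move=> ws.
have [||||||||||g [[a [ha ga]] gw gs]] := @weight_projector k n M (fun c m => sc c *: m)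
  (fun i m => W i *: m) (fun g => exists a, hdeg 0 a /\ forall m, g m = a *: m)
  _ _ _ _ _ _ _ _ _ w s.
- by move=> a b m; rewrite -scalerBl -rmorphB.
- by move=> a b m; rewrite scalerA -rmorphM.
- by move=> m; rewrite rmorph1 scale1r.
- by move=> m; rewrite rmorph0 scale0r.
- by move=> a; rewrite scaler0.
- by move=> i a m; rewrite !scalerA scC.
- by exists 1; split=> [|m]; rewrite ?scale1r // -(rmorph1 sc); apply: hg_sc.
- move=> g i c c' [a [ha ga]]; exists (a * (sc c * (W i - sc c'))); split.
    apply: hdeg_M0 => //; apply: hdeg_Z; apply: hg_D; first exact: hdeg_W.
    by apply: hdeg_N; apply: hg_sc.
  by move=> m; rewrite ga -!scalerA scalerBl.
- by move=> g [a [_ ->]]; rewrite scaler0.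
- exact: ws.
by exists a; split=> // [m /gw|w' m w's hm]; rewrite -ga //; apply: gs hm.
Qed.

Definition weightM := forall m : M, exists s : seq M, m = \sum_(v <- s) v /\
  forall v, v \in s -> exists w, wvec w v.

Definition cpointed := weightM /\
  forall w, exists v : M, forall m, wvec w m -> exists a, m = sc a *: v.

Hypothesis simpleM : simple_mod M.

Lemma weight_of_wvec w0 v0 : v0 <> 0 -> wvec w0 v0 -> weightM.
Proof.
move=> v0N hv m; have [a ->] := cyclic_sub simpleM v0N m.
have [s [sh ->]] := hdeg_dec a; exists [seq p.2 *: v0 | p <- s]; split.
  by rewrite big_map scaler_suml.
by move=> _ /mapP [p /sh ps ->]; exists (w0 + wt p.1); apply: hdeg_wvec.
Qed.

(** Project [a m = v] onto the weight [w0]: only one homogeneous component of [a] survives. *)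
Lemma wvec_hit w w0 (m v : M) : m <> 0 -> v <> 0 -> wvec w m -> wvec w0 v ->
  exists d y, [/\ hdeg d y, y *: m = v & w0 = w + wt d].
Proof.
move=> mN vN hm hv; have [a av] := cyclic_sub simpleM mN v.
have [s [sh as_]] := hdeg_dec a.
have [|c [_ cw cs]] := @wvec_projector w0 [seq w + wt p.1 | p <- s & w + wt p.1 != w0].
  by apply/negP => /mapP [p]; rewrite mem_filter => /andP [/eqP pn _] pe; apply: pn.
have vE : v = \sum_(p <- s | w + wt p.1 == w0) p.2 *: m.
  rewrite -(cw v hv) av as_ scaler_suml scaler_sumr [RHS]big_mkcond big_seq [RHS]big_seq.
  apply: eq_bigr => p ps; have hp := hdeg_wvec (sh p ps) hm.
  case: eqP => [pw|/eqP pw]; first by rewrite cw // -pw.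
  by apply: (cs (w + wt p.1)) => //; apply: map_f; rewrite mem_filter pw.
have [p [ps /eqP pw]] : exists p, p \in s /\ w + wt p.1 == w0.
  apply: contrapT => /forallNP no; apply: vN; rewrite vE big_seq_cond big1 // => p /andP [ps pw].
  by case: (no p).
exists p.1, (\sum_(q <- s | w + wt q.1 == w0) q.2); split=> //.
- rewrite big_seq_cond; apply: hdeg_sum => q /andP [qs /eqP qw].
  have -> : p.1 = q.1 by apply: wt_inj; apply: (addrI w); rewrite pw qw.
  exact: sh.
by rewrite scaler_suml.
Qed.

Hypothesis comm0 : forall a b, hdeg 0 a -> hdeg 0 b -> a * b = b * a.

(** One weight space of dimension one forces all. Otherwise, in the weight space of [m1], some [m2]
    is killed by a [y] with [y m1 = v0], while a [y'] of the same degree has [y' m2 = v0]. With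
    [z v0 = m1], the degree-zero elements [z y] and [z y'] do not commute on [m2]. *)
Lemma cpointed_of_wvec w0 v0 : v0 <> 0 -> wvec w0 v0 ->
  (forall m, wvec w0 m -> exists a, m = sc a *: v0) -> cpointed.
Proof.
move=> v0N hv0 top; split; first exact: weight_of_wvec hv0.
move=> w; case: (pselect (exists m, m <> 0 /\ wvec w m)) => [[m1 [m1N hm1]]|no]; last first.
  exists 0 => m hm; exists 0; rewrite scaler0; apply: contrapT => mN; apply: no; by exists m.
exists m1 => m' hm'.
have [d [y [hy ym1 e1]]] := wvec_hit m1N v0N hm1 hv0.
have [d' [z [hz zv0 e2]]] := wvec_hit v0N m1N hv0 hm1.
have d'd : d' = - d.
  apply: wt_inj; rewrite wtN; apply: (addrI w0); rewrite -e2 e1 -[RHS]addrA subrr addr0 //.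
have [c yc] : exists c, y *: m' = sc c *: v0 by apply: top; rewrite e1; apply: hdeg_wvec.
exists c; apply/subr0_eq; set m2 := m' - _; apply: contrapT => m2N.
have hm2 : wvec w m2 by apply: wvecB => //; apply: wvecZ.
have ym2 : y *: m2 = 0 by rewrite scalerBr yc scalerA -scC -scalerA ym1 subrr.
have [d2 [y' [hy' y'm2 e3]]] := wvec_hit m2N v0N hm2 hv0.
have dd2 : d2 = d by apply: wt_inj; apply: (addrI w); rewrite -e3.
subst d' d2; have hzy : hdeg 0 (z * y) by apply: (hdeg_MV hz); rewrite opprK.
have hzy' : hdeg 0 (z * y') by apply: (hdeg_MV hz); rewrite opprK.
have := congr1 (fun t => t *: m2) (comm0 hzy hzy').
by rewrite -!scalerA ym2 y'm2 !scaler0 zv0 ym1 zv0.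
Qed.

Hypothesis faithM : forall a : A, (forall m : M, a *: m = 0) -> a = 0.

Lemma faithful_wvec a : weightM -> (forall w m, wvec w m -> a *: m = 0) -> a = 0.
Proof.
move=> wM h; apply: faithM => m; have [s [-> sw]] := wM m.
by rewrite scaler_sumr big_seq big1 // => v /sw [w hw]; apply: h hw.
Qed.

(** Some weight vector [m] has [a m] nonzero, and a homogeneous [y] brings [a m] back to [m];
    comparing weights, [y] has degree [-d]. This nondegeneracy characterizes the quotient that
    defines a TGW algebra. *)
Lemma graded_faithful d a : weightM -> hdeg d a -> a <> 0 -> exists2 y, hdeg (- d) y & y * a <> 0.
Proof.
move=> wM ha aN.
have [w [m [hm am]]] : exists w m, wvec w m /\ a *: m <> 0.
  apply: contrapT => no; apply: aN; apply: faithful_wvec => // w m hm.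
  by apply: contrapT => am; apply: no; exists w, m.
have mN : m <> 0 by move=> m0; apply: am; rewrite m0 scaler0.
have [d' [y [hy yam e1]]] := wvec_hit am mN (hdeg_wvec ha hm) hm.
have d'd : d' = - d.
  apply: wt_inj; rewrite wtN; apply: (addrI w); apply: (addIr (wt d)).
  by rewrite addrAC -e1 subrK.
by subst d'; exists y => // ya; apply: mN; rewrite -yam scalerA ya scale0r.
Qed.
End WeightModules.

(** * Quotient of a ring by a left ideal, as a module *)

Inductive lideal_gen (A : pzRingType) (S : A -> Prop) : A -> Prop :=
| lideal_gen_in x : S x -> lideal_gen S x
| lideal_gen0 : lideal_gen S 0
| lideal_genD x y : lideal_gen S x -> lideal_gen S y -> lideal_gen S (x + y)
| lideal_genMl a x : lideal_gen S x -> lideal_gen S (a * x).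

Section LeftQuotient.
Variables (A : pzRingType) (S : A -> Prop).

Definition lideal_eqb (a b : A) : bool := `[< lideal_gen S (a - b) >].

Lemma lideal_genN a : lideal_gen S a -> lideal_gen S (- a).
Proof. by rewrite -mulN1r; exact: lideal_genMl. Qed.

Lemma lideal_eqb_equiv : equiv_class_of lideal_eqb.
Proof.
split.
- by move=> a; apply/asboolP; rewrite subrr; exact: lideal_gen0.
- by move=> a b; apply/asboolP/asboolP => /lideal_genN; rewrite opprB.
- move=> b a c /asboolP ab /asboolP bc; apply/asboolP.
  have -> : a - c = (a - b) + (b - c) by rewrite addrA subrK.
  exact: lideal_genD.
Qed.

Canonical lideal_eqb_rel := EquivRelPack lideal_eqb_equiv.

Definition lquot : Type := {eq_quot lideal_eqb}%qT.

HB.instance Definition _ := Choice.on lquot.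
HB.instance Definition _ := EqQuotient.on lquot.

Definition lquot_pi (a : A) : lquot := (\pi_lquot a)%qT.

Lemma lquot_eqP a b : lideal_gen S (a - b) <-> lquot_pi a = lquot_pi b.
Proof. by split=> [ab|/eqmodP/asboolP //]; apply/eqmodP/asboolP. Qed.

Lemma lquot_repr a : lideal_gen S (repr (lquot_pi a) - a).
Proof. by apply/lquot_eqP; rewrite /lquot_pi reprK. Qed.

Definition lquot_add (p q : lquot) : lquot := lquot_pi (repr p + repr q).
Definition lquot_opp (p : lquot) : lquot := lquot_pi (- repr p).
Definition lquot_scale (a : A) (p : lquot) : lquot := lquot_pi (a * repr p).

Lemma lquot_addE a b : lquot_add (lquot_pi a) (lquot_pi b) = lquot_pi (a + b).
Proof. by apply/lquot_eqP; rewrite opprD addrACA; apply: lideal_genD; exact: lquot_repr. Qed.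

Lemma lquot_oppE a : lquot_opp (lquot_pi a) = lquot_pi (- a).
Proof. by apply/lquot_eqP; rewrite -opprD; apply: lideal_genN; exact: lquot_repr. Qed.

Lemma lquot_scaleE a b : lquot_scale a (lquot_pi b) = lquot_pi (a * b).
Proof. by apply/lquot_eqP; rewrite -mulrBr; apply: lideal_genMl; exact: lquot_repr. Qed.

Lemma lquot_ind (P : lquot -> Prop) : (forall a, P (lquot_pi a)) -> forall p, P p.
Proof. by move=> H p; rewrite -[p]reprK; exact: H. Qed.

Lemma lquot_addA : associative lquot_add.
Proof. by elim/lquot_ind=> a; elim/lquot_ind=> b; elim/lquot_ind=> c; rewrite !lquot_addE addrA. Qed.

Lemma lquot_addC : commutative lquot_add.
Proof. by elim/lquot_ind=> a; elim/lquot_ind=> b; rewrite !lquot_addE addrC. Qed.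

Lemma lquot_add0 : left_id (lquot_pi 0) lquot_add.
Proof. by elim/lquot_ind=> a; rewrite lquot_addE add0r. Qed.

Lemma lquot_addN : left_inverse (lquot_pi 0) lquot_opp lquot_add.
Proof. by elim/lquot_ind=> a; rewrite lquot_oppE lquot_addE addNr. Qed.

HB.instance Definition _ :=
  GRing.isZmodule.Build lquot lquot_addA lquot_addC lquot_add0 lquot_addN.

Lemma lquot_scaleA a b (v : lquot) : lquot_scale a (lquot_scale b v) = lquot_scale (a * b) v.
Proof. by elim/lquot_ind: v => c; rewrite !lquot_scaleE mulrA. Qed.

Lemma lquot_scale1 : left_id 1 lquot_scale.
Proof. by elim/lquot_ind=> a; rewrite lquot_scaleE mul1r. Qed.

Lemma lquot_scaleDr : right_distributive lquot_scale +%R.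
Proof.
move=> a; elim/lquot_ind=> b; elim/lquot_ind=> c.
by rewrite [RHS](lquot_addE _) ?lquot_scaleE -?[_ + _]/(lquot_add _ _) ?lquot_addE ?lquot_scaleE ?mulrDr.
Qed.

Lemma lquot_scaleDl (v : lquot) : {morph lquot_scale^~ v : a b / a + b}.
Proof.
elim/lquot_ind: v => c a b; rewrite !lquot_scaleE -[RHS]/(lquot_add _ _) lquot_addE.
by rewrite mulrDl.
Qed.

HB.instance Definition _ := GRing.Zmodule_isLmodule.Build A lquot
  lquot_scaleA lquot_scale1 lquot_scaleDr lquot_scaleDl.
End LeftQuotient.

(** * Polynomials in the coweights, inside [A] *)

Section RegularModule.
Variables (k : closedFieldType) (L : lieAlgebra k) (n : nat) (e f : 'I_n -> L).
Variable S : primitive_quotient e f.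
Notation A := (pq_ring S).
Notation sc := (pq_sc S).
Notation E := (pqE S).
Notation F := (pqF S).
Notation H := (pqH S).
Notation W := (pqW S).
Notation hdeg := (@hdeg _ _ _ _ _ S).
Notation regular := (@regular _ _ _ _ _ S).
Notation wt := (@wt k n).
Let scC : forall c (a : A), sc c * a = a * sc c := @pq_scC _ _ _ _ _ S.

Definition ev : {mpoly k[n]} -> A := mmap sc W.

Lemma evD p q : ev (p + q) = ev p + ev q. Proof. exact: mmapD. Qed.
Lemma evB p q : ev (p - q) = ev p - ev q. Proof. exact: mmapB. Qed.
Lemma evC c : ev c%:MP = sc c. Proof. exact: mmapC. Qed.
Lemma evX i : ev 'X_i = W i. Proof. by rewrite /ev mmapX mmap1U. Qed.

Lemma ev_sum (I : Type) (r : seq I) (P : pred I) (g : I -> {mpoly k[n]}) :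
  ev (\sum_(i <- r | P i) g i) = \sum_(i <- r | P i) ev (g i).
Proof. exact: (raddf_sum (mmap sc W)). Qed.

(** [A] is not commutative; the product formula rests on the commutation of the [W i] among
    themselves. *)
Lemma evM p q : ev (p * q) = ev p * ev q.
Proof.
have ev1M m1 m2 : mmap1 W (m1 + m2)%MM = mmap1 W m1 * mmap1 W m2.
  rewrite /mmap1 -prodrM_comm; last by move=> i j _ _; apply/commrX/commr_sym/commrX/pqWW.
  by apply: eq_bigr => i _; rewrite mnmDE exprD.
rewrite [p in LHS]mpolyE [q in LHS]mpolyE mulr_suml ev_sum.
rewrite {2 3}/ev /mmap mulr_suml; apply: eq_bigr => m _.
rewrite [in RHS]mulr_sumr mulr_sumr ev_sum; apply: eq_bigr => m' _.
rewrite -scalerAl -scalerAr scalerA -mpolyXD /ev mmapZ mmapX rmorphM ev1M.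
by rewrite -!mulrA; congr (_ * _); rewrite !mulrA; congr (_ * _); rewrite scC.
Qed.

Lemma hpoly_ev a : hpoly a -> exists p, ev p = a.
Proof.
elim=> [c|i|x y _ [p <-] _ [q <-]|x y _ [p <-] _ [q <-]].
- by exists c%:MP; rewrite evC.
- by exists 'X_i; rewrite evX.
- by exists (p + q); rewrite evD.
by exists (p * q); rewrite evM.
Qed.

Lemma hdeg_ev p : hdeg 0 (ev p).
Proof.
apply: hdeg_hpoly; elim/mpoly_gen_ind: p => [c|i|p q hp hq|p q hp hq].
- by rewrite evC; constructor.
- by rewrite evX; constructor.
- by rewrite evD; constructor.
by rewrite evM; constructor.
Qed.

Lemma ev_shift d x p : hdeg d x -> ev p * x = x * ev (mshift (wt d) p).
Proof.
move=> hx; rewrite /mshift; elim/mpoly_gen_ind: p => [c|i|p q hp hq|p q hp hq].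
- by rewrite msubstC evC scC.
- by rewrite msubstX evD evX evC mxE mulrDr -scC -(hdeg_adW i hx) /adj addrC subrK.
- by rewrite msubstD !evD mulrDl mulrDr hp hq.
by rewrite msubstM !evM -mulrA hq mulrA hp mulrA.
Qed.

Lemma ev_wvec (M : lmodType A) w (m : M) p : wvec w m -> ev p *: m = sc p.@[fun i => w 0 i] *: m.
Proof.
move=> hm; elim/mpoly_gen_ind: p => [c|i|p q hp hq|p q hp hq].
- by rewrite evC mevalC.
- by rewrite evX hm mevalXU.
- by rewrite evD scalerDl hp hq mevalD rmorphD scalerDl.
by rewrite evM -scalerA hq scalerA -scC -scalerA hp scalerA -rmorphM mevalM mulrC.
Qed.

Hypothesis comm0 : forall a b, hdeg 0 a -> hdeg 0 b -> a * b = b * a.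
Hypothesis regE : forall i, regular (E i).
Hypothesis regF : forall i, regular (F i).

Lemma ev_onto a : hdeg 0 a -> exists p, ev p = a.
Proof. by move=> ha; apply/hpoly_ev/hdeg0_hpoly. Qed.

(** As [E i] is regular, the kernel is an ideal stable under shifts. It then contains each value of
    its elements as a constant, and constants are not killed. *)
Lemma ev_eq0 p : ev p = 0 -> p = 0.
Proof.
move=> p0; apply: (all_eval_eq0 (pq_pchar0 S)) => v.
have := @shift_stable_ideal k n (fun p => ev p = 0) (pq_pchar0 S).
have -> : ev 0 = 0 by rewrite -mpolyC0 evC rmorph0.
move=> /(_ erefl) h; have /eqP : ev (p.@[v])%:MP = 0.
  apply: h p0 v => [q r hq hr|q r hq|i q hq].
  - by rewrite evD hq hr addr0.
  - by rewrite evM hq mul0r.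
  apply: (regE i _).1; have := ev_shift q (hg_E S i); rewrite hq mul0r => ->.
  by rewrite wt_delta.
by rewrite evC fmorph_eq0 => /eqP.
Qed.

Lemma ev_inj : injective ev.
Proof. by move=> p q pq; apply/subr0_eq/ev_eq0; rewrite evB pq subrr. Qed.
End RegularModule.

(** * The simple weight module attached to a weight in the regular case *)

Section RegularWeight.
Variables (k : closedFieldType) (L : lieAlgebra k) (n : nat) (e f : 'I_n -> L).
Variable S : primitive_quotient e f.
Notation A := (pq_ring S).
Notation sc := (pq_sc S).
Notation E := (pqE S).
Notation F := (pqF S).
Notation H := (pqH S).
Notation W := (pqW S).
Notation B := (pqB S).
Notation hdeg := (@hdeg _ _ _ _ _ S).
Notation regular := (@regular _ _ _ _ _ S).
Notation wt := (@wt k n).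
Notation ev := (@ev _ _ _ _ _ S).
Let scC : forall c (a : A), sc c * a = a * sc c := @pq_scC _ _ _ _ _ S.

Hypothesis comm0 : forall a b, hdeg 0 a -> hdeg 0 b -> a * b = b * a.
Hypothesis regE : forall i, regular (E i).
Hypothesis regF : forall i, regular (F i).

Definition offdiag (r : A) := exists s : seq ('rV[int]_n * A),
  (forall p, p \in s -> p.1 != 0 /\ hdeg p.1 p.2) /\ r = \sum_(p <- s) p.2.

Lemma offdiagD r r' : offdiag r -> offdiag r' -> offdiag (r + r').
Proof.
move=> [s [sh ->]] [t [th ->]]; exists (s ++ t); rewrite big_cat; split=> // p.
by rewrite mem_cat => /orP []; [exact: sh|exact: th].
Qed.

Lemma offdiagM r a : offdiag r -> hdeg 0 a -> offdiag (r * a).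
Proof.
move=> [s [sh ->]] ha; exists [seq (p.1, p.2 * a) | p <- s]; rewrite big_map mulr_suml.
split=> // _ /mapP [p /sh [p0 hp] ->]; split=> //=; rewrite -[p.1]addr0; exact: hg_M.
Qed.

Lemma offdiag_dec a : exists p, exists2 r, offdiag r & a = ev p + r.
Proof.
have [s [sh ->]] := hdeg_dec a.
have [|p ep] := ev_onto comm0 regE regF (a := \sum_(p <- s | p.1 == 0) p.2).
  rewrite big_seq_cond; apply: hdeg_sum => p /andP [ps /eqP <-]; exact: sh.
exists p, (\sum_(p <- s | p.1 != 0) p.2); last by rewrite ep (bigID (fun p => p.1 == 0)).
exists [seq p <- s | p.1 != 0]; rewrite big_filter; split=> // q.
by rewrite mem_filter => /andP [q0 /sh].
Qed.

Lemma offdiag_uniq p r : offdiag r -> ev p + r = 0 -> p = 0.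
Proof.
move=> [s [sh ->]] e0; apply: (ev_eq0 regE).
have := @hdeg_sep _ _ _ _ _ S ((0, ev p) :: s); rewrite !big_cons /= => /(_ _ e0 0).
rewrite big_cons eqxx big_seq_cond big1 ?addr0 => [|q /andP [/sh [/negbTE -> //]]].
apply=> q; rewrite inE => /orP [/eqP ->|/sh []] //; exact: hdeg_ev.
Qed.

Section Functional.
Variable lam : 'rV[k]_n.

(* Evaluation at lam of the degree-zero component, a polynomial in the W i. *)
Definition phi (a : A) : k := (sval (cid (offdiag_dec a))).@[fun i => lam 0 i].

Lemma phiE p r : offdiag r -> phi (ev p + r) = p.@[fun i => lam 0 i].
Proof.
move=> hr; rewrite /phi; case: cid => q [r' hr' e0] /=.
congr (_.@[_]); apply/subr0_eq; apply: (@offdiag_uniq _ (r' - r)).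
  apply: offdiagD => //; rewrite -mulrN1; apply: offdiagM => //.
  by rewrite -(rmorphN1 sc); apply: hg_sc.
by rewrite evB addrACA -e0 -opprD subrr.
Qed.

Lemma phi_ev p : phi (ev p) = p.@[fun i => lam 0 i].
Proof. by rewrite -[ev p]addr0 phiE //; exists [::]; rewrite big_nil. Qed.

Lemma phiD a b : phi (a + b) = phi a + phi b.
Proof.
have [p [r hr ->]] := offdiag_dec a; have [q [r' hr' ->]] := offdiag_dec b.
by rewrite addrACA -evD !phiE ?mevalD //; apply: offdiagD.
Qed.

Lemma phiM a q : phi (a * ev q) = phi a * q.@[fun i => lam 0 i].
Proof.
have [p [r hr ->]] := offdiag_dec a.
by rewrite mulrDl -evM !phiE ?mevalM //; apply: offdiagM => //; apply: hdeg_ev.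
Qed.

Lemma phi1 : phi 1 = 1.
Proof. by rewrite -(rmorph1 sc) -evC phi_ev mevalC. Qed.

(** The largest left ideal on which [phi] vanishes, so that the quotient by it is simple. *)
Definition phi_null (a : A) := forall y, phi (y * a) = 0.

Definition phimod := lquot phi_null.
HB.instance Definition _ := GRing.Lmodule.on phimod.
Notation M := (phimod : lmodType A).
Definition phi_pi (a : A) : phimod := lquot_pi phi_null a.

Lemma phi_nullP a : phi_pi a = 0 <-> phi_null a.
Proof.
rewrite -[0]/(phi_pi 0) -lquot_eqP subr0; split; last by constructor.
elim=> // [y|x y _ hx _ hy z|b x _ hx z]; last by rewrite mulrA hx.
  by rewrite mulr0 -(rmorph0 sc) -evC phi_ev mevalC.
by rewrite mulrDr phiD hx hy addr0.
Qed.

Lemma phi_piZ a b : a *: phi_pi b = phi_pi (a * b).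
Proof. exact: lquot_scaleE. Qed.

Lemma phi_piE (m : phimod) : exists a, m = a *: phi_pi 1.
Proof. by elim/lquot_ind: m => a; exists a; rewrite phi_piZ mulr1. Qed.

Lemma phi_pi1 : phi_pi 1 <> 0.
Proof. by move=> /phi_nullP /(_ 1) /eqP; rewrite mulr1 phi1 oner_eq0. Qed.

Lemma phi_pi_ev p : ev p *: phi_pi 1 = sc p.@[fun i => lam 0 i] *: phi_pi 1.
Proof.
apply/subr0_eq; rewrite -scalerBl phi_piZ mulr1; apply/phi_nullP => y.
by rewrite -evC -evB phiM mevalB mevalC subrr mulr0.
Qed.

Lemma phi_pi_wvec : wvec lam (phi_pi 1).
Proof. by move=> i; rewrite -evX phi_pi_ev mevalXU. Qed.

(* A projector of A_0 onto the weight lam extracts phi from any element. *)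
Lemma phi_project b : exists c : A, forall m, m = b *: phi_pi 1 ->
  c *: m = sc (phi b) *: phi_pi 1 /\ (wvec lam m -> m = c *: m).
Proof.
have [p [r [s [sh ->]] ->]] := offdiag_dec b.
have [|c [hc cw cs]] := @wvec_projector _ _ _ _ _ S M lam [seq lam + wt q.1 | q <- s].
  apply/negP => /mapP [q /sh [q0 _]] /eqP; rewrite -subr_eq0 opprD addrA subrr sub0r oppr_eq0.
  by rewrite -wt0 (inj_eq (wt_inj S)) (negbTE q0).
exists c => m mE; split; last by move=> hm; rewrite cw.
rewrite mE phiE; last by exists s.
rewrite scalerDl scalerDr phi_pi_ev scaler_suml scaler_sumr big_seq big1 ?addr0.
  by rewrite cw //; apply/wvecZ/phi_pi_wvec.
move=> q qs; apply: (cs (lam + wt q.1)); first exact: map_f.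
by apply: hdeg_wvec phi_pi_wvec; apply: (sh q qs).2.
Qed.

(** If [a] is not null, some [y a] has nonzero [phi], and projecting its class onto the weight [lam]
    recovers the generator. *)
Lemma phimod_simple : simple_mod M.
Proof.
split; first by exists (phi_pi 1); exact: phi_pi1.
move=> N N0 ND NM; case: (pselect (forall x, N x -> x = 0)) => [|no]; [by left|right].
have [m [Nm mN]] : exists m, N m /\ m <> 0.
  apply: contrapT => h; apply: no => m Nm; apply: contrapT => mN; apply: h; by exists m.
have [a ma] := phi_piE m; move: mN; rewrite {1}ma phi_piZ mulr1 => /phi_nullP /existsNP [y ya].
have [c cP] := phi_project (y * a).
have [cm _] := cP (y *: m) (etrans (congr1 _ ma) (scalerA _ _ _)).
have N1 : N (phi_pi 1).
  have -> : phi_pi 1 = sc (phi (y * a))^-1 *: (c *: (y *: m)).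
    by rewrite cm scalerA -rmorphM mulVf ?rmorph1 ?scale1r //; apply/eqP.
  by do 3 apply: (NM).
by move=> x; have [b ->] := phi_piE x; apply: NM.
Qed.

Lemma phimod_cpointed : cpointed M.
Proof.
apply: (cpointed_of_wvec phimod_simple comm0 phi_pi1 phi_pi_wvec) => m hm.
have [a ma] := phi_piE m; have [c /(_ m ma) [cm cw]] := phi_project a.
by exists (phi a); rewrite -cm -cw.
Qed.
End Functional.

Lemma Hpoly_eval i (v : 'I_n -> k) :
  (\sum_j (B i j)%:MP * 'X_j : {mpoly k[n]}).@[v] = \sum_j B i j * v j.
Proof. by rewrite (raddf_sum (meval v)); apply: eq_bigr => j _; rewrite /= mevalM mevalC mevalXU. Qed.

Lemma ev_Hpoly i : ev (\sum_j (B i j)%:MP * 'X_j) = H i.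
Proof. by rewrite ev_sum pqH_W; apply: eq_bigr => j _; rewrite evM evC evX. Qed.

Section LineOfWeights.
Variables (M : lmodType A) (i : 'I_n) (T : {mpoly k[n]}).
Hypothesis evT : ev T = F i * E i.

Lemma ev_shiftT : ev (mshift (- delta_mx 0 i) T) = E i * F i.
Proof.
apply/subr0_eq; apply: (regE i _).2.
rewrite mulrBl (ev_shift _ (hg_E S i)) mshiftD wt_delta subrr mshift0 evT.
by rewrite mulrA subrr.
Qed.

(** This is [e_i f_i = f_i e_i + h_i], with [e_i f_i] read as the translate of [f_i e_i]. *)
Lemma T_rec (v : 'I_n -> k) :
  T.@[fun j => v j - (j == i)%:R] = T.@[v] + \sum_j B i j * v j.
Proof.
have -> : (fun j => v j - (j == i)%:R) = fun j => v j + (- delta_mx 0 i : 'rV[k]_n) 0 j.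
  by apply/funext => j; rewrite !mxE eqxx.
rewrite -meval_mshift -Hpoly_eval -mevalD; congr (_.@[v]); apply: (ev_inj regE).
by rewrite ev_shiftT evD ev_Hpoly evT pqHE addrC subrK.
Qed.

Lemma B_diag j : B j j = 2%:R.
Proof. by have [[[h _ _ _] _] _ _ _ _] := pqCP S; rewrite mxE h. Qed.

Definition shiftv (v : 'I_n -> k) (z : k) j := v j + z * (j == i)%:R.

Lemma h_shiftv v z : \sum_j B i j * shiftv v z j = \sum_j B i j * v j + 2%:R * z.
Proof.
rewrite /shiftv; under eq_bigr do rewrite mulrDr.
rewrite big_split /=; congr (_ + _).
rewrite (bigD1 i) //= big1 => [|j /negbTE ->]; last by rewrite !mulr0.
by rewrite eqxx mulr1 addr0 B_diag.
Qed.

(** The recursion summed along the line; it is quadratic because [B i i = 2]. *)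
Lemma T_shiftv v (m : int) :
  T.@[shiftv v m%:~R] = T.@[v] - m%:~R * (\sum_j B i j * v j) - m%:~R * (m%:~R + 1).
Proof.
have rec z : T.@[shiftv v z] = T.@[shiftv v (z - 1)] - (\sum_j B i j * v j) - 2%:R * z.
  have := T_rec (shiftv v z); rewrite h_shiftv.
  rewrite (_ : (fun j => _) = shiftv v (z - 1)).
    by move=> ->; ring.
  by apply/funext => j; rewrite /shiftv mulrBl mul1r addrA.
have s0 : T.@[shiftv v 0] = T.@[v].
  by apply: meval_eq => j; rewrite /shiftv mul0r addr0.
elim/int_ind: m => [|m IH|m IH].
- by rewrite s0 !mul0r !subr0.
- rewrite rec intS rmorphD /= [1 + _]addrC addrK IH; ring.

rewrite intS opprD addrC rmorphD /= rmorphN1.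
have -> : T.@[shiftv v ((- m%:Z)%:~R - 1)] = T.@[shiftv v (- m%:Z)%:~R] +
    (\sum_j B i j * v j) + 2%:R * (- m%:Z)%:~R by rewrite [in RHS]rec; ring.
by rewrite IH; ring.
Qed.

(** Two distinct zeros [m], [m'] would give [h_i(v) = - (m + m' + 1)], an integer. *)
Lemma T_one_zero v (m m' : int) :
  (forall z : int, \sum_j B i j * v j != z%:~R) ->
  T.@[shiftv v m%:~R] = 0 -> T.@[shiftv v m'%:~R] = 0 -> m = m'.
Proof.
move=> nz; rewrite !T_shiftv => h h'; apply/eqP; rewrite -subr_eq0; apply/negP => /negP mm'.
have mm'k : (m - m')%:~R != 0 :> k.
  by apply: contra mm' => /eqP e0; apply/eqP; apply: (intr_inj_pchar0 (pq_pchar0 S)).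
case/eqP: (nz (- (m + m' + 1))); apply: (mulfI mm'k).
rewrite !(rmorphN, rmorphD, rmorph1) /=.
have : T.@[v] - m%:~R * (\sum_j B i j * v j) - m%:~R * (m%:~R + 1) -
  (T.@[v] - m'%:~R * (\sum_j B i j * v j) - m'%:~R * (m'%:~R + 1)) = 0 by rewrite h h' subrr.
set s := \sum_j _; set x := m%:~R; set y := m'%:~R => e0.
apply/eqP; rewrite -subr_eq0 -oppr_eq0; apply/eqP; rewrite -[RHS]e0; ring.
Qed.

Definition wset (v : 'I_n -> k) := exists m : M, m <> 0 /\ wvec (\row_j v j) m.

Lemma wset_up v : wset v -> T.@[v] != 0 -> wset (shiftv v 1).
Proof.
move=> [m [mN hm]] Tv; exists (E i *: m); split.
  move=> Em; apply: mN; have := ev_wvec T hm; rewrite evT -scalerA Em scaler0.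
  rewrite (_ : T.@[_] = T.@[v]); last by apply: meval_eq => j; rewrite mxE.
  move=> /(congr1 (fun t => sc T.@[v]^-1 *: t)); rewrite scaler0 scalerA -rmorphM mulVf //.
  by rewrite rmorph1 scale1r.
have := hdeg_wvec (hg_E S i) hm; rewrite wt_delta.
by congr (wvec _ _); apply/rowP => j; rewrite !mxE /shiftv eqxx mul1r.
Qed.

Lemma wset_down v : wset v -> T.@[shiftv v (-1)] != 0 -> wset (shiftv v (-1)).
Proof.
move=> [m [mN hm]] Tv; exists (F i *: m); split.
  move=> Fm; apply: mN; have := ev_wvec (mshift (- delta_mx 0 i) T) hm.
  rewrite ev_shiftT -scalerA Fm scaler0 meval_mshift.
  rewrite (_ : T.@[_] = T.@[shiftv v (-1)]); last first.
    by apply: meval_eq => j; rewrite !mxE /shiftv eqxx mulN1r.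
  move=> /(congr1 (fun t => sc T.@[shiftv v (-1)]^-1 *: t)); rewrite scaler0 scalerA -rmorphM mulVf //.
  by rewrite rmorph1 scale1r.
have := hdeg_wvec (hg_F S i) hm; rewrite wtN wt_delta.
by congr (wvec _ _); apply/rowP => j; rewrite !mxE /shiftv eqxx mulN1r.
Qed.

Lemma shiftvD v x y : shiftv (shiftv v x) y = shiftv v (x + y).
Proof. by apply/funext => j; rewrite /shiftv mulrDl addrA. Qed.

Lemma shiftv0 v : shiftv v 0 = v.
Proof. by apply/funext => j; rewrite /shiftv mul0r addr0. Qed.

(** Going up is obstructed only at a zero of [T] on the nonnegative side, going down only at one on
    the negative side. There is at most one zero, so one direction is free. *)
Lemma wset_line v : wset v -> (forall z : int, \sum_j B i j * v j != z%:~R) ->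
  (forall m : nat, wset (shiftv v m%:R)) \/ (forall m : nat, wset (shiftv v (- m%:R))).
Proof.
move=> hv nz; case: (pselect (exists m : nat, T.@[shiftv v m%:R] = 0)) => [[m Tm]|no].
  right; elim=> [|l IH]; first by rewrite oppr0 shiftv0.
  rewrite mulrS opprD addrC -shiftvD; apply: wset_down => //; rewrite shiftvD.
  apply/negP => /eqP Tl; have := @T_one_zero v m%:Z (- l.+1%:Z) nz.
  rewrite -pmulrn => /(_ Tm); rewrite rmorphN /= -pmulrn mulrS opprD addrC.
  by move=> /(_ Tl) /eqP.
left; elim=> [|l IH]; first by rewrite shiftv0.
rewrite mulrS addrC -shiftvD; apply: wset_up => //.
by apply/negP => /eqP h; apply: no; exists l.
Qed.
End LineOfWeights.
End RegularWeight.

Lemma sum_by_degree (I : eqType) (G : zmodType) (s : seq (I * G)) :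
  \sum_(p <- s) p.2 = \sum_(d <- undup [seq p.1 | p <- s]) \sum_(p <- s | p.1 == d) p.2.
Proof.
rewrite (exchange_big_dep xpredT) //= big_seq [RHS]big_seq; apply: eq_bigr => p ps.
rewrite -big_filter (eq_filter (a2 := pred1 p.1)) => [|d]; last exact: eq_sym.
by rewrite filter_pred1_uniq ?big_seq1 ?undup_uniq // mem_undup map_f.
Qed.

(** * Faithfulness for a generic weight *)

Section RegularFaithful.
Variables (k : closedFieldType) (L : lieAlgebra k) (n : nat) (e f : 'I_n -> L).
Variable S : primitive_quotient e f.
Notation A := (pq_ring S).
Notation sc := (pq_sc S).
Notation E := (pqE S).
Notation F := (pqF S).
Notation B := (pqB S).
Notation hdeg := (@hdeg _ _ _ _ _ S).
Notation regular := (@regular _ _ _ _ _ S).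
Notation wt := (@wt k n).
Notation ev := (@ev _ _ _ _ _ S).

(** The homogeneous components send a weight vector to distinct weight spaces, so each of them kills
    it. *)
Lemma ann_component (M : lmodType A) (s : seq ('rV[int]_n * A)) w (m : M) d :
  (forall p, p \in s -> hdeg p.1 p.2) -> wvec w m -> (\sum_(p <- s) p.2) *: m = 0 ->
  (\sum_(p <- s | p.1 == d) p.2) *: m = 0.
Proof.
move=> sh hm e0.
have [|c [_ cw cs]] := @wvec_projector _ _ _ _ _ S M (w + wt d) [seq w + wt p.1 | p <- s & p.1 != d].
  apply/negP => /mapP [p]; rewrite mem_filter => /andP [pd _] /addrI /(wt_inj S) dp.
  by rewrite dp eqxx in pd.
have := congr1 (fun t => c *: t) e0; rewrite /= scaler0 => e1; rewrite -[RHS]e1.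
rewrite !scaler_suml scaler_sumr big_mkcond big_seq [RHS]big_seq; apply: eq_bigr => p ps.
have hp := hdeg_wvec (sh p ps) hm.
case: eqP => [pd|/eqP pd]; first by rewrite cw // -pd.
by rewrite (cs (w + wt p.1)) //; apply: map_f; rewrite mem_filter pd.
Qed.

Hypothesis comm0 : forall a b, hdeg 0 a -> hdeg 0 b -> a * b = b * a.
Hypothesis regE : forall i, regular (E i).
Hypothesis regF : forall i, regular (F i).

Notation phimod := (@phimod _ _ _ _ _ S comm0 regE regF).
Notation phi_pi := (@phi_pi _ _ _ _ _ S comm0 regE regF).

Lemma half_not_int (z : int) : (2%:R^-1 : k) != z%:~R.
Proof.
have two : (2%:R : k) != 0 by have -> := (pcharf0P k).1 (pq_pchar0 S) 2.
apply/negP => /eqP h; have : (1 : int)%:~R = (2 * z)%:~R :> k.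
  by rewrite rmorphM /= -h -pmulrn mulfV.
by move=> /(intr_inj_pchar0 (pq_pchar0 S)); lia.
Qed.

Lemma phimod_faithful (lam : 'rV[k]_n) : (forall i, \sum_j B i j * lam 0 j = 2%:R^-1) ->
  forall a : A, (forall m : phimod lam, a *: m = 0) -> a = 0.
Proof.
move=> hlam a akill; have [s [sh sE]] := hdeg_dec a.
rewrite sE sum_by_degree; apply: big1 => d _; set b := \sum_(p <- s | _) _.
have hb : hdeg d b by rewrite /b big_seq_cond; apply: hdeg_sum => p /andP [ps /eqP <-]; apply: sh.
have bkill w (m : phimod lam) : wvec w m -> b *: m = 0.
  by move=> hm; apply: ann_component hm _ => //; rewrite -sE akill.
(* A regular factor brings [b] to degree zero, where it is a polynomial in the coweights vanishing
   on the support. *)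
have [u hu ru] := regular_homog regE regF (- d).
apply: (ru b).1; have hub : hdeg 0 (u * b) by apply: (hdeg_MV hu); rewrite opprK.
have [p ep] := ev_onto comm0 regE regF hub; rewrite -ep.
suff -> : p = 0 by rewrite -mpolyC0 evC rmorph0.
apply/eqP/negP => /negP p0.
(* The support, with the record that it lies in [lam] plus the integral lattice: the Cartan matrix
   being integral, each [h_i] stays in 1/2 + Z there. *)
pose D (v : 'I_n -> k) := wset (phimod lam) v /\ exists d : 'rV[int]_n, forall j, v j = lam 0 j + (d 0 j)%:~R.
have D0 : D (fun j => lam 0 j).
  split; last by exists 0 => j; rewrite mxE addr0.
  exists (phi_pi lam 1); split; first exact: phi_pi1.
  by have := phi_pi_wvec comm0 regE regF lam; congr (wvec _ _); apply/rowP => j; rewrite mxE.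
have [|v [[m [mN hm]] _]] := tree_nonvanish p0 D0; last first.
  case/eqP; apply/eqP; rewrite -[_ == 0](fmorph_eq0 sc); apply/eqP.
  have := ev_wvec p hm; rewrite ep -scalerA (bkill _ _ hm) scaler0.
  rewrite (_ : p.@[_] = p.@[v]); last by apply: meval_eq => j; rewrite mxE.
  move=> pm; apply: contrapT => /eqP pv; apply: mN.
  rewrite -[m]scale1r -(rmorph1 sc) -(@mulVf _ p.@[v]) ?rmorphM -?scalerA -?pm ?scaler0 //.
  by move: pv; rewrite fmorph_eq0.
move=> v i [wv [d' vd]] r.
have [T evT] : exists T, ev T = F i * E i.
  by apply: (ev_onto comm0 regE regF); rewrite -(subrr (delta_mx 0 i)) addrC; apply: hg_M; constructor.
have nz (z : int) : \sum_j B i j * v j != z%:~R.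
  have -> : \sum_j B i j * v j = 2%:R^-1 + (\sum_j pqC S i j * d' 0 j)%:~R.
    rewrite -(hlam i) rmorph_sum -big_split; apply: eq_bigr => j _.
    by rewrite vd mulrDr mxE /= rmorphM.
  rewrite -subr_eq0 -addrA -rmorphB /= addr_eq0 -rmorphN /=.
  exact: half_not_int.
have upE c : upd v i (v i + c) = shiftv i v c.
  by apply/funext => j; rewrite /upd /shiftv; case: eqP => [->|_]; rewrite ?mulr1 ?mulr0 ?addr0.
have fin (g : nat -> k) : injective g -> (forall m, wset (phimod lam) (shiftv i v (g m))) ->
    (forall m, exists z : int, g m = z%:~R) -> exists c, c \notin r /\ D (upd v i c).
  move=> ginj gw gz.
  have [m mr] : exists m, v i + g m \notin r.
    apply: contrapT => /forallNP no.
    have sub : {subset [seq v i + g m | m <- iota 0 (size r).+1] <= r}.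
      by move=> _ /mapP [m _ ->]; move: (no m) => /negP; rewrite negbK.
    suff /uniq_leq_size /(_ sub) : uniq [seq v i + g m | m <- iota 0 (size r).+1].
      by rewrite size_map size_iota ltnn.
    by rewrite map_inj_uniq ?iota_uniq // => m m' /addrI /ginj.
  exists (v i + g m); split=> //; rewrite upE; split=> //.
  have [z gmz] := gz m; exists (d' + z *: delta_mx 0 i) => j.
  rewrite /shiftv gmz vd !mxE eqxx /= rmorphD rmorphM /= addrA; congr (_ + _ * _).
  by case: eqP.
have ninj := natr_inj_pchar0 (pq_pchar0 S).
case: (wset_line regE evT wv nz) => up.
  by apply: (fin (fun m => m%:R)) => // m; exists m%:Z; rewrite -pmulrn.
apply: (fin (fun m => - m%:R)) => //; first by move=> m m' /oppr_inj /ninj.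
by move=> m; exists (- m%:Z); rewrite rmorphN /= -pmulrn.
Qed.

Lemma regular_module : exists M : lmodType A,
  [/\ simple_mod M, cpointed M & forall a : A, (forall m : M, a *: m = 0) -> a = 0].
Proof.
(* The solution of [h_i = 1/2] for all [i], by the inverse Cartan matrix. *)
pose lam : 'rV[k]_n := \row_j \sum_l invmx B j l / 2%:R.
have hlam i : \sum_j B i j * lam 0 j = 2%:R^-1.
  have lamE j : lam 0 j = (\sum_l invmx B j l) / 2%:R by rewrite mxE mulr_suml.
  under eq_bigr do rewrite lamE mulrA.
  rewrite -mulr_suml -[RHS]mul1r; congr (_ * _).
  under eq_bigr do rewrite mulr_sumr.
  rewrite exchange_big /=.
  have row l : \sum_j B i j * invmx B j l = (i == l)%:R.
    by have /matrixP /(_ i l) := mulmxV (pqB_unit S); rewrite !mxE.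
  rewrite (eq_bigr _ (fun l _ => row l)) (bigD1 i) //= big1 ?eqxx ?addr0 // => l.
  by rewrite eq_sym => /negbTE ->.
exists (phimod lam); split; [exact: phimod_simple|exact: phimod_cpointed|exact: phimod_faithful].
Qed.
End RegularFaithful.

(** * Twisted generalized Weyl algebras *)

Section QuotientMaps.
Variables (A : pzRingType) (S : A -> Prop).

Lemma quot_piD a b : quot_pi S (a + b) = quot_pi S a + quot_pi S b.
Proof. by rewrite -[RHS]/(quot_add _ _) quot_addE. Qed.

Lemma quot_piM a b : quot_pi S (a * b) = quot_pi S a * quot_pi S b.
Proof. by rewrite -[RHS]/(quot_mul _ _) quot_mulE. Qed.

Lemma quot_piN a : quot_pi S (- a) = - quot_pi S a.
Proof. by rewrite -[RHS]/(quot_opp _) quot_oppE. Qed.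

Lemma quot_pi_rel a b : S (a - b) -> quot_pi S a = quot_pi S b.
Proof. by move=> h; apply/quot_eqP; constructor. Qed.

Lemma quot_onto (q : ring_quot S) : exists a, q = quot_pi S a.
Proof. by elim/quot_ind: q => a; exists a. Qed.

Lemma quot_lift (B : pzRingType) (g : A -> B) :
  (forall x y, g (x + y) = g x + g y) -> (forall x y, g (x * y) = g x * g y) ->
  (forall x, S x -> g x = 0) -> exists h : ring_quot S -> B, forall a, h (quot_pi S a) = g a.
Proof.
move=> gD gM gS; have g0 : g 0 = 0.
  by have /eqP := gD 0 0; rewrite addr0 -subr_eq subrr eq_sym => /eqP.
exists (fun q => g (repr q)) => a.
have : ideal_gen S (repr (quot_pi S a) - a) by exact: quot_repr.
have gI x : ideal_gen S x -> g x = 0.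
  elim=> [{}x /gS //|//|x' y _ hx _ hy|b x' _ hx|b x' _ hx]; first by rewrite gD hx hy addr0.
    by rewrite gM hx mulr0.
  by rewrite gM hx mul0r.
by move=> /gI h; rewrite -[repr _](subrK a) gD h add0r.
Qed.
End QuotientMaps.

Section FreeEval.
Variables (R : pzRingType) (T : Type) (B : pzRingType) (g : {rmorphism R -> B}) (h : T -> B).

Fixpoint teval (t : rterm R T) : B :=
  match t with
  | RCst r => g r
  | RGen x => h x
  | RAdd a b => teval a + teval b
  | RMul a b => teval a * teval b
  end.

Lemma teval_cong a b : rcong a b -> teval a = teval b.
Proof.
elim=> //= {a b}.
- by move=> a b c _ -> _ ->.
- by move=> a a' b b' _ -> _ ->.
- by move=> a a' b b' _ -> _ ->.
- by move=> *; rewrite addrA.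
- by move=> *; rewrite addrC.
- by move=> *; rewrite rmorph0 add0r.
- by move=> *; rewrite mulrA.
- by move=> *; rewrite rmorph1 mul1r.
- by move=> *; rewrite rmorph1 mulr1.
- by move=> *; rewrite rmorph0 mul0r.
- by move=> *; rewrite mulrDl.
- by move=> *; rewrite mulrDr.
- by move=> *; rewrite rmorphD.
by move=> *; rewrite rmorphM.
Qed.

Definition feval (p : freeRing R T) : B := teval (repr p).

Lemma feval_pi a : feval (\pi_(freeRing R T) a)%qT = teval a.
Proof. by apply: teval_cong; exact: free_repr. Qed.

Lemma feval_cst r : feval (free_cst T r) = g r. Proof. exact: feval_pi. Qed.
Lemma feval_gen x : feval (free_gen R x) = h x. Proof. exact: feval_pi. Qed.
Lemma fevalD p q : feval (p + q) = feval p + feval q. Proof. exact: feval_pi. Qed.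
Lemma fevalM p q : feval (p * q) = feval p * feval q. Proof. exact: feval_pi. Qed.

Lemma fevalN p : feval (- p) = - feval p.
Proof.
apply/eqP; rewrite -addr_eq0 -fevalD addNr.
by rewrite -[0]/(free_cst T 0) feval_cst rmorph0.
Qed.
End FreeEval.

Lemma free_gen_ind (R : pzRingType) (T : Type) (P : freeRing R T -> Prop) :
  (forall r, P (free_cst T r)) -> (forall x, P (free_gen R x)) ->
  (forall a b, P a -> P b -> P (a + b)) -> (forall a b, P a -> P b -> P (a * b)) -> forall p, P p.
Proof.
move=> PC PG PD PM; elim/free_ind; elim=> [r|x|a Pa b Pb|a Pa b Pb]; [exact: PC|exact: PG| |].
  by have := PD _ _ Pa Pb; congr P; rewrite -[LHS]/(free_add _ _) free_addE.
by have := PM _ _ Pa Pb; congr P; rewrite -[LHS]/(free_mul _ _) free_mulE.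
Qed.

(** * Normal form in the algebra [C_mu] *)

Section NormalForm.
Variables (k : fieldType) (n : nat) (D : tgw_datum k n) (mu : 'I_n -> 'I_n -> k).
Hypothesis mu0 : forall i j, i != j -> mu i j != 0.
Notation R := (tgw_ring D).
Notation C := (@tgwc_cst _ _ D mu).
Notation X := (@tgwc_X _ _ D mu).
Notation Y := (@tgwc_Y _ _ D mu).

Lemma tgwcD r s : C (r + s) = C r + C s.
Proof. by rewrite /tgwc_cst free_cstD -quot_piD. Qed.

Lemma tgwcM r s : C (r * s) = C r * C s.
Proof. by rewrite /tgwc_cst free_cstM -quot_piM. Qed.

Lemma tgwc1 : C 1 = 1. Proof. by []. Qed.

Lemma tgwc_XC i r : X i * C r = C (tgw_sigma D i r) * X i.
Proof. by rewrite -!quot_piM; apply: quot_pi_rel; constructor. Qed.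

Lemma tgwc_YC i r : Y i * C r = C (tgw_sigmaV i r) * Y i.
Proof. by rewrite -!quot_piM; apply: quot_pi_rel; constructor. Qed.

Lemma tgwcYX i : Y i * X i = C (tgw_t D i).
Proof. by rewrite -!quot_piM; apply: quot_pi_rel; constructor. Qed.

Lemma tgwcXY i : X i * Y i = C (tgw_sigma D i (tgw_t D i)).
Proof. by rewrite -!quot_piM; apply: quot_pi_rel; constructor. Qed.

Lemma tgwcXYij i j : i != j -> X i * Y j = C (mu i j)%:A * (Y j * X i).
Proof.
move=> ij; rewrite /tgwc_X /tgwc_Y -[in RHS](quot_piM (tgwc_rel mu) (free_gen R (inr j))).
by rewrite -!quot_piM; apply: quot_pi_rel; constructor.
Qed.

Lemma sigma_scalar i c : tgw_sigma D i c%:A = c%:A.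
Proof. by rewrite linearZ rmorph1. Qed.

Lemma sigmaV_scalar i c : tgw_sigmaV i (c%:A : R) = c%:A.
Proof. by rewrite -[X in tgw_sigmaV i X](sigma_scalar i) tgw_sigmaK. Qed.

Lemma TGWC_ind (P : TGWC D mu -> Prop) : (forall r, P (C r)) -> (forall i, P (X i)) ->
  (forall i, P (Y i)) -> (forall a b, P a -> P b -> P (a + b)) ->
  (forall a b, P a -> P b -> P (a * b)) -> forall y, P y.
Proof.
move=> PC PX PY PD PM y; have [p ->] := quot_onto y.
elim/free_gen_ind: p => [r|[i|i]|a b Pa Pb|a b Pa Pb].
- exact: PC.
- exact: PX.
- exact: PY.
- by rewrite quot_piD; apply: PD.
by rewrite quot_piM; apply: PM.
Qed.

Lemma tgwc_scalarC c y : C c%:A * y = y * C c%:A.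
Proof.
elim/TGWC_ind: y => [r|i|i|a b ha hb|a b ha hb].
- by rewrite -!tgwcM -scalerAl -scalerAr mul1r mulr1.
- by rewrite tgwc_XC sigma_scalar.
- by rewrite tgwc_YC sigmaV_scalar.
- by rewrite mulrDr mulrDl ha hb.
by rewrite mulrA ha -mulrA hb mulrA.
Qed.

Definition Xw (l : seq 'I_n) : TGWC D mu := \prod_(i <- l) X i.
Definition Yw (l : seq 'I_n) : TGWC D mu := \prod_(i <- l) Y i.
Definition ldeg (l : seq 'I_n) : 'rV[int]_n := \sum_(i <- l) delta_mx 0 i.

(** Equality up to a nonzero scalar, which avoids tracking the products of the [mu i j]. *)
Definition scassoc (x y : TGWC D mu) := exists2 c : k, c != 0 & x = C c%:A * y.

Lemma scassoc_refl x : scassoc x x.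
Proof. by exists 1; rewrite ?oner_neq0 // scale1r tgwc1 mul1r. Qed.

Lemma scassoc_trans y x z : scassoc x y -> scassoc y z -> scassoc x z.
Proof.
move=> [c c0 ->] [c' c'0 ->]; exists (c * c'); first by rewrite mulf_neq0.
by rewrite mulrA -tgwcM -scalerAl mul1r scalerA.
Qed.

Lemma scassoc_sym x y : scassoc x y -> scassoc y x.
Proof.
move=> [c c0 ->]; exists c^-1; first by rewrite invr_eq0.
by rewrite mulrA -tgwcM -scalerAl mul1r scalerA mulVf // scale1r tgwc1 mul1r.
Qed.

Lemma scassocM a b x y : scassoc x y -> scassoc (a * x * b) (a * y * b).
Proof. by move=> [c c0 ->]; exists c => //; rewrite mulrA -tgwc_scalarC -!mulrA. Qed.

Lemma scassoc_XY i j : i != j -> scassoc (X i * Y j) (Y j * X i).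
Proof. by move=> ij; exists (mu i j); [exact: mu0|exact: tgwcXYij]. Qed.

Lemma scassoc_XYw i l : i \notin l -> scassoc (X i * Yw l) (Yw l * X i).
Proof.
elim: l => [|j l IH]; first by rewrite /Yw big_nil mulr1 mul1r => _; exact: scassoc_refl.
rewrite inE negb_or => /andP [ij /IH h]; rewrite /Yw big_cons -/(Yw l) mulrA.
apply: (@scassoc_trans (Y j * X i * Yw l)).
  by have := scassocM 1 (Yw l) (scassoc_XY ij); rewrite !mul1r.
by have := scassocM (Y j) 1 h; rewrite !mulr1 !mulrA.
Qed.

Lemma scassoc_XwY j r : j \notin r -> scassoc (Xw r * Y j) (Y j * Xw r).
Proof.
elim: r => [|i r IH]; first by rewrite /Xw big_nil mulr1 mul1r => _; exact: scassoc_refl.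
rewrite inE negb_or => /andP [ij /IH h]; rewrite /Xw big_cons -/(Xw r) -mulrA.
apply: (@scassoc_trans (X i * (Y j * Xw r))).
  by have := scassocM (X i) 1 h; rewrite !mulr1.
rewrite mulrA [Y j * (X i * _)]mulrA.
by have := scassocM 1 (Xw r) (@scassoc_XY i j _); rewrite !mul1r; apply; rewrite eq_sym.
Qed.

Lemma scassoc_XwYw r l : (forall i, i \in l -> i \notin r) -> scassoc (Xw r * Yw l) (Yw l * Xw r).
Proof.
elim: l => [|j l IH] dis; first by rewrite /Yw big_nil mulr1 mul1r; exact: scassoc_refl.
rewrite /Yw big_cons -/(Yw l) mulrA; apply: (@scassoc_trans (Y j * Xw r * Yw l)).
  have := scassocM 1 (Yw l) (@scassoc_XwY j r _); rewrite !mul1r; apply.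
  by apply: dis; rewrite mem_head.
rewrite -!mulrA; have := scassocM (Y j) 1 (IH _); rewrite !mulr1; apply=> i il.
by apply: dis; rewrite inE il orbT.
Qed.

(** The coefficients allowed in normal forms. Two choices serve: all of [R], and its center, which
    contains the [t_i] and is stable under the automorphisms. *)
Variable Zp : R -> Prop.
Hypothesis ZpD : forall r s, Zp r -> Zp s -> Zp (r + s).
Hypothesis ZpM : forall r s, Zp r -> Zp s -> Zp (r * s).
Hypothesis ZpA : forall c, Zp c%:A.
Hypothesis Zpsigma : forall i r, Zp r -> Zp (tgw_sigma D i r).
Hypothesis ZpsigmaV : forall i r, Zp r -> Zp (tgw_sigmaV i r).
Hypothesis Zpt : forall i, Zp (tgw_t D i).

Definition zmul (x y : TGWC D mu) := exists2 z, Zp z & x = C z * y.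

Lemma zmul_trans y x z : zmul x y -> zmul y z -> zmul x z.
Proof. by move=> [r Zr ->] [s Zs ->]; exists (r * s); [exact: ZpM|rewrite tgwcM mulrA]. Qed.

Lemma scassoc_zmul x y : scassoc x y -> zmul x y.
Proof. by move=> [c _ ->]; exists c%:A. Qed.

Lemma zmulM b x y : zmul x y -> zmul (x * b) (y * b).
Proof. by move=> [r Zr ->]; exists r => //; rewrite mulrA. Qed.

Definition skew (a : TGWC D mu) := forall z, Zp z -> exists2 z', Zp z' & a * C z = C z' * a.

Lemma skewM a b : skew a -> skew b -> skew (a * b).
Proof.
move=> sa sb z Zz; have [z' Zz' h] := sb z Zz; have [z'' Zz'' h'] := sa z' Zz'.
by exists z'' => //; rewrite -mulrA h mulrA h' mulrA.
Qed.

Lemma skewX i : skew (X i).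
Proof. by move=> z Zz; exists (tgw_sigma D i z); [exact: Zpsigma|exact: tgwc_XC]. Qed.

Lemma skewY i : skew (Y i).
Proof. by move=> z Zz; exists (tgw_sigmaV i z); [exact: ZpsigmaV|exact: tgwc_YC]. Qed.

Lemma skew1 : skew 1. Proof. by move=> z Zz; exists z => //; rewrite mul1r mulr1. Qed.

Lemma skewXw l : skew (Xw l).
Proof. by rewrite /Xw; elim/big_rec: _ => [|i x _]; [exact: skew1|apply: skewM; exact: skewX]. Qed.

Lemma skewYw l : skew (Yw l).
Proof. by rewrite /Yw; elim/big_rec: _ => [|i x _]; [exact: skew1|apply: skewM; exact: skewY]. Qed.

Lemma skew_zmul a x y : skew a -> zmul x y -> zmul (a * x) (a * y).
Proof. by move=> sa [z /sa [z' Zz' h] ->]; exists z' => //; rewrite mulrA h mulrA. Qed.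

Lemma first_split (i : 'I_n) l : i \in l -> exists l1 l2, l = l1 ++ i :: l2 /\ i \notin l1.
Proof.
elim: l => // j l IH; rewrite inE; case: (eqVneq i j) => [-> _|ij /= /IH [l1 [l2 [-> h]]]].
  by exists [::], l.
by exists (j :: l1), l2; rewrite inE negb_or ij.
Qed.

Lemma ldeg_cat l l' : ldeg (l ++ l') = ldeg l + ldeg l'. Proof. exact: big_cat. Qed.
Lemma ldeg_cons i l : ldeg (i :: l) = delta_mx 0 i + ldeg l. Proof. exact: big_cons. Qed.
Lemma Xw_cat l l' : Xw (l ++ l') = Xw l * Xw l'. Proof. exact: big_cat. Qed.
Lemma Yw_cat l l' : Yw (l ++ l') = Yw l * Yw l'. Proof. exact: big_cat. Qed.
Lemma Xw_cons i l : Xw (i :: l) = X i * Xw l. Proof. exact: big_cons. Qed.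
Lemma Yw_cons i l : Yw (i :: l) = Y i * Yw l. Proof. exact: big_cons. Qed.

(** No index occurs in both words: an [X i] facing a [Y i] is absorbed into the coefficient. *)
Inductive nform (d : 'rV[int]_n) : TGWC D mu -> Prop :=
| nform0 : nform d 0
| nform_cons z l r y : Zp z -> (forall i, i \in l -> i \notin r) -> d = ldeg r - ldeg l ->
    nform d y -> nform d (C z * (Yw l * Xw r) + y).

Lemma nformD d x y : nform d x -> nform d y -> nform d (x + y).
Proof.
elim=> [|z l r x' Zz dis dd _ IH] hy; first by rewrite add0r.
by rewrite -addrA; apply: nform_cons => //; apply: IH.
Qed.

Lemma nform_mem d x l r : zmul x (Yw l * Xw r) -> (forall i, i \in l -> i \notin r) ->
  d = ldeg r - ldeg l -> nform d x.
Proof. by move=> [z Zz ->] dis dd; rewrite -[C z * _]addr0; apply: nform_cons => //; constructor. Qed.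

Lemma nform_cst d z y : Zp z -> nform d y -> nform d (C z * y).
Proof.
move=> Zz; elim=> [|z' l r y' Zz' dis dd _ IH]; first by rewrite mulr0; constructor.
by rewrite mulrDr mulrA -tgwcM; apply: nform_cons => //; apply: ZpM.
Qed.

Lemma nform_skew d d' a y : skew a -> (forall l r, (forall i, i \in l -> i \notin r) ->
   d = ldeg r - ldeg l -> nform d' (a * (Yw l * Xw r))) -> nform d y -> nform d' (a * y).
Proof.
move=> sa h; elim=> [|z l r y' /sa [z' Zz' az] dis dd _ IH]; first by rewrite mulr0; constructor.
by rewrite mulrDr mulrA az -mulrA; apply: nformD => //; apply: nform_cst => //; apply: h.
Qed.

(** [X i] passes to the right up to the first [Y i], where [X i Y i = sigma_i(t_i)] moves back left
    into the coefficient; without a [Y i] it joins the word in the [X j]. *)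
Lemma nform_X d i y : nform d y -> nform (delta_mx 0 i + d) (X i * y).
Proof.
apply: nform_skew; first exact: skewX.
move=> l r dis dd; case: (boolP (i \in l)) => [/first_split [l1 [l2 [le il1]]]|il]; last first.
  apply: (@nform_mem _ _ l (i :: r)); last by rewrite dd ldeg_cons addrA.
    apply: scassoc_zmul; have := scassocM 1 (Xw r) (scassoc_XYw il).
    by rewrite !mul1r Xw_cons !mulrA.
  by move=> j jl; rewrite inE negb_or (dis j jl) andbT; apply: contraNneq il => <-.
apply: (@nform_mem _ _ (l1 ++ l2) r).
- apply: (@zmul_trans (Yw l1 * (X i * Y i) * Yw l2 * Xw r)).
    apply: scassoc_zmul; have := scassocM 1 (Y i * Yw l2 * Xw r) (scassoc_XYw il1).
    by rewrite !mul1r le Yw_cat Yw_cons !mulrA.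
  rewrite -[X in zmul X]mulrA -[X in zmul X]mulrA Yw_cat -[X in zmul _ X]mulrA.
  apply: skew_zmul; first exact: skewYw.
  by exists (tgw_sigma D i (tgw_t D i)); [exact: Zpsigma|rewrite tgwcXY].
- by move=> j; rewrite mem_cat => /orP jl; apply: dis; rewrite le mem_cat inE; case: jl => ->; rewrite ?orbT.
by rewrite dd le !ldeg_cat ldeg_cons addrCA !opprD; congr (_ + _); rewrite addrCA; congr (_ + _); rewrite addrA subrr add0r.
Qed.

(** If [X i] occurs in [r], then [Y i] does not occur in [l]. Up to scalars, the words between [Y i]
    and the first [X i] can be moved out, and [Y i X i = t_i] is absorbed. *)
Lemma nform_Y d i y : nform d y -> nform (- delta_mx 0 i + d) (Y i * y).
Proof.
apply: nform_skew; first exact: skewY.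
move=> l r dis dd; case: (boolP (i \in r)) => [ir|ir]; last first.
  apply: (@nform_mem _ _ (i :: l) r); last by rewrite dd ldeg_cons opprD addrCA.
    by apply: scassoc_zmul; rewrite Yw_cons mulrA; exact: scassoc_refl.
  by move=> j; rewrite inE => /orP [/eqP ->|/dis].
have il : i \notin l by apply/negP => /dis; rewrite ir.
have [r1 [r2 [re ir1]]] := first_split ir.
have dis1 j : j \in l -> j \notin r1.
  by move=> /dis; rewrite re mem_cat negb_or => /andP [].
apply: (@nform_mem _ _ l (r1 ++ r2)).
- apply: (@zmul_trans (Y i * Xw r1 * (Yw l * (X i * Xw r2)))).
    apply: scassoc_zmul; have := scassocM (Y i) (X i * Xw r2) (scassoc_sym (scassoc_XwYw dis1)).
    by rewrite re Xw_cat Xw_cons !mulrA.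
  apply: (@zmul_trans (Xw r1 * Y i * (X i * Yw l) * Xw r2)).
    apply: scassoc_zmul; apply: (@scassoc_trans (Xw r1 * Y i * (Yw l * (X i * Xw r2)))).
      by have := scassocM 1 (Yw l * (X i * Xw r2)) (scassoc_sym (scassoc_XwY ir1)); rewrite !mul1r.
    by have := scassocM (Xw r1 * Y i) (Xw r2) (scassoc_sym (scassoc_XYw il)); rewrite !mulrA.
  apply: (@zmul_trans (Xw r1 * Yw l * Xw r2)).
    apply: zmulM; rewrite -mulrA; apply: skew_zmul; first exact: skewXw.
    by exists (tgw_t D i); rewrite ?Zpt // mulrA tgwcYX.
  by apply: scassoc_zmul; have := scassocM 1 (Xw r2) (scassoc_XwYw dis1); rewrite !mul1r Xw_cat !mulrA.
- by move=> j /dis; rewrite re !mem_cat inE !negb_or => /and3P [-> _ ->].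
by rewrite dd re !ldeg_cat ldeg_cons [ldeg r1 + (_ + _)]addrCA !addrA addNr add0r.
Qed.

Lemma nformM d d' x y : nform d x -> nform d' y -> nform (d + d') (x * y).
Proof.
move=> + hy; elim=> [|z l r x' Zz _ -> _ IH]; first by rewrite mul0r; constructor.
rewrite mulrDl; apply: nformD => //; rewrite -mulrA; apply: nform_cst => //.
have hX : nform (ldeg r + d') (Xw r * y).
  elim: r {IH} => [|i r IHr]; first by rewrite /ldeg /Xw !big_nil mul1r add0r.
  by rewrite ldeg_cons Xw_cons -mulrA -addrA; apply: nform_X.
rewrite -mulrA addrAC addrC.
elim: l {IH} => [|i l IHl]; first by rewrite /ldeg /Yw !big_nil mul1r oppr0 add0r.
by rewrite ldeg_cons Yw_cons -mulrA opprD -addrA; apply: nform_Y.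
Qed.

Inductive zhomog : 'rV[int]_n -> TGWC D mu -> Prop :=
| zh_cst r : Zp r -> zhomog 0 (C r)
| zh_X i : zhomog (delta_mx 0 i) (X i)
| zh_Y i : zhomog (- delta_mx 0 i) (Y i)
| zh_0 d : zhomog d 0
| zh_D d x y : zhomog d x -> zhomog d y -> zhomog d (x + y)
| zh_M d d' x y : zhomog d x -> zhomog d' y -> zhomog (d + d') (x * y).

Lemma Zp1 : Zp 1. Proof. by rewrite -[1]scale1r; apply: ZpA. Qed.

Lemma zhomog_nform d y : zhomog d y -> nform d y.
Proof.
elim=> {d y} [r Zr|i|i|d|d x y _ hx _ hy|d d' x y _ hx _ hy].
- apply: (@nform_mem _ _ [::] [::]) => //; last by rewrite subrr.
  by exists r => //; rewrite /Yw /Xw !big_nil !mulr1.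
- apply: (@nform_mem _ _ [::] [:: i]) => //; last by rewrite /ldeg big_seq1 big_nil subr0.
  by exists 1; [exact: Zp1|rewrite /Yw /Xw big_nil big_seq1 tgwc1 !mul1r].
- apply: (@nform_mem _ _ [:: i] [::]) => //; last by rewrite /ldeg big_seq1 big_nil sub0r.
  by exists 1; [exact: Zp1|rewrite /Yw /Xw big_nil big_seq1 tgwc1 mul1r mulr1].
- by constructor.
- exact: nformD.
exact: nformM.
Qed.

Lemma ldegE l i : ldeg l 0 i = (count_mem i l)%:Z.
Proof.
elim: l => [|j l IH]; first by rewrite /ldeg big_nil mxE.
by rewrite ldeg_cons mxE IH mxE eqxx /= PoszD eq_sym; case: (_ == _).
Qed.

(** In degree zero the two words of a normal form contain each index equally often and share none,
    so both are empty. *)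
Lemma zhomog0 y : zhomog 0 y -> exists2 z, Zp z & y = C z.
Proof.
move=> /zhomog_nform; elim=> [|z l r y' Zz dis dd _ [z' Zz' ->]].
  by exists 0; [rewrite -(scale0r 1); apply: ZpA|].
have cnt i : count_mem i r = count_mem i l.
  have /rowP /(_ i) := dd; rewrite !mxE !ldegE => /eqP; rewrite eq_sym subr_eq0.
  by move=> /eqP [].
have l0 : l = [::].
  case: l dis cnt {dd} => // i l dis cnt.
  have := dis i (mem_head _ _); rewrite -has_pred1 has_count cnt /= eqxx //.
have r0 : r = [::].
  case: r cnt {dis dd} => // i r /(_ i); rewrite l0 /= eqxx //.
exists (z + z'); first exact: ZpD.
by rewrite l0 r0 /Yw /Xw !big_nil !mulr1 tgwcD.
Qed.
End NormalForm.

(** * Recognizing [A] as a TGW algebra *)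

Section TGWIso.
Variables (k : closedFieldType) (L : lieAlgebra k) (n : nat) (e f : 'I_n -> L).
Variable S : primitive_quotient e f.
Notation A := (pq_ring S).
Notation sc := (pq_sc S).
Notation E := (pqE S).
Notation F := (pqF S).
Notation hdeg := (@hdeg _ _ _ _ _ S).
Variables (D : tgw_datum k n) (mu : 'I_n -> 'I_n -> k).
Notation R := (tgw_ring D).
Variable rho : {rmorphism R -> A}.
Hypothesis mu0 : forall i j, i != j -> mu i j != 0.
Hypothesis rhoA : forall c, rho c%:A = sc c.
Hypothesis rho_hdeg : forall r, hdeg 0 (rho r).
Hypothesis rhoE : forall i r, E i * rho r = rho (tgw_sigma D i r) * E i.
Hypothesis rhoF : forall i r, F i * rho r = rho (tgw_sigmaV i r) * F i.
Hypothesis rhoFE : forall i, F i * E i = rho (tgw_t D i).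
Hypothesis rhoEF : forall i, E i * F i = rho (tgw_sigma D i (tgw_t D i)).
Hypothesis rhomu : forall i j, i != j -> E i * F j = sc (mu i j) * (F j * E i).
(** Only the image of [r] in [C_mu] has to vanish: for the trivial module [rho] is not injective. *)
Hypothesis rho_ker : forall r, rho r = 0 -> tgwc_cst mu r = 0.
Hypothesis gfaith : forall d a, hdeg d a -> a <> 0 -> exists2 y, hdeg (- d) y & y * a <> 0.

Lemma tgwc_dec (x : TGWC D mu) : exists s : seq ('rV[int]_n * TGWC D mu),
  (forall p, p \in s -> tgwc_homog p.1 p.2) /\ x = \sum_(p <- s) p.2.
Proof.
have one d b : tgwc_homog d b -> exists s : seq ('rV[int]_n * TGWC D mu),
    (forall p, p \in s -> tgwc_homog p.1 p.2) /\ b = \sum_(p <- s) p.2.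
  by move=> h; exists [:: (d, b)]; rewrite big_seq1; split=> // p; rewrite inE => /eqP->.
elim/TGWC_ind: x => [c|i|i|a b [s [sh ->]] [t [th ->]]|a b [s [sh ->]] [t [th ->]]].
- by apply: one; constructor.
- by apply: one; constructor.
- by apply: one; constructor.
- exists (s ++ t); rewrite big_cat; split=> // p; rewrite mem_cat => /orP []; [exact: sh|exact: th].
exists [seq (p.1 + q.1, p.2 * q.2) | p <- s, q <- t]; split.
  by move=> _ /allpairsP [[p q] /= [ps qt ->]]; apply: homog_M; [apply: sh|apply: th].
rewrite big_allpairs_dep mulr_suml; apply: eq_bigr => p _; by rewrite mulr_sumr.
Qed.

Lemma tgwc_homog0 (y : TGWC D mu) : tgwc_homog 0 y -> exists r, y = tgwc_cst mu r.
Proof.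
move=> hy; have [//|//|//|//|//|//||z _ ->] := @zhomog0 k n D mu mu0 (fun=> True) _ _ _ _ _ _ y; last by exists z.
elim: hy => [r|i|i|d|d a b _ ha _ hb|d d' a b _ ha _ hb]; by constructor.
Qed.

(** The relations give a surjection from [C_mu] onto [A] whose kernel is precisely the union of the
    graded ideals that meet degree zero trivially; [psi] inverts the induced bijection. *)
Lemma tgw_iso : exists psi : A -> TGWA D mu,
  [/\ (forall a b, psi (a + b) = psi a + psi b) /\ (forall a b, psi (a * b) = psi a * psi b),
      psi 1 = 1 /\ forall c, psi (sc c) = tgwa_cst mu (c%:A : R),
      forall i, psi (E i) = tgwa_X D mu i /\ psi (F i) = tgwa_Y D mu i,
      forall a, psi a = 0 -> a = 0 & forall y, exists a, psi a = y].
Proof.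
pose g (x : 'I_n + 'I_n) : A := match x with inl i => E i | inr i => F i end.
have [|||thC thCE] := @quot_lift _ (@tgwc_rel _ _ D mu) A (feval rho g).
- exact: fevalD.
- exact: fevalM.
- move=> _ [i r|i r|i|i|i j ij]; rewrite fevalD fevalN !fevalM ?feval_cst !feval_gen /=.
  + by rewrite rhoE subrr.
  + by rewrite rhoF subrr.
  + by rewrite rhoFE subrr.
  + by rewrite rhoEF subrr.
  by rewrite rhoA rhomu // subrr.
have thD a b : thC (a + b) = thC a + thC b.
  by have [x ->] := quot_onto a; have [y ->] := quot_onto b; rewrite -quot_piD !thCE fevalD.
have thM a b : thC (a * b) = thC a * thC b.
  by have [x ->] := quot_onto a; have [y ->] := quot_onto b; rewrite -quot_piM !thCE fevalM.
have thc r : thC (tgwc_cst mu r) = rho r by rewrite thCE feval_cst.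
have thX i : thC (tgwc_X D mu i) = E i by rewrite thCE feval_gen.
have thY i : thC (tgwc_Y D mu i) = F i by rewrite thCE feval_gen.
have th0 : thC 0 = 0 by rewrite -[0]/(tgwc_cst mu (0 : R)) thc rmorph0.
have thS (I : Type) (r : seq I) (P : pred I) (h : I -> TGWC D mu) :
    thC (\sum_(i <- r | P i) h i) = \sum_(i <- r | P i) thC (h i).
  by elim/big_rec2: _ => // i x y _ <-.
have homD d y : tgwc_homog d y -> hdeg d (thC y).
  elim=> {d y} [r|i|i|d|d x y _ hx _ hy|d d' x y _ hx _ hy].
  - by rewrite thc.
  - by rewrite thX; constructor.
  - by rewrite thY; constructor.
  - by rewrite th0; constructor.
  - by rewrite thD; constructor.
  by rewrite thM; constructor.
have homE d a : hdeg d a -> exists2 y, tgwc_homog d y & thC y = a.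
  elim=> {d a} [c|i|i|d|d x y _ [x' hx <-] _ [y' hy <-]|d d' x y _ [x' hx <-] _ [y' hy <-]].
  - by exists (tgwc_cst mu c%:A); [constructor|rewrite thc rhoA].
  - by exists (tgwc_X D mu i); [constructor|].
  - by exists (tgwc_Y D mu i); [constructor|].
  - by exists 0; [constructor|].
  - by exists (x' + y'); [constructor|].
  by exists (x' * y'); [constructor|].
(* A homogeneous element of such an ideal with nonzero image would have, by [gfaith], a multiple of
   degree zero with nonzero image, yet that multiple is zero. *)
have rel0 x : tgwa_rel x -> thC x = 0.
  move=> [I [[[I0 ID IM] gr] I00 Ix]].
  have [s [-> sI]] := gr x Ix; rewrite thS big_seq big1 // => y /sI [Iy [d hy]].
  apply: contrapT => yN; have [a ha] := gfaith (homD _ _ hy) yN; apply.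
  have [z hz <-] := homE _ _ ha; rewrite -thM (I00 (z * y)) ?th0 //; first exact: (IM z y Iy).1.
  by rewrite -(addNr d); apply: homog_M.
(* Conversely the kernel is graded, and its elements of degree zero are constants killed by [rho],
   hence zero in [C_mu]. *)
have ker0 x : thC x = 0 -> tgwa_rel x.
  move=> x0; exists (fun x => thC x = 0); split=> //; last first.
    by move=> y y0 /tgwc_homog0 [r yr]; rewrite yr in y0 *; apply: rho_ker; rewrite -thc.
  split; first split=> //.
  - by move=> a b a0 b0; rewrite thD a0 b0 addr0.
  - by move=> a b b0; rewrite !thM b0 mulr0 mul0r.
  move=> y y0; have [s [sh sE]] := tgwc_dec y.
  exists [seq \sum_(p <- s | p.1 == d) p.2 | d <- undup [seq p.1 | p <- s]]; split.
    by rewrite big_map -sum_by_degree.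
  move=> _ /mapP [d _ ->]; split; last first.
    exists d; rewrite big_seq_cond; elim/big_rec: _ => [|p z /andP [ps /eqP <-] hz]; first by constructor.
    by apply: homog_D => //; apply: sh.
  rewrite thS.
  have := @hdeg_sep _ _ _ _ _ S [seq (p.1, thC p.2) | p <- s]; rewrite big_map => h.
  have := h _ _ d; rewrite big_map; apply=> [_ /mapP [p ps ->]|]; first by apply/homD/sh.
  by rewrite -thS -sE.
have [th thE] := @quot_lift _ (@tgwa_rel _ _ D mu) A thC thD thM rel0.
have thinj p q : th p = th q -> p = q.
  have [a ->] := quot_onto p; have [b ->] := quot_onto q; rewrite !thE => ab.
  apply: quot_pi_rel; apply: ker0; rewrite thD ab.
  have := thD (- b) b; rewrite addNr th0 => /esym h.
  by rewrite addrC h.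
have thAD p q : th (p + q) = th p + th q.
  by have [a ->] := quot_onto p; have [b ->] := quot_onto q; rewrite -quot_piD !thE thD.
have thAM p q : th (p * q) = th p * th q.
  by have [a ->] := quot_onto p; have [b ->] := quot_onto q; rewrite -quot_piM !thE thM.
have onto a : exists p, th p = a.
  have [s [sh ->]] := hdeg_dec a.
  elim: s sh => [|p s IH] sh; first by exists 0; rewrite big_nil -[0]/(quot_pi (@tgwa_rel _ _ D mu) 0) thE.
  have [q qE] := IH (fun q qs => sh q (mem_behead (s := p :: s) qs)).
  have [y _ yE] := homE _ _ (sh p (mem_head _ _)).
  by exists (quot_pi _ y + q); rewrite thAD thE yE qE big_cons.
have /choice [psi psiE] := onto.
have psiK p : psi (th p) = p by apply: thinj; rewrite psiE.
exists psi; split; first by split=> a b; apply: thinj; rewrite ?thAD ?thAM !psiE.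
- split=> [|c]; apply: thinj; rewrite psiE; last by rewrite thE thc rhoA.
  by rewrite -[X in th X]/(quot_pi (@tgwa_rel _ _ D mu) (tgwc_cst mu (1 : R))) thE thc rmorph1.
- by move=> i; split; apply: thinj; rewrite psiE thE.
- move=> a pa; rewrite -(psiE a) pa -[0]/(quot_pi (@tgwa_rel _ _ D mu) 0) thE //.
by move=> y; exists (th y).
Qed.
End TGWIso.

Definition tgw_realizable (k : closedFieldType) (L : lieAlgebra k) (n : nat) (e f : 'I_n -> L)
    (S : primitive_quotient e f) : Prop :=
  exists (D : tgw_datum k n) (mu : 'I_n -> 'I_n -> k) (psi : pq_ring S -> TGWA D mu),
  (forall i j, i != j -> mu i j != 0) /\
  [/\ (forall a b, psi (a + b) = psi a + psi b) /\ (forall a b, psi (a * b) = psi a * psi b),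
      psi 1 = 1 /\ forall c, psi (pq_sc S c) = tgwa_cst mu (c%:A : tgw_ring D),
      forall i, psi (pqE S i) = tgwa_X D mu i /\ psi (pqF S i) = tgwa_Y D mu i,
      forall a, psi a = 0 -> a = 0 & forall y, exists a, psi a = y].

(** * The TGW datum in the regular case *)

Section RegularTGW.
Variables (k : closedFieldType) (L : lieAlgebra k) (n : nat) (e f : 'I_n -> L).
Variable S : primitive_quotient e f.
Notation A := (pq_ring S).
Notation sc := (pq_sc S).
Notation E := (pqE S).
Notation F := (pqF S).
Notation hdeg := (@hdeg _ _ _ _ _ S).
Notation regular := (@regular _ _ _ _ _ S).
Notation ev := (@ev _ _ _ _ _ S).
Hypothesis comm0 : forall a b, hdeg 0 a -> hdeg 0 b -> a * b = b * a.
Hypothesis regE : forall i, regular (E i).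
Hypothesis regF : forall i, regular (F i).

HB.instance Definition _ := GRing.isZmodMorphism.Build {mpoly k[n]} A ev (@evB _ _ _ _ _ S).

Lemma ev_monoid : monoid_morphism ev.
Proof. by split=> [|p q]; [rewrite -mpolyC1 evC rmorph1|rewrite evM]. Qed.

HB.instance Definition _ := GRing.isMonoidMorphism.Build {mpoly k[n]} A ev ev_monoid.

(** [E i] raises the [i]-th coordinate of a weight by one, so a polynomial that moves to its left
    must be evaluated one step back. *)
Definition shift_sigma (i : 'I_n) : {lrmorphism {mpoly k[n]} -> {mpoly k[n]}} :=
  comp_mpoly [tuple 'X_j + ((- delta_mx 0 i : 'rV[k]_n) 0 j)%:MP | j < n].

Lemma regular_tgw : tgw_realizable S.
Proof.
have hFE i : hdeg 0 (F i * E i).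
  by rewrite -(addNr (delta_mx 0 i)); apply: hg_M; constructor.
have /choice [T TE] i : exists T, ev T = F i * E i by apply: (ev_onto comm0 regE regF).
have T0 i : T i != 0.
  apply/negP => /eqP T0; have := TE i; rewrite T0 -mpolyC0 evC rmorph0 => /esym /(regF i _).1.
  rewrite -[pqE S i]mulr1 => /(regE i _).1 /eqP; by rewrite oner_eq0.
have sK i : cancel (shift_sigma i) (mshift (delta_mx 0 i)).
  by move=> p; have := mshiftD (delta_mx 0 i) (- delta_mx 0 i) p; rewrite subrr mshift0.
have sVK i : cancel (mshift (delta_mx 0 i)) (shift_sigma i).
  by move=> p; have := mshiftD (- delta_mx 0 i) (delta_mx 0 i) p; rewrite addNr mshift0.
pose D := TGWDatum sK sVK T0 (fun i r => mulrC (T i) r).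
have evE i (r : {mpoly k[n]}) : E i * ev r = ev (shift_sigma i r) * E i.
  rewrite -{1}[r](sK i) (ev_shift _ (hg_E S i)); congr (_ * ev _).
  by rewrite wt_delta.
have evF i (r : {mpoly k[n]}) : F i * ev r = ev (mshift (delta_mx 0 i) r) * F i.
  rewrite -{1}[r](sVK i) (ev_shift _ (hg_F S i)); congr (_ * ev _).
  by rewrite wtN wt_delta.
exists D, (fun _ _ => 1).
have [||||||||||psi psiP] := @tgw_iso k L n e f S D (fun _ _ => 1) ev.
- by move=> i j _; apply: oner_neq0.
- by move=> c; rewrite -[c%:A]mul_mpolyC mulr1; apply: evC.
- exact: hdeg_ev.
- exact: evE.
- exact: evF.
- by move=> i; apply/esym; exact: TE.
- move=> i; apply/subr0_eq; apply: (regE i _).2; rewrite mulrBl.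
  by rewrite -[X in _ - X]evE /= TE mulrA subrr.
- by move=> i j ij; rewrite rmorph1 mul1r pqEF.
- by move=> r /(ev_eq0 regE) ->.
- move=> d a ha aN; have [y hy ry] := regular_homog regE regF (- d); exists y => //.
  by move=> /(ry _).1.
by exists psi; split=> // i j _; apply: oner_neq0.
Qed.
End RegularTGW.

(** * The case where some e_i or f_i is nilpotent *)

Section Split.
Variables (k : fieldType) (A : pzRingType) (sc : {rmorphism k -> A}).
Hypothesis scC : forall c a, sc c * a = a * sc c.
Implicit Types (h x y z u : A) (s : seq k).

Definition hprod h s : A := \prod_(c <- s) (h - sc c).
(** Algebraicity over [k]. Repeated roots are harmless: only joint eigenvectors and the finiteness
    of the set of weights are drawn from it. *)
Definition split_elt h := exists s, hprod h s = 0.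

Lemma hprod_cons h c s : hprod h (c :: s) = (h - sc c) * hprod h s.
Proof. exact: big_cons. Qed.

Lemma hprod_cat h s t : hprod h (s ++ t) = hprod h s * hprod h t.
Proof. exact: big_cat. Qed.

Lemma hprodN h s : hprod h [seq - c | c <- s] = (-1) ^+ size s * hprod (- h) s.
Proof.
elim: s => [|c s IH]; first by rewrite /hprod !big_nil mulr1.
rewrite /= !hprod_cons IH exprS mulN1r !mulrA; congr (_ * _).
have -> : h - sc (- c) = - (- h - sc c) by rewrite rmorphN opprK opprB opprK addrC.
by rewrite !mulNr commr_sign.
Qed.

Lemma hlinC h c c' : (h - sc c) * (h - sc c') = (h - sc c') * (h - sc c).
Proof.
have cm : GRing.comm (h - sc c) (h - sc c').
  apply: commrB; first by apply/commr_sym/commrB => //; apply/commr_sym => //; apply: scC.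
  by apply/commr_sym; apply: scC.
exact: cm.
Qed.

Lemma hlin_shift h z b c : h * z - z * h = sc b * z -> (h - sc c) * z = z * (h - sc (c - b)).
Proof.
move=> hz; rewrite mulrBl mulrBr -(scC (c - b)) rmorphB mulrBl opprB -hz.
by rewrite [_ - _ - _]addrAC addrCA [z * h + _]addrC !addrA subrK.
Qed.

Lemma hprod_shift h z b s : h * z - z * h = sc b * z ->
  hprod h s * z = z * hprod h [seq c - b | c <- s].
Proof.
move=> hz; elim: s => [|c s IH]; first by rewrite /hprod !big_nil mulr1 mul1r.
by rewrite /= !hprod_cons -mulrA IH mulrA (hlin_shift _ hz) mulrA.
Qed.

Lemma hprod_shift_iter h z b m s : h * z - z * h = sc b * z ->
  hprod h s * z ^+ m = z ^+ m * hprod h [seq c - m%:R * b | c <- s].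
Proof.
move=> hz; elim: m s => [|m IH] s.
  by rewrite expr0 mulr1 mul1r; congr hprod; rewrite (eq_map (g := id)) ?map_id // => c; rewrite mul0r subr0.
rewrite exprS mulrA (hprod_shift _ hz) -mulrA IH mulrA -map_comp; congr (_ * hprod h _).
by apply: eq_map => c /=; rewrite mulrS mulrDl mul1r opprD addrA.
Qed.

Lemma hprod_div h b s : exists g, hprod h s = (h - sc b) * g + sc (\prod_(c <- s) (b - c)).
Proof.
elim: s => [|c s [g IH]]; first by exists 0; rewrite /hprod !big_nil mulr0 add0r rmorph1.
exists ((h - sc c) * g + sc (\prod_(c <- s) (b - c))); rewrite hprod_cons IH big_cons.
rewrite mulrDr mulrA hlinC -mulrA mulrDr -addrA; congr (_ + _).
by rewrite rmorphM -mulrDl rmorphB addrA subrK.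
Qed.

Lemma hlin_inv h b s : hprod h s = 0 -> b \notin s -> exists g, (h - sc b) * g = 1.
Proof.
move=> h0 bs; have [g hg] := hprod_div h b s.
have p0 : \prod_(c <- s) (b - c) != 0.
  rewrite prodf_seq_neq0; apply/allP => c cs /=; rewrite subr_eq0.
  by apply: contraNneq bs => ->.
exists (g * sc (- (\prod_(c <- s) (b - c))^-1)); rewrite mulrA.
have -> : (h - sc b) * g = sc (- \prod_(c <- s) (b - c)).
  by apply/eqP; rewrite rmorphN -addr_eq0 -hg h0.
by rewrite -rmorphM mulrNN mulfV ?rmorph1.
Qed.

Lemma hprod_inv h s t : hprod h s = 0 -> (forall b, b \in t -> b \notin s) ->
  exists g, hprod h t * g = 1.
Proof.
move=> h0; elim: t => [|b t IH] dis; first by exists 1; rewrite /hprod big_nil mulr1.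
have [g hg] := hlin_inv h0 (dis b (mem_head _ _)).
have [c ct|g' hg'] := IH; first by apply: dis; rewrite inE ct orbT.
by exists (g' * g); rewrite hprod_cons mulrA -[_ * _ * g']mulrA hg' mulr1.
Qed.

(** Passing [z ^ m] through the product of linear factors translates the roots by [m b]. When they
    are disjoint from the old roots, the translated product is invertible, and it is killed by
    [z ^ m]. *)
Lemma split_nilpotent h z b : [pchar k] =i pred0 -> b != 0 -> h * z - z * h = sc b * z ->
  split_elt h -> exists m, z ^+ m = 0.
Proof.
move=> ch b0 hz [s h0].
(* Avoiding these quotients is what makes the two sets of roots disjoint. *)
have [m mP] := natr_notin_pchar0 [seq (c - c') / b | c <- s, c' <- s] ch.
have [|g hg] := @hprod_inv h s [seq c - m%:R * b | c <- s] h0.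
  move=> _ /mapP [c cs ->]; apply: contra mP => c's; apply/allpairsP.
  exists (c, c - m%:R * b); split=> //=; by rewrite opprB addrC subrK mulfK.
exists m; rewrite -[z ^+ m]mulr1 -hg mulrA -(hprod_shift_iter _ _ hz) h0.
by rewrite !mul0r.
Qed.

Section SL2.
Variables (x y h : A).
Hypothesis hE : h = x * y - y * x.
Hypothesis hx : h * x - x * h = sc 2%:R * x.
Hypothesis hy : h * y - y * h = sc (- 2%:R) * y.

Lemma sl2_ef m u : x * u = 0 ->
  x * (y ^+ m.+1 * u) = sc m.+1%:R * (y ^+ m * ((h - sc m%:R) * u)).
Proof.
move=> xu.
have xy : x * y = y * x + h by rewrite hE addrC subrK.
elim: m => [|m IH].
  by rewrite expr1 expr0 mul1r rmorph0 subr0 rmorph1 mul1r mulrA xy mulrDl -mulrA xu mulr0 add0r.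
rewrite exprS -mulrA mulrA xy mulrDl -mulrA IH.
have hym : h * (y ^+ m.+1 * u) = y ^+ m.+1 * ((h - sc (m.+1%:R * 2%:R)) * u).
  have := hprod_shift_iter m.+1 [:: 0] hy; rewrite /hprod /= !big_seq1 rmorph0 subr0.
  by rewrite !mulrA => ->; rewrite mulrN sub0r opprK.
rewrite hym.
rewrite [y * (sc _ * _)]mulrA -scC -[sc _ * y * _]mulrA [y * (y ^+ m * _)]mulrA -exprS.
rewrite [sc m.+1%:R * (y ^+ _ * _)]mulrA scC -mulrA -mulrDr [RHS]mulrA [sc m.+2%:R * _]scC -mulrA; congr (_ * _).
rewrite !mulrA -mulrDl; congr (_ * u).
rewrite mulrBr -rmorphM addrACA -opprD -rmorphD mulrBr -rmorphM.
have -> : sc m.+1%:R * h + h = sc m.+2%:R * h by rewrite -{2}[h]mul1r -(rmorph1 sc) -mulrDl -rmorphD -mulrSr.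
congr (_ - sc _); rewrite -mulrDr -!natrM -natrD -natrM; congr (_%:R); lia.
Qed.

Lemma sl2_eeff m u : x * u = 0 ->
  x ^+ m * (y ^+ m * u) = sc (m`!)%:R * (hprod h [seq i%:R | i <- iota 0 m] * u).
Proof.
elim: m u => [|m IH] u xu; first by rewrite !expr0 !mul1r rmorph1 /hprod big_nil !mul1r.
rewrite exprSr -mulrA (sl2_ef m xu) mulrA -scC -mulrA IH; last first.
  have := hlin_shift (m%:R + 2%:R) hx; rewrite addrK => h1.
  by rewrite mulrA -h1 -mulrA xu mulr0.
rewrite mulrA -rmorphM -natrM -factS; congr (_ * _).
rewrite -addn1 iotaD map_cat hprod_cat mulrA; congr (_ * _ * u).
by rewrite /hprod big_seq1 add0n.
Qed.

(** If [x u = 0], then [x ^ N y ^ N u = 0] shows that [h (h - 1) ... (h - N + 1)] kills [u].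
    Translates of this product treat [x ^ p u = 0] for growing [p]; then take [p = N] and
    [u = 1]. *)
Lemma sl2_split N : [pchar k] =i pred0 -> x ^+ N = 0 -> split_elt h.
Proof.
move=> ch xN.
have H p : exists s, forall u, x ^+ p * u = 0 -> hprod h s * u = 0.
  elim: p => [|p [s IH]]; first by exists [::] => u; rewrite expr0 mul1r => ->; rewrite mulr0.
  exists (s ++ [seq c - p%:R * 2%:R | c <- [seq i%:R | i <- iota 0 N]]) => u xpu.
  rewrite hprod_cat -mulrA; apply: IH.
  rewrite mulrA -(hprod_shift_iter _ _ hx) -mulrA.
  have xu : x * (x ^+ p * u) = 0 by rewrite mulrA -exprS.
  have := sl2_eeff N xu; rewrite xN mul0r => /esym h0.
  have f0 : (N`!)%:R != 0 :> k by rewrite ((pcharf0P k).1 ch) -lt0n fact_gt0.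
  set Z := (X in sc _ * X = 0) in h0.
  rewrite -/Z; have -> : Z = sc (N`!)%:R^-1 * (sc (N`!)%:R * Z) by rewrite mulrA -rmorphM mulVf // rmorph1 mul1r.
  by rewrite h0 mulr0.
have [s sP] := H N; exists s; rewrite -[hprod h s]mulr1; apply: sP.
by rewrite xN mul0r.
Qed.
End SL2.
End Split.

(** * Propagation along the Dynkin diagram *)

Section NilpotentCase.
Variables (k : closedFieldType) (L : lieAlgebra k) (n : nat) (e f : 'I_n -> L).
Variable S : primitive_quotient e f.
Notation A := (pq_ring S).
Notation sc := (pq_sc S).
Notation E := (pqE S).
Notation F := (pqF S).
Notation H := (pqH S).
Notation B := (pqB S).
Let scC : forall c (a : A), sc c * a = a * sc c := @pq_scC _ _ _ _ _ S.

Lemma coroot_neq0 i : coroot e f i != 0.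
Proof.
have [[_ fr] _ _ _ _] := pqCP S; apply/negP => /eqP c0.
have : coroot e f i \in coroots e f by apply: map_f; rewrite mem_enum.
by rewrite c0 => /(free_not0 fr); rewrite eqxx.
Qed.

(** Let [V] be the centralizer of the [e_j], [f_j] outside [P]. It contains the [e_i], [f_i] inside
    [P] by the Serre relations, and all generators normalize it. So it is a nonzero ideal, hence
    everything, and [h_j = 0] for some [j] outside [P], which is absurd. *)
Lemma dynkin_connected (P : 'I_n -> Prop) : (exists i, P i) ->
  (forall i j, P i -> B i j != 0 -> P j) -> forall j, P j.
Proof.
move=> [i0 Pi0] adjP j0; apply: contrapT => nPj0.
have [_ [_ ef] _ ser gen] := pqCP S.
have br0 (x : L) : lie_br x 0 = 0.
  by have /eqP := lie_linr x 1 0 0; rewrite !scale1r addr0 -subr_eq subrr eq_sym => /eqP.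
have brD (x y z : L) : lie_br x (y + z) = lie_br x y + lie_br x z.
  by have := lie_linr x 1 y z; rewrite !scale1r.
have br0l (x : L) : lie_br 0 x = 0 by rewrite lie_skew br0 oppr0.
have B0 i j : P i -> ~ P j -> pqC S i j = 0.
  move=> Pi nPj; apply: (intr_inj_pchar0 (pq_pchar0 S)) => /=.
  apply: contrapT => /eqP h; apply: nPj; apply: (adjP i) => //; by rewrite mxE.
pose Q (x : L) := forall j, ~ P j -> lie_br x (e j) = 0 /\ lie_br x (f j) = 0.
have [||V VP] := @vspace_of_pred _ L Q.
- by move=> j _; rewrite !br0l.
- move=> a x y Qx Qy j nPj; have [x1 x2] := Qx j nPj; have [y1 y2] := Qy j nPj.
  by rewrite !lie_linl x1 x2 y1 y2 !scaler0 addr0.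
have jac (x y z : L) : lie_br x z = 0 -> lie_br y z = 0 -> lie_br (lie_br x y) z = 0.
  move=> xz yz; have := lie_jacobi x y z.
  rewrite yz br0 (lie_skew z x) xz oppr0 br0 !add0r => zxy.
  by rewrite lie_skew zxy oppr0.
have VE i : P i -> e i \in V /\ f i \in V.
  move=> Pi; have ne j : ~ P j -> i != j by move=> nPj; apply/eqP => ij; apply: nPj; rewrite -ij.
  split; apply/VP => j nPj; have [] := ser i j (ne j nPj); rewrite (B0 i j Pi nPj) subr0 /= => ee ff.
    by rewrite ee ef // ne.
  by rewrite ff lie_skew ef 1?eq_sym ?ne // oppr0.
have VB x y : x \in V -> y \in V -> lie_br x y \in V.
  move=> /VP Qx /VP Qy; apply/VP => j nPj; have [x1 x2] := Qx j nPj; have [y1 y2] := Qy j nPj.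
  by split; apply: jac.
(* [U] is the normalizer of [V], a subalgebra; it contains every generator, since those outside [P]
   even commute with [V]. *)
have [||U UP] := @vspace_of_pred _ L (fun y => forall x, x \in V -> lie_br y x \in V).
- by move=> x _; rewrite br0l mem0v.
- by move=> a y z hy hz x xV; rewrite lie_linl memvD ?memvZ ?hy ?hz.
have UT : U = fullv.
  apply: gen => [i|y z /UP hy /UP hz].
    case: (pselect (P i)) => [/VE [eV fV]|nPi].
      by split; apply/UP => x xV; apply: VB.
    split; apply/UP => x /VP /(_ i nPi) [x1 x2]; rewrite lie_skew.
      by rewrite x1 oppr0 mem0v.
    by rewrite x2 oppr0 mem0v.
  apply/UP => x xV.
  have -> : lie_br (lie_br y z) x = lie_br y (lie_br z x) - lie_br z (lie_br y x).
    have /eqP := lie_jacobi y z x; rewrite addr_eq0 => /eqP h.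
    rewrite (lie_skew (lie_br y z) x) -h (lie_skew x y).
    have -> : lie_br z (- lie_br y x) = - lie_br z (lie_br y x); last by [].
    by apply/eqP; rewrite -addr_eq0 -brD addNr br0.
  by rewrite memvB ?hy ?hz ?hz ?hy.
have ideal x y : y \in V -> lie_br x y \in V by move=> yV; apply: (UP x).1 => //; rewrite UT memvf.
have [_ /(_ V ideal) [V0|VT]] := pq_simpleL S.
  have [+ _] := VE i0 Pi0; rewrite V0 memv0 => /eqP ei.
  by have := coroot_neq0 i0; rewrite /coroot ei br0l eqxx.
have /VP /(_ j0 nPj0) [_ h] : e j0 \in V by rewrite VT memvf.
by have := coroot_neq0 j0; rewrite /coroot h eqxx.
Qed.

Lemma adHE i j : H i * E j - E j * H i = sc (B i j) * E j. Proof. exact: pqHadE. Qed.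

Lemma adHF i j : H i * F j - F j * H i = sc (- B i j) * F j.
Proof. by rewrite rmorphN mulNr; exact: pqHadF. Qed.

Lemma nilpotent_split i : (exists m, E i ^+ m = 0) \/ (exists m, F i ^+ m = 0) ->
  split_elt sc (H i).
Proof.
have ch := pq_pchar0 S; have B2 : B i i = 2%:R := B_diag S i.
case=> -[m hm].
  apply: (sl2_split scC (x := E i) (y := F i) (h := H i) _ _ _ ch hm).
  - exact: pqHE.
  - by rewrite adHE B2.
  by rewrite adHF B2.
have [s hs] : split_elt sc (- H i).
  apply: (sl2_split scC (x := F i) (y := E i) (h := - H i) _ _ _ ch hm).
  - by rewrite pqHE opprB.
  - by rewrite mulNr mulrN opprK addrC -opprB adHF B2 rmorphN mulNr opprK.
  by rewrite mulNr mulrN opprK addrC -opprB adHE B2 rmorphN mulNr.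
by exists [seq - c | c <- s]; rewrite hprodN hs mulr0.
Qed.

(** If [h_i] is split and [B i j] is nonzero, then [e_j] is nilpotent, since [h_i] acts on it by a
    nonzero scalar; hence [h_j] is split. *)
Lemma all_split : (exists i, (exists m, E i ^+ m = 0) \/ (exists m, F i ^+ m = 0)) ->
  forall i, split_elt sc (H i).
Proof.
move=> [i0 /nilpotent_split h0]; apply: dynkin_connected; first by exists i0.
move=> i j hi Bij; apply: nilpotent_split; left.
exact: (split_nilpotent scC (pq_pchar0 S) Bij (adHE i j) hi).
Qed.
End NilpotentCase.

(** * The given simple module as a highest weight module *)

Section SplitModule.
Variables (k : closedFieldType) (L : lieAlgebra k) (n : nat) (e f : 'I_n -> L).
Variable S : primitive_quotient e f.
Notation A := (pq_ring S).
Notation sc := (pq_sc S).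
Notation E := (pqE S).
Notation F := (pqF S).
Notation H := (pqH S).
Notation W := (pqW S).
Notation B := (pqB S).
Notation hdeg := (@hdeg _ _ _ _ _ S).
Notation wt := (@wt k n).
Notation V := (pq_mod S).
Let scC : forall c (a : A), sc c * a = a * sc c := @pq_scC _ _ _ _ _ S.

Lemma sc_scale_inj (M : lmodType A) (m : M) c c' : m <> 0 -> sc c *: m = sc c' *: m -> c = c'.
Proof.
move=> mN h; apply/eqP; rewrite -subr_eq0; apply/negP => /negP d0; apply: mN.
rewrite -[m]scale1r -(rmorph1 sc) -(mulVf d0) rmorphM rmorphB -scalerA scalerBl h subrr.
by rewrite scaler0.
Qed.

Lemma wvec_H (M : lmodType A) w (m : M) i : wvec w m -> H i *: m = sc (\sum_j B i j * w 0 j) *: m.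
Proof.
move=> hm; rewrite pqH_W rmorph_sum !scaler_suml; apply: eq_bigr => j _.
by rewrite rmorphM -!scalerA hm.
Qed.

Hypothesis splitH : forall i, split_elt sc (H i).

Lemma joint_eigenvector : exists w (v : V), v <> 0 /\ wvec w v.
Proof.
have step r : exists (c : 'I_n -> k) (v : V), v <> 0 /\ forall i : 'I_n, (i < r)%N -> H i *: v = sc (c i) *: v.
  elim: r => [|r [c [v [vN hv]]]].
    by have [[v vN] _] := pq_simple S; exists (fun=> 0), v.
  have [nr|rn] := leqP n r.
    by exists c, v; split=> // i _; apply: hv; apply: leq_trans nr.
  pose i0 := Ordinal rn; have [s hs] := splitH i0.
  have : hprod sc (H i0) s *: v = 0 by rewrite hs scale0r.
  elim: s {hs} => [|c0 s IH]; first by rewrite /hprod big_nil scale1r.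
  rewrite hprod_cons -scalerA; set u := hprod sc (H i0) s *: v => hu.
  case: (pselect (u = 0)) => [/IH //|uN].
  exists (fun i => if i == i0 then c0 else c i), u; split=> // i.
  rewrite ltnS leq_eqVlt => /orP [/eqP ir|ir].
    have -> : i = i0 by apply: val_inj.
    by rewrite eqxx; apply/subr0_eq; rewrite -scalerBl.
  have -> : (i == i0) = false by apply/eqP => ii; rewrite ii ltnn in ir.
  have cm : H i * hprod sc (H i0) s = hprod sc (H i0) s * H i.
    apply: commr_prod => c' _; apply: commrB; first exact: pqHH.
    by apply/commr_sym; exact: scC.
  by rewrite /u scalerA cm -scalerA hv // !scalerA scC.
have [c [v [vN hv]]] := step n.
exists (\row_i \sum_j invmx B i j * c j), v; split=> // i.
rewrite /W scaler_suml mxE rmorph_sum scaler_suml; apply: eq_bigr => j _.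
by rewrite rmorphM -!scalerA hv.
Qed.

Lemma finite_weights : exists ws : seq 'rV[k]_n,
  forall w (v : V), v <> 0 -> wvec w v -> w \in ws.
Proof.
have /choice [s sP] := splitH.
pose t := flatten [seq s i | i <- enum 'I_n].
(* Each [h_i] has its eigenvalues in the finite list [t], and the inverse Cartan matrix recovers the
   weight from them. *)
exists [seq \row_i \sum_j invmx B i j * t`_(c j) | c : {ffun 'I_n -> 'I_(size t)}].
move=> w v vN hv.
pose h i : k := \sum_j B i j * w 0 j.
have Hin i : h i \in s i.
  have prodE r : hprod sc (H i) r *: v = sc (\prod_(c <- r) (h i - c)) *: v.
    elim: r => [|c r IH]; first by rewrite /hprod !big_nil rmorph1.
    rewrite hprod_cons big_cons -scalerA IH scalerA -scC -scalerA scalerBl (wvec_H _ hv) -scalerBl.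
    by rewrite -rmorphB scalerA -rmorphM mulrC.
  have /eqP : \prod_(c <- s i) (h i - c) = 0.
    by apply: (sc_scale_inj vN); rewrite -prodE sP rmorph0 !scale0r.
  rewrite prodf_seq_eq0 => /hasP [c cs /=]; rewrite subr_eq0 => /eqP hc.
  by rewrite hc.
have inT i : h i \in t.
  by apply/flattenP; exists (s i) => //; apply: map_f; rewrite mem_enum.
have lt i : (index (h i) t < size t)%N by rewrite index_mem.
apply/mapP; exists [ffun i => Ordinal (lt i)]; first by rewrite mem_enum.
apply/rowP => i; rewrite mxE.
under [RHS]eq_bigr do rewrite ffunE nth_index // /h.
under [RHS]eq_bigr do rewrite mulr_sumr.
rewrite exchange_big /=.
have row l : \sum_j invmx B i j * B j l = (i == l)%:R.
  by have /matrixP /(_ i l) := mulVmx (pqB_unit S); rewrite !mxE.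
rewrite (eq_bigr (fun l => (i == l)%:R * w 0 l)) => [|l _]; last first.
  by rewrite -row mulr_suml; apply: eq_bigr => j _; rewrite mulrA.
rewrite (bigD1 i) //= big1 ?eqxx ?mul1r ?addr0 // => l.
by rewrite eq_sym => /negbTE ->; rewrite mul0r.
Qed.

Definition ht (w : 'rV[k]_n) := \sum_i w 0 i.

Lemma ht_delta w i : ht (w + wt (delta_mx 0 i)) = ht w + 1.
Proof.
rewrite /ht wt_delta; under eq_bigr do rewrite !mxE eqxx /=.
rewrite big_split /=; congr (_ + _); rewrite (bigD1 i) //= eqxx big1 ?addr0 //.
by move=> j /negbTE ->.
Qed.

(** Otherwise the [E i] could be applied forever, each raising the height by one, against the
    finiteness of the set of weights. *)
Lemma highest_vector : exists w (v : V), [/\ v <> 0, wvec w v & forall i, E i *: v = 0].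
Proof.
apply: contrapT => no; have [w0 [v0 [v0N hv0]]] := joint_eigenvector.
have climb m : exists w (v : V), [/\ v <> 0, wvec w v & ht w = ht w0 + m%:R].
  elim: m => [|m [w [v [vN hv hw]]]]; first by exists w0, v0; rewrite addr0.
  have [i Ei] : exists i, E i *: v <> 0.
    apply: contrapT => /forallNP h; apply: no; exists w, v; split=> // i.
    by apply: contrapT => /h.
  exists (w + wt (delta_mx 0 i)), (E i *: v); split=> //.
    by apply: hdeg_wvec hv; constructor.
  by rewrite ht_delta hw mulrSr addrA.
have [ws wsP] := finite_weights.
have [m /negP] := natr_notin_pchar0 [seq ht w - ht w0 | w <- ws] (pq_pchar0 S); apply.
have [w [v [vN hv hw]]] := climb m; apply/mapP; exists w; first exact: wsP hv.
by rewrite hw addrC addKr.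
Qed.

Hypothesis comm0 : forall a b, hdeg 0 a -> hdeg 0 b -> a * b = b * a.

(** Words in the [F i] applied to a highest vector span the module, and nonempty words have other
    weights. So the highest weight space is a line, which suffices when [A_0] is commutative. *)
Lemma split_cpointed : cpointed V.
Proof.
have [w [v [vN hv Ev]]] := highest_vector.
apply: (cpointed_of_wvec (pq_simple S) comm0 vN hv).
pose Fw (l : seq 'I_n) : A := \prod_(i <- l) F i.
have hFw l : hdeg (- ldeg l) (Fw l).
  elim: l => [|i l IH].
    by rewrite /ldeg /Fw !big_nil oppr0 -(rmorph1 sc); constructor.
  by rewrite ldeg_cons opprD /Fw big_cons; apply: hg_M => //; constructor.
pose FS (m : V) := exists s : seq (k * seq 'I_n), m = \sum_(p <- s) sc p.1 *: (Fw p.2 *: v).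
have FS0 : FS 0 by exists [::]; rewrite big_nil.
have FSD m m' : FS m -> FS m' -> FS (m + m').
  by move=> [s ->] [t ->]; exists (s ++ t); rewrite big_cat.
have FSm c l : FS (sc c *: (Fw l *: v)) by exists [:: (c, l)]; rewrite big_seq1.
have FSl (a : A) : (forall l, FS (a *: (Fw l *: v))) -> (forall c l, FS (sc c *: (a *: (Fw l *: v)))) ->
    forall m, FS m -> FS (a *: m).
  move=> _ h m [s ->]; elim: s => [|p s IH]; first by rewrite big_nil scaler0.
  by rewrite big_cons scalerDr; apply: FSD => //; rewrite scalerA -scC -scalerA; apply: h.
have FSsc c m : FS m -> FS (sc c *: m).
  move=> [s ->]; elim: s => [|p s IH]; first by rewrite big_nil scaler0.
  by rewrite big_cons scalerDr; apply: FSD => //; rewrite scalerA -rmorphM.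
have FSa (a : A) : (forall l, FS (a *: (Fw l *: v))) -> forall m, FS m -> FS (a *: m).
  by move=> h; apply: FSl => // c l; apply/FSsc/h.
have FSF i : forall m, FS m -> FS (F i *: m).
  apply: FSa => l; have := FSm 1 (i :: l).
  by rewrite rmorph1 scale1r /Fw big_cons scalerA.
have FSE i : forall m, FS m -> FS (E i *: m).
  apply: FSa; elim=> [|j l IH]; first by rewrite /Fw big_nil scale1r Ev.
  rewrite /Fw big_cons -/(Fw l) -scalerA scalerA.
  have [ij|ij] := eqVneq i j; last by rewrite pqEF // -scalerA; apply: FSF.
  rewrite -ij -[E i * F i](subrK (F i * E i)) -pqHE scalerDl; apply: FSD.
    by rewrite (wvec_H _ (hdeg_wvec (hFw l) hv)).
  by rewrite -scalerA; apply: FSF.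
have FSall a : forall m, FS m -> FS (a *: m).
  elim/pq_EFgen: a => [c|i|i|a b ha hb|a b ha hb] m hm; [exact: FSsc|exact: FSE|exact: FSF| |].
    by rewrite scalerDl; apply: FSD; [apply: ha|apply: hb].
  by rewrite -scalerA; apply/ha/hb.
move=> m hm; have [s ms] : FS m.
  have [a ->] := cyclic_sub (pq_simple S) vN m; apply: FSall.
  by have := FSm 1 [::]; rewrite rmorph1 /Fw big_nil !scale1r.
have [|c [_ cw cs]] := @wvec_projector _ _ _ _ _ S V w [seq w + wt (- ldeg p.2) | p <- s & p.2 != [::]].
  apply/negP => /mapP [p]; rewrite mem_filter => /andP [p0 _] /eqP.
  rewrite -subr_eq0 opprD addrA subrr sub0r oppr_eq0 -wt0 (inj_eq (wt_inj S)) oppr_eq0 => /eqP d0.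
  case: (p.2) p0 d0 => // i l _ /rowP /(_ i).
  by rewrite ldegE mxE /= eqxx.
exists (\sum_(p <- s | p.2 == [::]) p.1).
rewrite -{1}(cw m hm) ms scaler_sumr rmorph_sum scaler_suml [RHS]big_mkcond big_seq [RHS]big_seq.
apply: eq_bigr => p ps; case: eqP => [->|/eqP p0].
  by rewrite /Fw big_nil scale1r cw //; apply: wvecZ.
rewrite scalerA -scC -scalerA (cs (w + wt (- ldeg p.2))) ?scaler0 //.
  by apply: map_f; rewrite mem_filter p0.
exact: hdeg_wvec.
Qed.
End SplitModule.

(** * The algebra of functions on a nonempty set *)

Section FunctionAlgebra.
Variables (k : fieldType) (T : Type) (t0 : T).

(* The point t0 makes the algebra nontrivial. *)
Definition funalg of T : Type := T -> k.
Local Notation FA := (funalg t0).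
HB.instance Definition _ := gen_eqMixin FA.
HB.instance Definition _ := gen_choiceMixin FA.

Definition fa_add (f g : FA) : FA := fun t => f t + g t.
Definition fa_opp (f : FA) : FA := fun t => - f t.
Definition fa_mul (f g : FA) : FA := fun t => f t * g t.
Definition fa_scale (c : k) (f : FA) : FA := fun t => c * f t.

Lemma fa_addA : associative fa_add. Proof. by move=> f g h; apply/funext => t; exact: addrA. Qed.
Lemma fa_addC : commutative fa_add. Proof. by move=> f g; apply/funext => t; exact: addrC. Qed.
Lemma fa_add0 : left_id (fun=> 0 : k) fa_add. Proof. by move=> f; apply/funext => t; exact: add0r. Qed.
Lemma fa_addN : left_inverse (fun=> 0 : k) fa_opp fa_add.
Proof. by move=> f; apply/funext => t; exact: addNr. Qed.
HB.instance Definition _ := GRing.isZmodule.Build FA fa_addA fa_addC fa_add0 fa_addN.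

Lemma fa_mulA : associative fa_mul. Proof. by move=> f g h; apply/funext => t; exact: mulrA. Qed.
Lemma fa_mul1 : left_id (fun=> 1 : k) fa_mul. Proof. by move=> f; apply/funext => t; exact: mul1r. Qed.
Lemma fa_1mul : right_id (fun=> 1 : k) fa_mul. Proof. by move=> f; apply/funext => t; exact: mulr1. Qed.
Lemma fa_mulDl : left_distributive fa_mul +%R.
Proof. by move=> f g h; apply/funext => t; exact: mulrDl. Qed.
Lemma fa_mulDr : right_distributive fa_mul +%R.
Proof. by move=> f g h; apply/funext => t; exact: mulrDr. Qed.
Lemma fa_1neq0 : (fun=> 1 : k) != 0 :> FA.
Proof. by apply/eqP => /(congr1 (fun f : FA => f t0)) /eqP; rewrite oner_eq0. Qed.
HB.instance Definition _ := GRing.Zmodule_isNzRing.Build FA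
  fa_mulA fa_mul1 fa_1mul fa_mulDl fa_mulDr fa_1neq0.

Lemma fa_scaleA a b (f : FA) : fa_scale a (fa_scale b f) = fa_scale (a * b) f.
Proof. by apply/funext => t; exact: mulrA. Qed.
Lemma fa_scale1 : left_id 1 fa_scale. Proof. by move=> f; apply/funext => t; exact: mul1r. Qed.
Lemma fa_scaleDr : right_distributive fa_scale +%R.
Proof. by move=> a f g; apply/funext => t; exact: mulrDr. Qed.
Lemma fa_scaleDl (f : FA) : {morph fa_scale^~ f : a b / a + b}.
Proof. by move=> a b; apply/funext => t; exact: mulrDl. Qed.
HB.instance Definition _ := GRing.Zmodule_isLmodule.Build k FA
  fa_scaleA fa_scale1 fa_scaleDr fa_scaleDl.

Lemma fa_scaleAl (a : k) (f g : FA) : a *: (f * g) = (a *: f) * g.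
Proof. by apply/funext => t; exact: mulrA. Qed.
HB.instance Definition _ := GRing.Lmodule_isLalgebra.Build k FA fa_scaleAl.

Lemma fa_scaleAr (a : k) (f g : FA) : a *: (f * g) = f * (a *: g).
Proof. by apply/funext => t; exact: mulrCA. Qed.
HB.instance Definition _ := GRing.Lalgebra_isAlgebra.Build k FA fa_scaleAr.

Lemma fa_mulC (f g : FA) : f * g = g * f.
Proof. by apply/funext => t; exact: mulrC. Qed.

Definition fa_comp (s : T -> T) (f : FA) : FA := fun t => f (s t).

Lemma fa_comp_zmod s : zmod_morphism (fa_comp s). Proof. by []. Qed.
HB.instance Definition _ s := GRing.isZmodMorphism.Build FA FA (fa_comp s) (fa_comp_zmod s).

Lemma fa_comp_monoid s : monoid_morphism (fa_comp s). Proof. by []. Qed.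
HB.instance Definition _ s := GRing.isMonoidMorphism.Build FA FA (fa_comp s) (fa_comp_monoid s).

Lemma fa_comp_scalable s : scalable (fa_comp s). Proof. by []. Qed.
HB.instance Definition _ s := GRing.isScalable.Build k FA FA *:%R (fa_comp s) (fa_comp_scalable s).
End FunctionAlgebra.

(** A new pair [(a, b)] is enforced by composing with the transposition of [s a] and [b], which
    injectivity keeps away from the earlier values. *)
Lemma extend_to_perm (T : finType) (l : seq (T * T)) :
  (forall p q, p \in l -> q \in l -> (p.1 == q.1) = (p.2 == q.2)) ->
  exists s : {perm T}, forall p, p \in l -> s p.1 = p.2.
Proof.
elim: l => [|[a b] l IH] inj; first by exists 1%g.
have [p q pl ql|s sP] := IH; first by apply: inj; rewrite inE ?pl ?ql orbT.
exists (s * tperm (s a) b)%g => p; rewrite inE => /orP [/eqP -> /=|pl].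
  by rewrite permM tpermL.
rewrite permM; have pi := inj p (a, b); rewrite inE pl orbT mem_head in pi.
have {}pi := pi isT isT; have [pa|pa] := eqVneq p.1 a.
  by move: pi; rewrite pa /= eqxx => /esym /eqP ->; rewrite tpermL.
rewrite tpermD ?sP //.
  by apply: contra pa => /eqP h; apply/eqP/(@perm_inj _ s); rewrite sP.
by rewrite eq_sym -pi.
Qed.

(** * The TGW datum when the set of weights is finite *)

Section FiniteTGW.
Variables (k : closedFieldType) (L : lieAlgebra k) (n : nat) (e f : 'I_n -> L).
Variable S : primitive_quotient e f.
Notation A := (pq_ring S).
Notation sc := (pq_sc S).
Notation E := (pqE S).
Notation F := (pqF S).
Notation H := (pqH S).
Notation W := (pqW S).
Notation hdeg := (@hdeg _ _ _ _ _ S).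
Notation wt := (@wt k n).
Notation V := (pq_mod S).
Let scC : forall c (a : A), sc c * a = a * sc c := @pq_scC _ _ _ _ _ S.

(* f e = 0 forces h^2 = h e = f h = 0, and then 4 e = [h, [h, e]] = 0. *)
Lemma FE0_trivial i : F i * E i = 0 -> forall x, pq_X S x = 0.
Proof.
move=> fe; have hE : H i = E i * F i by rewrite pqHE fe subr0.
have he : H i * E i = 0 by rewrite hE -mulrA fe mulr0.
have hh : H i * H i = 0 by rewrite {2}hE mulrA he mul0r.
have B2 : pqB S i i = 2%:R := B_diag S i.
have two : (2%:R : k) != 0 by have -> := (pcharf0P k).1 (pq_pchar0 S) 2.
have eh : E i * H i = - (sc 2%:R * E i).
  by have := adHE S i i; rewrite B2 he sub0r => <-; rewrite opprK.
have E0 : sc (2%:R * 2%:R) * E i = 0.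
  have : E i * H i * H i = 0 by rewrite -mulrA hh mulr0.
  by rewrite eh mulNr -mulrA eh mulrN opprK mulrA -rmorphM.
have {}E0 : E i = 0.
  have t4 : (2%:R * 2%:R : k) != 0 by rewrite mulf_neq0.
  by rewrite -[E i]mul1r -(rmorph1 sc) -(mulVf t4) rmorphM -mulrA E0 mulr0.
have H0 : H i = 0 by rewrite hE E0 mul0r.
have [||U UP] := @vspace_of_pred _ L (fun x => pq_X S x = 0).
- exact: pqX0.
- by move=> a x y hx hy; rewrite pq_lin hx hy mulr0 addr0.
have ideal x y : y \in U -> lie_br x y \in U.
  by move=> /UP hy; apply/UP; rewrite pq_br hy mulr0 mul0r subrr.
have [_ /(_ U ideal) [U0|UT]] := pq_simpleL S.
  have : coroot e f i \in U by apply/UP.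
  by rewrite U0 memv0 (negbTE (coroot_neq0 S i)).
by move=> x; apply/UP; rewrite UT memvf.
Qed.

Hypothesis comm0 : forall a b, hdeg 0 a -> hdeg 0 b -> a * b = b * a.
Hypothesis splitH : forall i, split_elt sc (H i).
Hypothesis nontriv : exists x, pq_X S x <> 0.

Lemma split_tgw : tgw_realizable S.
Proof.
have [wM cp] := split_cpointed splitH comm0.
have faith := @pq_faithful _ _ _ _ _ S.
have [ws0 ws0P] := finite_weights splitH.
have [w0 [v0 [v0N hv0]]] := joint_eigenvector splitH.
(* Only the weights that occur, each once, so that they are indexed by a finite type without
   repetition. *)
pose ws := undup [seq w <- ws0 | `[< exists v : V, v <> 0 /\ wvec w v >]].
have wsP w (v : V) : v <> 0 -> wvec w v -> w \in ws.
  move=> vN hv; rewrite mem_undup mem_filter (ws0P w v) // andbT.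
  by apply/asboolP; exists v.
have w0s := wsP _ _ v0N hv0.
pose T := 'I_(size ws); pose wp (p : T) : 'rV[k]_n := ws`_p.
have p0 : (index w0 ws < size ws)%N by rewrite index_mem.
pose t0 : T := Ordinal p0.
have wp_inj : injective wp.
  move=> p q /eqP; rewrite /wp nth_uniq ?undup_uniq // => /eqP; exact: val_inj.
have wpE w : w \in ws -> exists p, w = wp p.
  move=> h; have lt : (index w ws < size ws)%N by rewrite index_mem.
  by exists (Ordinal lt); rewrite /wp /= nth_index.
have /choice [vp vpP] (p : T) : exists v : V, [/\ v <> 0, wvec (wp p) v &
    forall m, wvec (wp p) m -> exists a, m = sc a *: v].
  have : wp p \in ws by apply: mem_nth.
  rewrite mem_undup mem_filter => /andP [/asboolP [v [vN hv]] _].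
  have [u uP] := cp (wp p); exists v; split=> // m hm.
  have [a ma] := uP m hm; have [b vb] := uP v hv; exists (a / b).
  have b0 : b != 0 by apply/eqP => b0; apply: vN; rewrite vb b0 rmorph0 scale0r.
  by rewrite ma vb scalerA -rmorphM divfK.
have vN p : vp p <> 0 by have [] := vpP p.
have hv p : wvec (wp p) (vp p) by have [] := vpP p.
have v1 p m : wvec (wp p) m -> exists a, m = sc a *: vp p by have [_ _] := vpP p; apply.
have eqA (a b : A) : (forall p, a *: vp p = b *: vp p) -> a = b.
  move=> h; apply/subr0_eq; apply: (faithful_wvec faith wM) => w m hm.
  case: (pselect (m = 0)) => [->|mN]; first by rewrite scaler0.
  have [p wE] := wpE w (wsP _ _ mN hm); rewrite wE in hm; have [c ->] := v1 _ _ hm.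
  by rewrite scalerA -scC -scalerA scalerBl h subrr scaler0.
have step d y p : hdeg d y -> y *: vp p = 0 \/ exists2 q, wp q = wp p + wt d & wvec (wp q) (y *: vp p).
  move=> hy; case: (pselect (y *: vp p = 0)) => [|yN]; [by left|right].
  have hyv := hdeg_wvec hy (hv p); have [q qE] := wpE _ (wsP _ _ yN hyv).
  by exists q; rewrite -qE.
(* Each weight space has its projector in [A_0], so every function on the weights is realized by an
   element of [A_0]. *)
have /choice [eps epsP] (p : T) : exists a, [/\ hdeg 0 a, a *: vp p = vp p &
    forall q, q != p -> a *: vp q = 0].
  have [|a [ha aw as_]] := @wvec_projector _ _ _ _ _ S V (wp p) [seq wp q | q <- enum T & q != p].
    apply/negP => /mapP [q]; rewrite mem_filter => /andP [qp _] /wp_inj pq.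
    by rewrite pq eqxx in qp.
  exists a; split=> //; first exact: aw.
  by move=> q qp; apply: (as_ (wp q)) => //; apply: map_f; rewrite mem_filter qp mem_enum.
pose R : algType k := funalg k t0.
pose rhof (r : R) : A := \sum_p sc (r p) * eps p.
have rho_hdeg r : hdeg 0 (rhof r).
  by apply: hdeg_sum => p _; apply: hdeg_Z; have [] := epsP p.
have rhov r p : rhof r *: vp p = sc (r p) *: vp p.
  rewrite scaler_suml (bigD1 p) //= big1 => [|q qp].
    by rewrite addr0 -scalerA; have [_ -> _] := epsP p.
  by rewrite -scalerA; have [_ _ ->] := epsP q; rewrite ?scaler0 // eq_sym.
have rhow r p (m : V) : wvec (wp p) m -> rhof r *: m = sc (r p) *: m.
  by move=> hm; have [c ->] := v1 _ _ hm; rewrite !scalerA -scC -scalerA rhov !scalerA scC.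
have rhoB : zmod_morphism rhof.
  by move=> r s; apply: eqA => p; rewrite scalerBl !rhov -scalerBl -rmorphB.
have rhoM : monoid_morphism rhof.
  split=> [|r s]; apply: eqA => p; first by rewrite rhov rmorph1.
  by rewrite -scalerA !rhov scalerA -scC -scalerA rhov scalerA -rmorphM mulrC.
pose rho : {rmorphism R -> A} := HB.pack_for {rmorphism R -> A} rhof
  (GRing.isZmodMorphism.Build R A rhof rhoB) (GRing.isMonoidMorphism.Build R A rhof rhoM).
(* The shift by a simple root leaves the finite set of weights; a permutation is needed for an
   invertible [sigma i]. *)
have /choice [s sP] (i : 'I_n) : exists s : {perm T}, forall p q, wp q = wp p + wt (delta_mx 0 i) -> s p = q.
  have [|s sP] := @extend_to_perm T [seq pq <- enum ((T * T)%type : finType) | wp pq.2 == wp pq.1 + wt (delta_mx 0 i)].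
    move=> [p q] [p' q']; rewrite !mem_filter /= => /andP [/eqP h _] /andP [/eqP h' _].
    by rewrite -(inj_eq wp_inj q q') h h' (inj_eq (addIr _)) (inj_eq wp_inj).
  by exists s => p q h; apply: (sP (p, q)); rewrite mem_filter h eqxx mem_enum.
have sV i p q : wp q = wp p + wt (delta_mx 0 i) -> ((s i)^-1)%g q = p.
  by move=> /sP <-; rewrite permK.
have /choice [t tP] (i : 'I_n) : exists t : R, forall p, F i *: (E i *: vp p) = sc (t p) *: vp p.
  have hFE : hdeg 0 (F i * E i) by rewrite -(addNr (delta_mx 0 i)); apply: hg_M; constructor.
  have /choice [t tP] (p : T) : exists c, F i *: (E i *: vp p) = sc c *: vp p.
    by rewrite scalerA; apply: v1; have := hdeg_wvec hFE (hv p); rewrite wt0 addr0.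
  by exists t.
have tN i : t i != 0.
  have [x xN] := nontriv; apply/eqP => ti; apply: xN; apply: (FE0_trivial (i := i)).
  by apply: eqA => p; rewrite -scalerA tP ti rmorph0 !scale0r.
pose sigma (i : 'I_n) : {lrmorphism R -> R} := @fa_comp k T t0 ((s i)^-1)%g.
have sK i : cancel (sigma i) (@fa_comp k T t0 (s i)).
  by move=> r; apply/funext => p; congr (r _); exact: permK.
have sVK i : cancel (@fa_comp k T t0 (s i)) (sigma i).
  by move=> r; apply/funext => p; congr (r _); exact: permKV.
pose D := @TGWDatum k n R sigma (fun i => @fa_comp k T t0 (s i)) sK sVK t tN (fun i r => fa_mulC (t i) r).
exists D, (fun _ _ => 1).
have [||||||||||psi psiP] := @tgw_iso k L n e f S D (fun _ _ => 1) rho.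
- by move=> i j _; apply: oner_neq0.
- by move=> c; apply: eqA => p; rewrite rhov; congr (sc _ *: _); exact: mulr1.
- exact: rho_hdeg.
- move=> i r; apply: eqA => p; rewrite -!scalerA rhov scalerA -scC -scalerA.
  case: (step _ _ p (hg_E S i)) => [->|[q qE hq]]; first by rewrite !scaler0.
  by rewrite (rhow _ _ _ hq) /= /fa_comp (sV i p q).
- move=> i r; apply: eqA => p; rewrite -!scalerA rhov scalerA -scC -scalerA.
  case: (step _ _ p (hg_F S i)) => [->|[q qE hq]]; first by rewrite !scaler0.
  by rewrite (rhow _ _ _ hq) /= /fa_comp (sP i q p) // qE wtN subrK.
- by move=> i; apply: eqA => p; rewrite -scalerA tP rhov.
- move=> i; apply: eqA => q; rewrite -scalerA rhov /= /fa_comp.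
  case: (step _ _ q (hg_F S i)) => [Fq|[p pE hp]].
    (* The permutation may join points that are not a simple root apart. There [E i] kills [vp p];
       in the other case [E i] lands on the line of [vp q], which [F i] kills. Either way [t i]
       vanishes at [p]. *)
    rewrite Fq scaler0; set p := ((s i)^-1)%g q.
    case: (step _ _ p (hg_E S i)) => [Ep|[q' q'E hq']].
      suff -> : t i p = 0 by rewrite rmorph0 scale0r.
      by apply: (sc_scale_inj (vN p)); rewrite -tP Ep scaler0 rmorph0 scale0r.
    have qq' : q' = q by rewrite -(sP i p q' q'E) /p permKV.
    have [b Eb] : exists b, E i *: vp p = sc b *: vp q by apply: v1; rewrite -qq'.
    suff -> : t i p = 0 by rewrite rmorph0 scale0r.
    apply: (sc_scale_inj (vN p)); rewrite -tP Eb scalerA -scC -scalerA Fq scaler0.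
    by rewrite rmorph0 scale0r.
  have qp : wp q = wp p + wt (delta_mx 0 i) by rewrite pE wtN subrK.
  rewrite (sV i p q qp); have [a Fa] := v1 _ _ hp.
  have [b Eb] : exists b, E i *: vp p = sc b *: vp q.
    by apply: v1; rewrite qp; apply: hdeg_wvec (hv p); constructor.
  have tab : t i p = b * a.
    by apply: (sc_scale_inj (vN p)); rewrite -tP Eb scalerA -scC -scalerA Fa scalerA rmorphM.
  by rewrite Fa scalerA -scC -scalerA Eb scalerA -rmorphM tab mulrC.
- by move=> i j ij; rewrite rmorph1 mul1r pqEF.
- move=> r r0; have {}r0 : rhof r = 0 := r0; suff -> : r = 0 by [].
  apply/funext => p; apply: (sc_scale_inj (vN p)).
  by rewrite -rhov r0 scale0r rmorph0 scale0r.
- by move=> d a; apply: (graded_faithful (pq_simple S) faith).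
by exists psi; split=> // i j _; apply: oner_neq0.
Qed.
End FiniteTGW.

(** * The trivial module in rank at least two *)

Section TrivialTGW.
Variables (k : closedFieldType) (L : lieAlgebra k) (n : nat) (e f : 'I_n -> L).
Variable S : primitive_quotient e f.
Notation A := (pq_ring S).
Notation sc := (pq_sc S).
Notation E := (pqE S).
Notation F := (pqF S).
Notation hdeg := (@hdeg _ _ _ _ _ S).
Hypothesis trivX : forall x, pq_X S x = 0.
Variables i0 j0 : 'I_n.
Hypothesis ij0 : i0 != j0.

Let R : algType k := (k^o * k^o)%type.
Let t : R := (0, 1).

Lemma trivial_t_neq0 : t != 0.
Proof. by apply/eqP => /(congr1 snd) /eqP; rewrite oner_eq0. Qed.

Let D : tgw_datum k n := @TGWDatum k n R (fun=> idfun) (fun=> idfun) (fun i => frefl _) (fun i => frefl _)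
  (fun=> t) (fun=> trivial_t_neq0) (fun _ r => mulrC t r).
Let mu : 'I_n -> 'I_n -> k := fun _ _ => 2%:R.
Notation C := (@tgwc_cst k n D mu).

(* Both ways of straightening X_i Y_j X_j Y_i: t^2 and mu^2 t^2. *)
Lemma trivial_t_eq0 : C t = 0.
Proof.
have tt : t * t = t by congr (_, _); rewrite ?mul0r ?mul1r.
have tC : C t * C t = C t by rewrite -tgwcM tt.
pose X i := tgwc_X D mu i; pose Y i := tgwc_Y D mu i.
have YX i : Y i * X i = C t := @tgwcYX k n D mu i.
have XY i : X i * Y i = C t := @tgwcXY k n D mu i.
have e1 : X i0 * Y j0 * (X j0 * Y i0) = C t.
  by rewrite mulrA -[X i0 * _ * _]mulrA YX (@tgwc_XC k n D mu i0 t) -mulrA XY tC.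
have e2 : X i0 * Y j0 * (X j0 * Y i0) = C (4%:R%:A) * C t.
  rewrite [X i0 * _]tgwcXYij // [X j0 * _]tgwcXYij 1?eq_sym //.
  rewrite mulrA -[C _ * _ * C _]mulrA -tgwc_scalarC -!mulrA.
  rewrite [X i0 * _]mulrA XY [Y j0 * _]mulrA (@tgwc_YC k n D mu j0 t) -mulrA YX tC.
  by rewrite mulrA -tgwcM; congr (_ * _); congr tgwc_cst; rewrite -scalerAl mul1r scalerA -natrM.
(* The two values differ by [(4 - 1) t], and 3 is invertible. *)
have e3 : C (3%:R%:A) * C t = 0.
  apply: (addIr (C t)); rewrite add0r -{3}e1 e2 -{2}[C t]mul1r -tgwc1 -mulrDl -tgwcD.
  by congr (_ * _); congr tgwc_cst; rewrite -[in X in _ + X](scale1r 1) -scalerDl natr1.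
have t3 : (3%:R : k) != 0 by have -> := (pcharf0P k).1 (pq_pchar0 S) 3.
rewrite -[C t]mul1r -tgwc1 -(scale1r 1) -(mulVf t3) -scalerA -[_ *: 1]mul1r scalerAl tgwcM.
by rewrite -mulrA e3 mulr0.
Qed.

Lemma trivial_tgw : tgw_realizable S.
Proof.
have E0 i : E i = 0 by exact: trivX.
have F0 i : F i = 0 by exact: trivX.
(* The kernel of the first projection is the line of [t], which is zero in [C_mu]. *)
pose rhof (r : R) : A := sc r.1.
have rhoB : zmod_morphism rhof by move=> r s; exact: rmorphB.
have rhoM : monoid_morphism rhof by split; [exact: rmorph1|move=> r s; exact: rmorphM].
pose rho : {rmorphism R -> A} := HB.pack_for {rmorphism R -> A} rhof
  (GRing.isZmodMorphism.Build R A rhof rhoB) (GRing.isMonoidMorphism.Build R A rhof rhoM).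
have mu0 i j : i != j -> mu i j != 0.
  by rewrite /mu; have -> := (pcharf0P k).1 (pq_pchar0 S) 2.
exists D, mu.
have [||||||||||psi psiP] := @tgw_iso k L n e f S D mu rho.
- exact: mu0.
- by move=> c; rewrite /= /rhof /= [c *: _]mulr1.
- by move=> r; exact: hg_sc.
- by move=> i r; rewrite E0 mul0r mulr0.
- by move=> i r; rewrite F0 mul0r mulr0.
- by move=> i; rewrite E0 mulr0 /= /rhof rmorph0.
- by move=> i; rewrite E0 mul0r /= /rhof rmorph0.
- by move=> i j ij; rewrite E0 mul0r !mulr0.
- move=> [a b] /= ab.
  have a0 : a = 0 by apply: (fmorph_inj sc); rewrite rmorph0.
  have -> : (a, b) = b%:A * t :> R by rewrite a0; congr (_, _); rewrite /= ?mulr0 // [_ *: _]mulr1 mulr1.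
  by rewrite tgwcM trivial_t_eq0 mulr0.
- move=> d a ha aN; apply: (graded_faithful (pq_simple S) (@pq_faithful _ _ _ _ _ S) _ ha aN).
  move=> m; exists [:: m]; rewrite big_seq1; split=> // v _; exists 0 => i.
  rewrite mxE rmorph0 scale0r /pqW.
  by rewrite big1 ?scale0r // => j _; rewrite /pqH trivX mulr0.
by exists psi; split.
Qed.
End TrivialTGW.

(** * Both conditions compared with the commutativity of [A_0] *)

Section Dichotomy.
Variables (k : closedFieldType) (L : lieAlgebra k) (n : nat) (e f : 'I_n -> L).
Variable S : primitive_quotient e f.
Notation A := (pq_ring S).
Notation sc := (pq_sc S).
Notation hdeg := (@hdeg _ _ _ _ _ S).
Let scC : forall c (a : A), sc c * a = a * sc c := @pq_scC _ _ _ _ _ S.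

Definition comm_hdeg0 := forall a b, hdeg 0 a -> hdeg 0 b -> a * b = b * a.

Lemma cpointed_comm_hdeg0 : cpointed (pq_mod S) -> comm_hdeg0.
Proof.
move=> [wM cp] a b ha hb; apply/subr0_eq.
apply: (faithful_wvec (@pq_faithful _ _ _ _ _ S) wM) => w m hm.
case: (pselect (m = 0)) => [->|mN]; first by rewrite scaler0.
have [v vP] := cp w.
have scal y : hdeg 0 y -> exists c, y *: m = sc c *: m.
  move=> hy; have := hdeg_wvec hy hm; rewrite wt0 addr0 => /vP [c ->].
  have [d md] := vP m hm; exists (c / d); rewrite md scalerA -rmorphM divfK //.
  by apply/eqP => d0; apply: mN; rewrite md d0 rmorph0 scale0r.
have [c ca] := scal a ha; have [d db] := scal b hb.
rewrite scalerBl -!scalerA ca db !scalerA -!scC -!scalerA ca db !scalerA -!rmorphM.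
by rewrite mulrC subrr.
Qed.

(** Elements of [A_0] lift to expressions in the [X i], [Y i] and scalars. Normalizing these creates
    only translates of the [t_i], so the resulting constants are central in [R]. *)
Lemma tgw_comm_hdeg0 (D : tgw_datum k n) mu (psi : A -> TGWA D mu) :
  (forall i j, i != j -> mu i j != 0) ->
  (forall a b, psi (a + b) = psi a + psi b) -> (forall a b, psi (a * b) = psi a * psi b) ->
  (forall c, psi (sc c) = tgwa_cst mu (c%:A : tgw_ring D)) ->
  (forall i, psi (pqE S i) = tgwa_X D mu i /\ psi (pqF S i) = tgwa_Y D mu i) ->
  injective psi -> comm_hdeg0.
Proof.
move=> mu0 psiD psiM psic psiXY psiI.
pose Zp (r : tgw_ring D) := forall s, r * s = s * r.
have lift d a : hdeg d a -> exists2 y, zhomog (mu := mu) Zp d y & psi a = quot_pi (@tgwa_rel _ _ D mu) y.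
  elim=> {d a} [c|i|i|d|d x y _ [x' hx xE] _ [y' hy yE]|d d' x y _ [x' hx xE] _ [y' hy yE]].
  - exists (tgwc_cst mu c%:A); last exact: psic.
    by constructor=> s; rewrite -scalerAl -scalerAr mul1r mulr1.
  - by exists (tgwc_X D mu i); [constructor|exact: (psiXY i).1].
  - by exists (tgwc_Y D mu i); [constructor|exact: (psiXY i).2].
  - exists 0; first by constructor.
    by have /eqP := psiD 0 0; rewrite addr0 -subr_eq subrr eq_sym => /eqP.
  - by exists (x' + y'); [constructor|rewrite psiD quot_piD xE yE].
  by exists (x' * y'); [constructor|rewrite psiM quot_piM xE yE].
have zero y : zhomog (mu := mu) Zp 0 y -> exists2 z, Zp z & y = tgwc_cst mu z.
  apply: zhomog0 => //.
  - by move=> r s hr hs x; rewrite mulrDl mulrDr hr hs.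
  - by move=> r s hr hs x; rewrite -mulrA hs mulrA hr mulrA.
  - by move=> c s; rewrite -scalerAl -scalerAr mul1r mulr1.
  - by move=> i r hr s; rewrite -[s](tgw_sigmaVK i) -!rmorphM hr.
  - by move=> i r hr s; apply: (can_inj (tgw_sigmaK i)); rewrite !rmorphM /= tgw_sigmaVK hr.
  exact: tgw_t_central.
move=> a b /lift [y /zero [z hz yE] aE] /lift [y' /zero [z' _ y'E] bE].
by apply: psiI; rewrite !psiM aE bE -!quot_piM yE y'E -!tgwcM hz.
Qed.

Lemma comm_hdeg0_realizable : comm_hdeg0 -> ~ (n = 1%N /\ forall x, pq_X S x = 0) ->
  tgw_realizable S /\ exists M : lmodType A,
    [/\ simple_mod M, cpointed M & forall a : A, (forall m : M, a *: m = 0) -> a = 0].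
Proof.
move=> comm0 ntriv.
case: (pselect (exists i, (exists m, pqE S i ^+ m = 0) \/ (exists m, pqF S i ^+ m = 0))) => [nil|reg].
  have split := all_split nil; split; last first.
    exists (pq_mod S); split; [exact: pq_simple|exact: split_cpointed|exact: pq_faithful].
  case: (pselect (exists x, pq_X S x <> 0)) => [|triv]; first exact: split_tgw.
  have {}triv x : pq_X S x = 0 by apply: contrapT => xN; apply: triv; exists x.
  (* The excluded case is exactly the trivial module without a second index. *)
  case: (nil) => i0 _; have [j0 ij] : exists j0, i0 != j0; last exact: trivial_tgw ij.
  apply: contrapT => /forallNP one; apply: ntriv; split=> //.
  rewrite -(card_ord n); apply/eqP; apply/fintype1P; exists i0 => j.
  by apply/eqP; rewrite eq_sym; apply/negPn/negP; exact: one.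
have regE i : regular (pqE S i).
  case: (pq_regular_or_nilpotent (@pq_adnilE _ _ _ _ _ S i)) => // h; case: reg; by exists i; left.
have regF i : regular (pqF S i).
  case: (pq_regular_or_nilpotent (@pq_adnilF _ _ _ _ _ S i)) => // h; case: reg; by exists i; right.
by split; [exact: regular_tgw|exact: regular_module].
Qed.
End Dichotomy.

(** * Modules over the enveloping algebra *)

Section Action.
Variables (A : pzRingType) (N : zmodType) (s : A -> N -> N).

Definition is_action := [/\ forall a b m, s a (s b m) = s (a * b) m, left_id 1 s,
  right_distributive s +%R & forall m, {morph s^~ m : a b / a + b}].
(** A copy of [N] for each proof of [is_action], so that the new module structure does not clash
    with one already on [N]. *)
Definition acted of is_action : Type := N.
Variable sP : is_action.
HB.instance Definition _ := GRing.Zmodule.on (acted sP).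

Definition acted_scale (a : A) (m : acted sP) : acted sP := s a m.
Fact acted_scaleA a b m : acted_scale a (acted_scale b m) = acted_scale (a * b) m.
Proof. by have [h _ _ _] := sP; exact: h. Qed.
Fact acted_scale1 : left_id 1 acted_scale. Proof. by have [_ h _ _] := sP; exact: h. Qed.
Fact acted_scaleDr : right_distributive acted_scale +%R. Proof. by have [_ _ h _] := sP; exact: h. Qed.
Fact acted_scaleDl m : {morph acted_scale^~ m : a b / a + b}. Proof. by have [_ _ _ h] := sP; exact: h. Qed.
HB.instance Definition _ := GRing.Zmodule_isLmodule.Build A (acted sP)
  acted_scaleA acted_scale1 acted_scaleDr acted_scaleDl.

Lemma module_of_action : exists (M : lmodType A) (phi : M -> N) (phiV : N -> M),
  [/\ cancel phi phiV, cancel phiV phi,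
    forall x y, phi (x + y) = phi x + phi y & forall a x, phi (a *: x) = s a (phi x)].
Proof. by exists (acted sP : lmodType A), id, id; split. Qed.
End Action.

Section EnvelopingQuotient.
Variables (k : closedFieldType) (char0 : [pchar k] =i pred0) (L : lieAlgebra k).
Hypothesis simpleL : lie_simple L.
Variables (n : nat) (e f : 'I_n -> L).
Hypothesis serre_ef : serre_generators e f.
Notation U := (Uenv L).

Lemma free_cstB (a b : k) : free_cst L (a - b) = free_cst L a - free_cst L b.
Proof.
have cD u v : free_cst L (u + v) = free_cst L u + free_cst L v :> freeRing k L by exact: free_cstD.
by apply: (addIr (free_cst L b)); rewrite -cD !subrK.
Qed.

Lemma Uenv_ind (P : U -> Prop) : (forall c, P (Uenv_scalar L c)) -> (forall x, P (Uenv_inj x)) ->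
  (forall a b, P a -> P b -> P (a + b)) -> (forall a b, P a -> P b -> P (a * b)) -> forall u, P u.
Proof.
move=> Pc PX PD PM u; have [p ->] := quot_onto u; elim/free_gen_ind: p => // a b Pa Pb.
  by rewrite quot_piD; apply: PD.
by rewrite quot_piM; apply: PM.
Qed.

Lemma Uenv_scalarC c (u : U) : Uenv_scalar L c * u = u * Uenv_scalar L c.
Proof.
elim/Uenv_ind: u => [d|x|a b ha hb|a b ha hb].
- by rewrite /Uenv_scalar -!quot_piM -![free_cst L _ * _]/(free_mul _ _) -!free_cstM mulrC.
- by rewrite -!quot_piM; apply/esym; apply: quot_pi_rel; exact: Uenv_central.
- by rewrite mulrDl mulrDr ha hb.
by rewrite mulrA ha -mulrA hb mulrA.
Qed.

Lemma Uenv_injP c x y :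
  Uenv_inj (c *: x + y) = Uenv_scalar L c * Uenv_inj x + Uenv_inj y.
Proof. by rewrite -quot_piM -quot_piD; apply: quot_pi_rel; exact: Uenv_linear. Qed.

Lemma Uenv_inj_br x y :
  Uenv_inj (lie_br x y) = Uenv_inj x * Uenv_inj y - Uenv_inj y * Uenv_inj x :> U.
Proof. by rewrite -!quot_piM -quot_piN -quot_piD; apply: quot_pi_rel; exact: Uenv_br. Qed.

Variables (M : lmodType U) (simpleM : simple_module M).

Lemma primitive_quotient_exists : exists (S : primitive_quotient e f) (pi : {rmorphism U -> pq_ring S})
    (phi : M -> pq_mod S) (phiV : pq_mod S -> M),
  [/\ forall u, annihilator M u <-> pi u = 0, forall a, exists u, pi u = a,
      (forall c, pi (Uenv_scalar L c) = pq_sc S c) /\ (forall x, pi (Uenv_inj x) = pq_X S x) &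
      [/\ cancel phi phiV, cancel phiV phi, forall x y, phi (x + y) = phi x + phi y &
          forall u x, phi (u *: x) = pi u *: phi x]].
Proof.
pose J := annihilator M.
have ideal u : ideal_gen J u <-> J u.
  split; last by constructor.
  elim=> [//|m|x y _ hx _ hy m|a x _ hx m|a x _ hx m]; first by rewrite scale0r.
  - by rewrite scalerDl hx hy addr0.
  - by rewrite -scalerA hx scaler0.
  by rewrite -scalerA hx.
pose Q : pzRingType := ring_quot J.
pose p : U -> Q := quot_pi J.
have pE u v : p u = p v <-> J (u - v).
  by split=> [/quot_eqP /ideal|/ideal /quot_eqP].
have pJ u : p u = 0 <-> J u by rewrite -[0]/(p 0) pE subr0.
have Q1 : (1 : Q) != 0.
  apply/eqP => /pJ h; have [[m mN] _] := simpleM; apply: mN.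
  by have := h m; rewrite scale1r.
pose A : nzRingType := HB.pack_for nzRingType (ring_quot J)
  (GRing.PzSemiRing_isNonZero.Build (ring_quot J) Q1).
pose sc0 (c : k) : A := p (Uenv_scalar L c).
have pD u v : p (u + v) = p u + p v by exact: quot_piD.
have pM u v : p (u * v) = p u * p v by exact: quot_piM.
have pB : zmod_morphism (p : U -> A) by move=> u v; rewrite pD [p (- v)]quot_piN.
have pMM : monoid_morphism (p : U -> A) by split.
pose pi : {rmorphism U -> A} := HB.pack_for {rmorphism U -> A} (p : U -> A)
  (GRing.isZmodMorphism.Build U A p pB) (GRing.isMonoidMorphism.Build U A p pMM).
have scB : zmod_morphism sc0.
  move=> a b; rewrite -[RHS]pB; congr p.
  by rewrite /Uenv_scalar -quot_piN -quot_piD; congr (quot_pi _ _); apply: free_cstB.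
have scM : monoid_morphism sc0.
  split=> [//|a b]; rewrite -[RHS]pM; congr p.
  by rewrite -[RHS]quot_piM; congr (quot_pi _ _); apply: free_cstM.
pose sc : {rmorphism k -> A} := HB.pack_for {rmorphism k -> A} sc0
  (GRing.isZmodMorphism.Build k A sc0 scB) (GRing.isMonoidMorphism.Build k A sc0 scM).
have onto (a : A) : exists u, p u = a by have [u ->] := quot_onto a; exists u.
(* The choice of representative is harmless, because [J] annihilates [M]. *)
pose act (a : A) (m : M) : M := (repr a : U) *: m.
have actE u m : act (p u) m = u *: m.
  apply/subr0_eq; rewrite -scalerBl; apply: (iffLR (ideal _)); exact: quot_repr.
have actP : is_action act.
  split.
  - move=> a b m; have [u <-] := onto a; have [v <-] := onto b.
    by rewrite -pM !actE scalerA.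
  - by move=> m; rewrite -[1]/(p 1) actE scale1r.
  - by move=> a m m'; exact: scalerDr.
  by move=> m a b; have [u <-] := onto a; have [v <-] := onto b; rewrite -pD !actE scalerDl.
have [N [psi [psiV [psiK psiVK psiD psiZ]]]] := module_of_action actP.
have psi0 : psi 0 = 0.
  by have /eqP := psiD 0 0; rewrite addr0 -subr_eq subrr eq_sym => /eqP.
have psiVD x y : psiV (x + y) = psiV x + psiV y by rewrite -[RHS]psiK psiD !psiVK.
have psiVZ u x : psiV (u *: x) = pi u *: psiV x by rewrite -[RHS]psiK psiZ actE psiVK.
have simpleN : simple_mod N.
  have [[m mN] simp] := simpleM; split.
    by exists (psiV m) => h; apply: mN; rewrite -[m]psiVK h.
  move=> P P0 PD PZ; have [|||h|h] := simp (fun m => P (psiV m)).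
  - by rewrite -psi0 psiK.
  - by move=> x y hx hy; rewrite psiVD; apply: PD.
  - by move=> u x hx; rewrite psiVZ; apply: PZ.
  - by left=> x Px; rewrite -[x]psiK (h (psi x)) ?psiK // -psi0 psiK.
  by right=> x; rewrite -[x]psiK; exact: h.
have faithN (a : A) : (forall v : N, a *: v = 0) -> a = 0.
  have [u <-] := onto a => h; apply/pJ => m.
  by rewrite -[m]psiVK -actE -psiZ h psi0.
have scC c (a : A) : sc c * a = a * sc c.
  by have [u <-] := onto a; rewrite -[LHS]pM -[RHS]pM Uenv_scalarC.
pose X x : A := p (Uenv_inj x).
have lin a x y : X (a *: x + y) = sc a * X x + X y by rewrite /X Uenv_injP pD pM.
have br x y : X (lie_br x y) = X x * X y - X y * X x by rewrite /X Uenv_inj_br [LHS]pB !pM.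
have gen (P : A -> Prop) : (forall c, P (sc c)) -> (forall x, P (X x)) ->
    (forall a b, P a -> P b -> P (a + b)) -> (forall a b, P a -> P b -> P (a * b)) -> forall a, P a.
  move=> Pc PX PD PM a; have [u <-] := onto a.
  elim/Uenv_ind: u => [//|//|u v Pu Pv|u v Pu Pv]; first by rewrite pD; apply: PD.
  by rewrite pM; apply: PM.
exists (PrimitiveQuotient char0 simpleL serre_ef scC lin br gen simpleN faithN), pi, psiV, psi.
by split=> // u; split=> [h|/pJ //]; apply/pJ.
Qed.
End EnvelopingQuotient.

(** * Weights as functionals on the Cartan subalgebra *)

Section Transport.
Variables (k : closedFieldType) (L : lieAlgebra k) (n : nat) (e f : 'I_n -> L).
Variable S : primitive_quotient e f.
Notation U := (Uenv L).
Notation A := (pq_ring S).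
Notation sc := (pq_sc S).
Notation X := (pq_X S).
Notation H := (pqH S).
Notation B := (pqB S).
Variable pi : {rmorphism U -> A}.
Hypothesis pi_sc : forall c, pi (Uenv_scalar L c) = sc c.
Hypothesis pi_X : forall x, pi (Uenv_inj x) = X x.
Hypothesis pi_onto : forall a, exists u, pi u = a.
Variables (M : lmodType U) (N : lmodType A) (phi : M -> N) (phiV : N -> M).
Hypothesis phiK : cancel phi phiV.
Hypothesis phiVK : cancel phiV phi.
Hypothesis phiD : forall x y, phi (x + y) = phi x + phi y.
Hypothesis phiZ : forall u x, phi (u *: x) = pi u *: phi x.
Notation h := (cartan_subalg e f).

Lemma transport0 : phi 0 = 0.
Proof. by have /eqP := phiD 0 0; rewrite addr0 -subr_eq subrr eq_sym => /eqP. Qed.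

Lemma transport_sum (r : seq M) : phi (\sum_(v <- r) v) = \sum_(v <- r) phi v.
Proof. by elim/big_rec2: _ => [|v y x _ <-]; rewrite ?transport0 ?phiD. Qed.

(** A weight is either its row of values on the coweights or a functional on the span of the
    coroots; the Cartan matrix and its inverse pass from one to the other. *)
Lemma transport_wvec w : exists lam, forall m, wvec w (phi m) -> @weight_space _ _ M h lam m.
Proof.
pose c i := \sum_j B i j * w 0 j.
pose T := [tuple coroot e f i | i < n].
pose lam0 (x : subvs_of h) : k^o := \sum_i coord T i (vsval x) * c i.
have lam_lin : linear lam0.
  move=> a x y; rewrite /lam0 scaler_sumr -big_split; apply: eq_bigr => i _ /=.
  by rewrite !linearP mulrDl [_ *: (_ * _)]mulrA.
pose lamL : {linear subvs_of h -> k^o} := HB.pack lam0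
  (GRing.isLinear.Build k (subvs_of h) k^o *:%R lam0 lam_lin).
exists (linfun lamL) => m hm x; apply: (can_inj phiK).
rewrite !phiZ pi_X pi_sc lfunE /= /lam0.
have xT : vsval x \in <<T>>%VS by exact: subvsP x.
rewrite {1}(coord_span xT) pqX_sum rmorph_sum !scaler_suml; apply: eq_bigr => i _.
by rewrite pqXZ rmorphM -!scalerA; congr (_ *: _); rewrite -(wvec_H _ hm) -tnth_nth tnth_mktuple.
Qed.

Lemma transport_weight lam : exists w, forall m, @weight_space _ _ M h lam m -> wvec w (phi m).
Proof.
have hH i : coroot e f i \in h by apply: memv_span; apply: map_f; rewrite mem_enum.
exists (\row_i \sum_j invmx B i j * lam (vsproj h (coroot e f j))) => m hm i.
rewrite /pqW scaler_suml mxE rmorph_sum scaler_suml; apply: eq_bigr => j _.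
rewrite rmorphM -!scalerA; congr (_ *: _).
by rewrite /pqH -pi_X -pi_sc -!phiZ -hm vsprojK.
Qed.

Lemma transport_cpointed : completely_pointed M h <-> cpointed N.
Proof.
split=> [[wM cp]|[wN cp]]; split.
- move=> x; have [s [xs sw]] := wM (phiV x).
  exists [seq phi v | v <- s]; rewrite big_map -transport_sum -xs phiVK; split=> //.
  move=> _ /mapP [v /sw [lam hv] ->]; have [w hw] := transport_weight lam.
  by exists w; apply: hw.
- move=> w; have [lam hl] := transport_wvec w; have [v hv] := cp lam.
  exists (phi v) => x hx; have [|a xa] := hv (phiV x); first by apply: hl; rewrite phiVK.
  by exists a; rewrite -[x]phiVK xa phiZ pi_sc.
- move=> m; have [s [ms sw]] := wN (phi m).
  exists [seq phiV v | v <- s]; rewrite big_map; split.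
    apply: (can_inj phiK); rewrite ms; elim/big_rec2: _ => [|v y z _]; first by rewrite transport0.
    by rewrite phiD phiVK => <-.
  move=> _ /mapP [v /sw [w hw] ->]; have [lam hl] := transport_wvec w.
  by exists lam; apply: hl; rewrite phiVK.
move=> lam; have [w hw] := transport_weight lam; have [v hv] := cp w.
exists (phiV v) => m /hw /hv [a ma]; exists a; apply: (can_inj phiK).
by rewrite phiZ phiVK pi_sc.
Qed.

Lemma transport_simple : simple_mod N -> simple_module M.
Proof.
move=> [[x xN] simp]; split; first by exists (phiV x) => h; apply: xN; rewrite -[x]phiVK h transport0.
move=> P P0 PD PZ; have [|||hx|hx] := simp (fun x => P (phiV x)).
- by rewrite -transport0 phiK.
- by move=> y z hy hz; rewrite -[y]phiVK -[z]phiVK -phiD !phiK; apply: PD.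
- by move=> a y hy; have [u <-] := pi_onto a; rewrite -[y]phiVK -phiZ phiK; apply: PZ.
- by left=> m Pm; apply: (can_inj phiK); rewrite transport0; apply: hx; rewrite phiK.
by right=> m; rewrite -[m]phiK; exact: hx.
Qed.
End Transport.

Theorem theorem5p13 (k : closedFieldType) (char0 : [pchar k] =i pred0)
  (L : lieAlgebra k) (simpleL : lie_simple L)
  (n : nat) (e f : 'I_n -> L) (serre_ef : serre_generators e f)
  (J : Uenv L -> Prop) (primJ : primitive_ideal J)
  (not_sl2_trivial : ~ (n = 1%N /\ contains_lie J)) :
  (exists (D : tgw_datum k n) (mu : 'I_n -> 'I_n -> k)
          (psi : {rmorphism Uenv L -> TGWA D mu}),
    [/\ forall i j, i != j -> mu i j != 0,
        forall a : k, psi (Uenv_scalar L a) = tgwa_cst mu (a%:A : tgw_ring D),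
        forall y : TGWA D mu, exists u, psi u = y,
        forall u, J u <-> psi u = 0
      & forall i, psi (Uenv_inj (e i)) = tgwa_X D mu i /\
                  psi (Uenv_inj (f i)) = tgwa_Y D mu i]) <->
  (exists M : lmodType (Uenv L),
    [/\ simple_module M,
        completely_pointed M (cartan_subalg e f)
      & forall u, J u <-> annihilator M u]).
Proof.
split=> [[D [mu [psi [mu0 psic psi_onto psiJ psiXY]]]]|[M [simpleM cpM JM]]].
  have [M [simpleM JM]] := primJ.
  have [S [pi [phi [phiV [piJ pi_onto [pi_sc pi_X] [phiK phiVK phiD phiZ]]]]]] :=
    primitive_quotient_exists char0 simpleL serre_ef simpleM.
  have JE u : pi u = 0 <-> psi u = 0 by rewrite -piJ -JM.
  (* [psi] and [pi] have the same kernel [J], so [psi] descends to [A] through any section of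
     [pi]. *)
  have /choice [sec secK] := pi_onto.
  have psE u v : pi u = pi v -> psi u = psi v.
    move=> /eqP; rewrite -subr_eq0 -rmorphB => /eqP /JE; rewrite rmorphB => /eqP.
    by rewrite subr_eq0 => /eqP.
  have comm0 : comm_hdeg0 S.
    apply: (@tgw_comm_hdeg0 _ _ _ _ _ S D mu (fun a => psi (sec a))) => //.
    - by move=> a b; rewrite -rmorphD; apply: psE; rewrite rmorphD !secK.
    - by move=> a b; rewrite -rmorphM; apply: psE; rewrite rmorphM !secK.
    - by move=> c; rewrite -psic; apply: psE; rewrite secK pi_sc.
    - by move=> i; have [<- <-] := psiXY i; split; apply: psE; rewrite secK pi_X.
    move=> a b /eqP; rewrite -subr_eq0 -rmorphB => /eqP /JE /eqP.
    by rewrite rmorphB !secK subr_eq0 => /eqP.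
  have [|_ [N [simpleN cpN faithN]]] := comm_hdeg0_realizable comm0.
    move=> [n1 X0]; apply: not_sl2_trivial; split=> // x.
    by apply/JM/piJ; rewrite pi_X.
  (* The module found over [A] may differ from [M]; its pullback along [pi] has annihilator [J]
     because it is faithful over [A]. *)
  have [|M' [chi [chiV [chiK chiVK chiD chiZ]]]] :=
    @module_of_action (Uenv L) N (fun u m => pi u *: m).
    split=> [a b m|m|a m m'|m a b]; rewrite ?rmorphM ?rmorph1 ?rmorphD ?scalerA //.
    + by rewrite scale1r.
    + by rewrite scalerDr.
    by rewrite scalerDl.
  exists M'; split.
  - exact: (transport_simple pi_onto chiK chiVK chiD chiZ simpleN).
  - by apply/(transport_cpointed pi_sc pi_X chiK chiVK chiD chiZ).
  move=> u; rewrite JM piJ; split=> [u0 m|h].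
    by apply: (can_inj chiK); rewrite chiZ u0 scale0r (transport0 chiD).
  by apply: faithN => x; rewrite -[x]chiVK -chiZ h (transport0 chiD).
have [S [pi [phi [phiV [piJ pi_onto [pi_sc pi_X] [phiK phiVK phiD phiZ]]]]]] :=
  primitive_quotient_exists char0 simpleL serre_ef simpleM.
have cpV : cpointed (pq_mod S) by apply/(transport_cpointed pi_sc pi_X phiK phiVK phiD phiZ).
have [|[D [mu [psi [mu0 [[psiD psiM] [psi1 psic] psiXY psi_inj psi_onto]]]]] _] :=
  comm_hdeg0_realizable (cpointed_comm_hdeg0 cpV).
  move=> [n1 X0]; apply: not_sl2_trivial; split=> // x.
  by apply/JM/piJ; rewrite pi_X.
pose g u := psi (pi u).
have gB : zmod_morphism g.
  move=> u v; apply: (addIr (g v)); rewrite subrK /g -psiD -rmorphD subrK //.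
have gM : monoid_morphism g by split=> [|u v]; rewrite /g ?rmorph1 // rmorphM psiM.
pose G : {rmorphism Uenv L -> TGWA D mu} := HB.pack_for {rmorphism Uenv L -> TGWA D mu} g
  (GRing.isZmodMorphism.Build (Uenv L) (TGWA D mu) g gB)
  (GRing.isMonoidMorphism.Build (Uenv L) (TGWA D mu) g gM).
exists D, mu, G; split=> //.
- by move=> a; rewrite /= /g pi_sc psic.
- by move=> y; have [a <-] := psi_onto y; have [u <-] := pi_onto a; exists u.
- move=> u; rewrite JM piJ; split=> [u0|/psi_inj //].
  by rewrite -[LHS]/(psi (pi u)) u0 -(rmorph0 pi) -[LHS]/(G 0) rmorph0.
by move=> i; rewrite /= /g !pi_X; exact: psiXY.
Qed.
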